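(* Let $\lambda\ge0$, let the means $\mu_i=c_i-\lambda/\bar q_i-\lambda_i/q_i$ satisfy $\mu_1,\mu_2<0$, $r_1|\mu_1|>|\mu_2|$, $r_2|\mu_2|>|\mu_1|$, and assume that for neither $(i,j)=(1,2)$ nor $(i,j)=(2,1)$ both equalities $c_i=r_jc_j$ and $\bar q_i=\bar q_j/r_j$ hold. Write $$A=\frac{r_1}{\bar q_1}-\frac1{\bar q_2},\qquad B=\frac{r_2}{\bar q_2}-\frac1{\bar q_1},\qquad N=1+\frac{s_1}{\bar q_1}+\frac{s_2}{\bar q_2},$$ $$\psi_1=c_2-\frac{\lambda/\bar q_2}{N(1-Bs_1)}-\frac{\lambda_2/q_2}{(1+s_2/q_2)(1-r_2s_1/q_2)},\qquad \psi_2=c_1-\frac{\lambda/\bar q_1}{N(1-As_2)}-\frac{\lambda_1/q_1}{(1+s_1/q_1)(1-r_1s_2/q_1)},$$ $$\psi_5=\frac{\lambda_2/q_2}{(1+s_2/q_2)(1-r_2s_1/q_2)},\qquad\psi_6=\frac{\lambda_1/q_1}{(1+s_1/q_1)(1-r_1s_2/q_1)}.$$ Then the following kernel equations are satisfied: (1) If $A>0$ and $B>0$, then $$\begin{aligned}\psi F(s_1,s_2)={}&\psi_1F_1(s_1)+\psi_2F_2(s_2)+\frac{\lambda/\bar q_2}{N(1-Bs_1)}F_1\!\left(\frac{r_1+As_1}{(r_1r_2-1)/\bar q_2}\right)+\frac{\lambda/\bar q_1}{N(1-As_2)}F_2\!\left(\frac{r_2+Bs_2}{(r_1r_2-1)/\bar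 q_1}\right)\\&+\psi_5F_1(q_2/r_2)+\psi_6F_2(q_1/r_1)-\frac{\lambda\left[ABN+r_1/\bar q_1^2+r_2/\bar q_2^2-2/(\bar q_1\bar q_2)\right]}{N(r_1+As_1)(r_2+Bs_2)}\,p_1(0,0).\end{aligned}$$ (2) If $A>0$ and $B\le0$, then $$\begin{aligned}\psi F(s_1,s_2)={}&\psi_1F_1(s_1)+\psi_2F_2(s_2)+\frac{\lambda/\bar q_2}{N(1-Bs_1)}F_1\!\left(\frac{r_1+As_1}{(r_1r_2-1)/\bar q_2}\right)+\frac{\lambda/\bar q_2}{N(r_1+As_1)}F_2\!\left(\frac{1-Bs_1}{(r_1r_2-1)/\bar q_2}\right)\\&+\psi_5F_1(q_2/r_2)+\psi_6F_2(q_1/r_1)+\frac{\lambda A}{(r_1+As_1)(1-As_2)}F_2(1/A)-\frac{\lambda(r_1r_2-1)/\bar q_2^2}{N(r_1+As_1)(1-Bs_1)}\,p_1(0,0).\end{aligned}$$ (3) If $A\le0$ and $B>0$, then the equation of case (2) holds with the indices $1$ and $2$ changed correspondingly: $$\begin{aligned}\psi F(s_1,s_2)={}&\psi_1F_1(s_1)+\psi_2F_2(s_2)+\frac{\lambda/\bar q_1}{N(1-As_2)}F_2\!\left(\frac{r_2+Bs_2}{(r_1r_2-1)/\bar q_1}\right)+\frac{\lambda/\bar q_1}{N(r_2+Bs_2)}F_1\!\left(\frac{1-As_2}{(r_1r_2-1)/\bar q_1}\right)\\&+\psi_5F_1(q_2/r_2)+\psi_6F_2(q_1/r_1)+\frac{\lambda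 B}{(r_2+Bs_2)(1-Bs_1)}F_1(1/B)-\frac{\lambda(r_1r_2-1)/\bar q_1^2}{N(r_2+Bs_2)(1-As_2)}\,p_1(0,0).\end{aligned}$$
   Context: Let $c_i,q_i,\bar q_i,\lambda_i,r_i>0$ ($i=1,2$) and $\lambda\ge0$. Let $N_0,N_1,N_2$ be independent Poisson processes with rates $\lambda,\lambda_1,\lambda_2$ and $J_k,J_k^{(1)},J_k^{(2)}$ independent standard exponential variables, independent of the Poisson processes. The free process is $$X_i(t)=c_it-\frac1{\bar q_i}\sum_{k=1}^{N_0(t)}J_k-\frac1{q_i}\sum_{k=1}^{N_i(t)}J_k^{(i)},\qquad i=1,2,$$ with Laplace exponent $$\psi=\psi(s_1,s_2)=c_1s_1+c_2s_2-(\lambda+\lambda_1+\lambda_2)+\frac{\lambda}{1+s_1/\bar q_1+s_2/\bar q_2}+\frac{\lambda_1}{1+s_1/q_1}+\frac{\lambda_2}{1+s_2/q_2}.$$ The reflected process $Y=(Y_1,Y_2)$ started at $(u,v)\in[0,\infty)^2$ moves linearly with velocity $(c_1,c_2)$ between jumps of $X$; at a jump epoch $T$, with $x_i=Y_i(T-)+\Delta X_i(T)$, one sets $Y(T)=(y_1,y_2)$ where: $y=x$ if $x_1,x_2\ge0$; $y=(0,x_2-r_1x_1)$ if $x_1<\min(r_2x_2,0)$; $y=(x_1-r_2x_2,0)$ if $x_2<\min(r_1x_1,0)$; and $y=(0,0)$ in the remaining case $x_1,x_2<0$, $x_1\ge r_2x_2$, $x_2\ge r_1x_1$. Let $$p_1(u,v)=\mathbb{P}_{(u,v)}\{Y_1(t)\to\infty,\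 Y_2(t)/Y_1(t)\to0\text{ as }t\to\infty\},$$ and for $s_1,s_2>0$ $$F(s_1,s_2)=\int_0^\infty\!\!\int_0^\infty e^{-s_1u-s_2v}p_1(u,v)\,du\,dv,\quad F_1(s_1)=\int_0^\infty e^{-s_1u}p_1(u,0)\,du,\quad F_2(s_2)=\int_0^\infty e^{-s_2v}p_1(0,v)\,dv.$$
   Formalization: In case (1) the bracket multiplying p1(0,0) is corrected from ABN+… to AB(N+1)+…, since the printed equation fails whenever λ>0; the equations are stated where 1−Bs1, 1−As2, 1−r2s1/q2 and 1−r1s2/q1 are nonzero. *)

(* Defs.v *)
(* MathComp-Analysis *)
From HB Require Import structures.
From mathcomp Require Export all_boot all_order all_algebra.
From mathcomp Require Export all_classical all_reals all_analysis.
Export Order.TTheory GRing.Theory Num.Theory.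
Export numFieldNormedType.Exports.

Set Implicit Arguments.
Unset Strict Implicit.
Unset Printing Implicit Defensive.

Local Open Scope classical_set_scope.
Local Open Scope ring_scope.

Section independence.
Context d (T : measurableType d) (R : realType) (P : probability T R).

Definition mutually_independent (I : eqType) (G : I -> set_system T) :=
  forall (s : seq I) (E : I -> set T), uniq s ->
    (forall i, i \in s -> G i (E i)) ->
    P (\big[setI/setT]_(i <- s) E i) = (\prod_(i <- s) P (E i))%E.

Definition sigma_rv d' (T' : measurableType d') (X : T -> T') : set_system T :=
  preimage_set_system setT X measurable.

Definition sigma_process d' (T' : measurableType d') (X : R -> T -> T') :
    set_system T :=
  <<s \bigcup_(t in [set t : R | 0 <= t]) sigma_rv (X t) >>.

End independence.

Section driving_processes.
Context d (T : measurableType d) (R : realType) (P : probability T R).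

(* The second argument of [poisson_prob] is not used by its definition;
   [poisson_prob 0 _] is the Dirac mass at 0. *)
Record poisson_process (rate : R) (N : R -> T -> nat) : Prop := {
  poisson_measurable : forall t, 0 <= t -> measurable_fun setT (N t) ;
  poisson_start : forall w, N 0 w = 0%N ;
  poisson_nondecreasing : forall w s t, 0 <= s -> s <= t -> (N s w <= N t w)%N ;
  poisson_right_continuous : forall w t, 0 <= t ->
    \forall s \near t^'+, N s w = N t w ;
  poisson_increment : forall s t, 0 <= s -> s <= t -> forall U : set nat,
    P ((fun w => N t w - N s w)%N @^-1` U)
    = poisson_prob (rate * (t - s)) 0%N U ;
  poisson_independent_increments : forall t : nat -> R, 0 <= t 0%N ->
    {homo t : m n / (m <= n)%N >-> m <= n} ->
    mutually_independent P
      (fun i => sigma_rv (fun w => N (t i.+1) w - N (t i) w)%N) }.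

(* The index 0 stands for the common shocks, the indices 1 and 2 for those of
   the single components; jump sizes are numbered from 0. *)
Record shock_model (lam lam1 lam2 : R) (N : 'I_3 -> R -> T -> nat)
    (J : 'I_3 -> nat -> {RV P >-> R}) : Prop := {
  shock_poisson :
    forall i, poisson_process (tnth [tuple lam; lam1; lam2] i) (N i) ;
  shock_exponential : forall i k (U : set R), measurable U ->
    P (J i k @^-1` U) = exponential_prob 1 U ;
  shock_independent :
    mutually_independent P (fun x : 'I_3 + 'I_3 * nat =>
      match x with
      | inl i => sigma_process (N i)
      | inr (i, k) => sigma_rv (J i k)
      end) }.

Definition free_process (c1 c2 q1 q2 qb1 qb2 : R) (N : 'I_3 -> R -> T -> nat)
    (J : 'I_3 -> nat -> {RV P >-> R}) (w : T) (t : R) : R * R :=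
  (c1 * t - qb1^-1 * (\sum_(k < N 0 t w) J 0 k w)
          - q1^-1 * (\sum_(k < N 1 t w) J 1 k w),
   c2 * t - qb2^-1 * (\sum_(k < N 0 t w) J 0 k w)
          - q2^-1 * (\sum_(k < N 2%:R t w) J 2%:R k w)).

End driving_processes.

Section reflection.
Context (R : realType).

(* The second and third regions overlap only if r1 * r2 < 1. *)
Definition reflect_point (r1 r2 : R) (x : R * R) : R * R :=
  if (0 <= x.1) && (0 <= x.2) then x
  else if x.1 < Num.min (r2 * x.2) 0 then (0, x.2 - r1 * x.1)
  else if x.2 < Num.min (r1 * x.1) 0 then (x.1 - r2 * x.2, 0)
  else (0, 0).

Definition left_limit (X : R -> R * R) (t : R) : R * R :=
  (lim ((X s).1 @[s --> t^'-]), lim ((X s).2 @[s --> t^'-])).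

Definition jump (X : R -> R * R) (t : R) : R * R := X t - left_limit X t.

Record reflected_path (c1 c2 r1 r2 : R) (X : R -> R * R) (u v : R)
    (Y : R -> R * R) : Prop := {
  reflected_start : Y 0 = (u, v) ;
  reflected_linear : forall s t, 0 <= s -> s <= t ->
    (forall z, s < z -> z <= t -> jump X z = 0) ->
    Y t = Y s + (c1 * (t - s), c2 * (t - s)) ;
  reflected_jump : forall t, 0 < t -> jump X t != 0 ->
    Y t = reflect_point r1 r2 (left_limit Y t + jump X t) }.

End reflection.

Section escape_probability.
Context d (T : measurableType d) (R : realType) (P : probability T R).

(* Y u v w is the trajectory started at (u, v) for the outcome w. *)
Definition escape_prob1 (Y : R -> R -> T -> R -> R * R) (u v : R) : R :=
  fine (P [set w | (Y u v w t).1 @[t --> +oo] --> +oo /\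
                   (Y u v w t).2 / (Y u v w t).1 @[t --> +oo] --> 0]).

End escape_probability.

Section laplace.
Context (R : realType).
Local Notation mu := (@lebesgue_measure R).

Definition laplace (f : R -> R) (s : R) : R :=
  \int[mu]_(u in `[0, +oo[) (expR (- s * u) * f u).

Definition laplace2 (f : R -> R -> R) (s1 s2 : R) : R :=
  \int[mu]_(v in `[0, +oo[) \int[mu]_(u in `[0, +oo[)
    (expR (- s1 * u - s2 * v) * f u v).

End laplace.

(* Main.v *)
(* The driving processes are one random path with independent increments, and the
   reflected trajectory is a measurable functional of it.  By the Markov
   property at a small time h, the escape probability q satisfies, up to O(h^2),
   q(z) = E q(Y(h)) restricted to the events of no shock and of exactly one shock
   before h.  Taking double Laplace transforms and letting h -> 0, the drift
   yields c1 s1 + c2 s2 and the boundary terms c2 F1 and c1 F2, and each kind of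
   shock yields the transform of z |-> E q(R(z - jump)), R being the reflection.
   The latter splits along the four regions of R.  The quadrant gives F / N.  On
   the side x1 < min(r2 x2, 0), put x1 = - m and x2 = y - r1 m: the integral over
   m of an exponential is a difference of two exponentials of y, the integrand
   changing form at m = y / (qb1 A) when this value is in range, which is what
   separates the cases A, B > 0 from the others.  The mass of the cone sent to
   the origin is obtained from the total mass. *)
From HB Require Import structures.
Require Import Defs.
From mathcomp Require Import measurable_realfun zify lra ring.

Set Implicit Arguments.
Unset Strict Implicit.
Unset Printing Implicit Defensive.

Local Open Scope classical_set_scope.
Local Open Scope ring_scope.

(** * Reflected trajectories driven by a deterministic path *)

(** [Y] is only assumed to satisfy [reflected_path] outcome by outcome; nothing is assumed about its
    measurability. Hence the detour through a type of deterministic paths: there the trajectory is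
    an explicit [flow], escape is a measurable set of pairs (start, path), and the escape
    probability becomes the measurable function [escape_law] on the whole plane, equal to
    [escape_prob1] on the quadrant. The inequality r1 r2 > 1, which makes the reflection land in the
    quadrant and its regions disjoint, comes from the two domination inequalities between the means.
    The law of the first shock time never enters: shifting a single shock within [0, h] costs O(h)
    on an event of probability O(h). The only continuity estimate for the escape probability is a
    Lipschitz bound along the drift; displacements in other directions are absorbed by the Laplace
    integration, which turns a translation of the start into a boundary layer and an exponential
    factor. The limit h -> 0 is taken in finite form: if h x is bounded by C h^2 for all small h,
    then x = 0. *)

Section reflection_theory.
Context (R : realType) (c1 c2 r1 r2 : R).
Hypotheses (r1_gt0 : 0 < r1) (r2_gt0 : 0 < r2) (r12 : 1 < r1 * r2).

Definition quadrant : set (R * R) := [set x | 0 <= x.1 /\ 0 <= x.2].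

Lemma reflect_point_id x : quadrant x -> reflect_point r1 r2 x = x.
Proof. by move=> [x1 x2]; rewrite /reflect_point x1 x2. Qed.

(** Only negative x2 (or, symmetrically, negative x1) needs r1 r2 > 1: from x1 < r2 x2 one gets r1
    x1 < r1 r2 x2 < x2, so the new coordinate x2 - r1 x1 is positive. *)
Lemma reflect_point_quadrant x : quadrant (reflect_point r1 r2 x).
Proof.
rewrite /reflect_point /quadrant; case: x => x1 x2 /=.
case: ifPn => [/andP[]//|ge0N].
rewrite !lt_min; case: ifPn => /= [/andP[x12 x10]|lt1N].
  split=> //; case: (lerP 0 x2) => x20.
    by rewrite subr_ge0 (le_trans _ x20)// pmulr_rle0// ltW.
  have : 0 < r1 * (r2 * x2 - x1) by rewrite mulr_gt0// subr_gt0.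
  have : 0 < (r1 * r2 - 1) * - x2
    by rewrite mulr_gt0 ?subr_gt0 ?oppr_gt0.
  by lra.
case: ifPn => /= [/andP[x21 x20]|lt2N].
  split=> //; case: (lerP 0 x1) => x10'.
    by rewrite subr_ge0 (le_trans _ x10')// pmulr_rle0// ltW.
  have : 0 < r2 * (r1 * x1 - x2) by rewrite mulr_gt0// subr_gt0.
  have : 0 < (r1 * r2 - 1) * - x1
    by rewrite mulr_gt0 ?subr_gt0 ?oppr_gt0.
  by lra.
by split.
Qed.

Lemma left_limit_linear (X : R -> R * R) (a : R * R) s t : s < t ->
  (forall z, s < z -> z < t -> X z = a + (c1 * z, c2 * z)) ->
  left_limit X t = a + (c1 * t, c2 * t).
Proof.
move=> st Xa; have lin (b c : R) : b + c * z @[z --> t^'-] --> b + c * t.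
  apply: cvg_at_left_filter; apply: cvgD; first exact: cvg_cst.
  by apply: cvgM; [exact: cvg_cst|exact: cvg_id].
have nearX : \forall z \near t^'-, a + (c1 * z, c2 * z) = X z.
  by apply: filterS2 (nbhs_left_gt st) (nbhs_left_lt t) => z sz zt; rewrite Xa.
rewrite /left_limit; congr pair; apply/cvg_lim => //;
  [apply: cvg_trans (lin a.1 c1)|apply: cvg_trans (lin a.2 c2)];
  apply: near_eq_cvg; by apply: filterS nearX => z /= <-.
Qed.

End reflection_theory.

(** The outcome-wise content of [shock_model]. As a type it can carry a sigma-algebra, and
    trajectories become functions of a single argument. *)
Record path (R : realType) := Path {
  count : 'I_3 -> R -> nat ;
  size_of : 'I_3 -> nat -> R ;
  count_nondecreasing : forall i s t, 0 <= s -> s <= t ->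
    (count i s <= count i t)%N ;
  count_right_continuous : forall i t, 0 <= t ->
    \forall s \near t^'+, count i s = count i t }.

(** * The trajectory as an explicit function of the driving path *)

Section path_dynamics.
Context (R : realType) (c1 c2 q1 q2 qb1 qb2 r1 r2 : R).
Hypotheses (r1_gt0 : 0 < r1) (r2_gt0 : 0 < r2) (r12 : 1 < r1 * r2).
Implicit Types (e : path R) (s t : R) (z : R * R).

Definition total e t : nat := (\sum_(i < 3) count e i t)%N.

Definition pure_jump e t : R * R :=
  (- (qb1^-1 * (\sum_(k < count e 0 t) size_of e 0 k))
     - q1^-1 * (\sum_(k < count e 1 t) size_of e 1 k),
   - (qb2^-1 * (\sum_(k < count e 0 t) size_of e 0 k))
     - q2^-1 * (\sum_(k < count e 2%:R t) size_of e 2%:R k)).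

Definition drift t : R * R := (c1 * t, c2 * t).

(* The successive jump times of the total count, capped at t: t is reached after
   total e t + 1 steps. *)
Fixpoint stage_time e t n : R :=
  if n is m.+1 then
    if (total e (stage_time e t m) < total e t)%N then
      inf [set x | 0 <= x /\ (total e (stage_time e t m) < total e x)%N]
    else t
  else 0.

(** The reflection is applied at every stage, even when the stage ends at [t] without a jump: the
    point then lies in the quadrant, where the reflection is the identity. This keeps one formula
    for all stages. *)
Fixpoint stage e t z n : R * R :=
  if n is m.+1 then
    reflect_point r1 r2 (stage e t z m
      + drift (stage_time e t m.+1 - stage_time e t m)
      + (pure_jump e (stage_time e t m.+1) - pure_jump e (stage_time e t m)))
  else z.

Definition flow e t z := stage e t z (total e t).+1.

Definition free_path e t := drift t + pure_jump e t.

Lemma total_nondecreasing e s t : 0 <= s -> s <= t -> (total e s <= total e t)%N.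
Proof. by move=> s0 st; apply: leq_sum => i _; exact: count_nondecreasing. Qed.

Lemma total_right_continuous e t : 0 <= t ->
  \forall s \near t^'+, total e s = total e t.
Proof.
move=> t0; have : \forall s \near t^'+, forall i : 'I_3, count e i s = count e i t.
  by apply: filter_forall => i; exact: count_right_continuous.
by apply: filterS => s st; apply: eq_bigr => i _; rewrite st.
Qed.

Lemma total_eq_count e s t i : 0 <= s -> s <= t -> total e s = total e t ->
  count e i s = count e i t.
Proof.
move=> s0 st tot; have cd j := count_nondecreasing e j s0 st.
apply/eqP; rewrite eqn_leq cd/= leqNgt; apply/negP => lt_i.
move: tot; rewrite /total (bigD1 i)//= [RHS](bigD1 i)//= => /eqP.
apply/negP; rewrite neq_ltn; apply/orP; left; rewrite -addSn leq_add//.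
by apply: leq_sum => j _; exact: cd.
Qed.

Lemma total_eq_pure_jump e s t : 0 <= s -> s <= t -> total e s = total e t ->
  pure_jump e s = pure_jump e t.
Proof. by move=> s0 st tot; rewrite /pure_jump !(total_eq_count _ s0 st tot). Qed.

Section first_passage.
Variables (e : path R) (m : nat) (t : R).
Hypotheses (t_ge0 : 0 <= t) (mt : (m < total e t)%N).
Let S := [set x | 0 <= x /\ (m < total e x)%N].

Let hasinfS : has_inf S.
Proof. by split; [exists t|exists 0 => x []]. Qed.

Lemma passage_le : inf S <= t.
Proof. by apply: ge_inf; [case: hasinfS|]. Qed.

Lemma passage_ge0 : 0 <= inf S.
Proof. by apply: lb_le_inf; [case: hasinfS|move=> x []]. Qed.

Lemma passage_lt x : 0 <= x -> x < inf S -> (total e x <= m)%N.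
Proof.
move=> x0; rewrite leqNgt ltNge; apply: contra => mx.
by apply: ge_inf; [case: hasinfS|].
Qed.

(** The infimum is attained by right continuity: the total count is constant just after [inf S], and
    some element of [S] lies in that range. *)
Lemma passage_gt : (m < total e (inf S))%N.
Proof.
have [b b_gt be] : exists2 b, inf S < b & total e b = total e (inf S)
    /\ forall x, inf S < x -> x < b -> total e x = total e (inf S).
  have := total_right_continuous e passage_ge0.
  rewrite near_withinE => /nbhs_ballP[d /= d0 dS].
  have hd x : inf S < x -> x < inf S + d -> total e x = total e (inf S).
    move=> x1 x2; apply: dS => //; rewrite /ball/= distrC ger0_norm ?subr_ge0 ?ltW//.
    by rewrite ltrBlDl.
  exists (inf S + d / 2); first by rewrite ltrDl divr_gt0.
  split=> [|x x1 x2]; apply: hd => //; first by rewrite ltrDl divr_gt0.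
    by rewrite ltrD2l ltr_pdivrMr// ltr_pMr// ltr1n.
  by apply: (lt_trans x2); rewrite ltrD2l ltr_pdivrMr// ltr_pMr// ltr1n.
have [x Sx xb] := inf_lt hasinfS.1 b_gt.
have := ge_inf hasinfS.2 Sx; rewrite le_eqVlt => /predU1P[->|ltx].
  by case: Sx.
by rewrite -(be.2 x)//; case: Sx.
Qed.

End first_passage.

Lemma free_path_left_limit e s t : 0 <= s -> s < t ->
  (forall x, s <= x -> x < t -> total e x = total e s) ->
  left_limit (free_path e) t = pure_jump e s + drift t.
Proof.
move=> s0 st tot; apply: (left_limit_linear st) => z sz zt.
rewrite /free_path addrC -(total_eq_pure_jump s0 (ltW sz))//.
by rewrite (tot z)// ltW.
Qed.

Lemma free_path_jump e s t : 0 <= s -> s < t ->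
  (forall x, s <= x -> x < t -> total e x = total e s) ->
  jump (free_path e) t = pure_jump e t - pure_jump e s.
Proof.
move=> s0 st tot; rewrite /jump (free_path_left_limit s0 st tot) /free_path.
by rewrite [drift t + _]addrC [pure_jump e s + _]addrC addrKA.
Qed.

Lemma free_path_jump0 e (s t x : R) : 0 <= s -> s < t ->
  (forall x, s <= x -> x < t -> total e x = total e s) ->
  s < x -> x < t -> jump (free_path e) x = 0.
Proof.
move=> s0 st tot sx xt; rewrite (free_path_jump s0 sx).
  by rewrite (total_eq_pure_jump s0 (ltW sx)) ?subrr// (tot x)// ltW.
by move=> y sy yx; apply: tot => //; exact: lt_trans xt.
Qed.

Section reflected.
Variables (e : path R) (X Y : R -> R * R) (u v : R).
Hypotheses (XE : X = free_path e) (rY : reflected_path c1 c2 r1 r2 X u v Y).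
Hypotheses (uv : quadrant (u, v)).

Lemma reflected_linear_step s t : 0 <= s -> s <= t ->
  (forall x, s <= x -> x <= t -> total e x = total e s) ->
  Y t = Y s + drift (t - s).
Proof.
move=> s0 st tot; apply: (reflected_linear rY) => // z sz zt; rewrite XE.
rewrite (free_path_jump s0 sz) ?(total_eq_pure_jump s0 (ltW sz)) ?subrr//.
  by rewrite (tot z)// ltW.
by move=> x sx xz; apply: tot => //; exact: le_trans (ltW xz) zt.
Qed.

(** The count may change at [t] while the jump vanishes there, since sizes may be zero. In that case
    the linear clause of [reflected_path] covers the whole interval up to [t], and the reflection
    acts trivially; otherwise the jump clause applies. *)
Lemma reflected_step s t : 0 <= s -> s <= t ->
  (forall x, s <= x -> x < t -> total e x = total e s) -> quadrant (Y s) ->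
  quadrant (Y s + drift (t - s)) ->
  Y t = reflect_point r1 r2
    (Y s + drift (t - s) + (pure_jump e t - pure_jump e s)).
Proof.
move=> s0; rewrite le_eqVlt => /predU1P[<- _ Ys _|st tot Ys Yst].
  by rewrite subrr /drift !mulr0 subrr !addr0 reflect_point_id.
have lim : left_limit Y t = Y s + drift (t - s).
  rewrite (_ : Y s + drift (t - s) = (Y s - drift s) + drift t); last first.
    by rewrite /drift !mulrBr -addrA; congr +%R; congr pair; rewrite addrC.
  apply: (left_limit_linear st) => z sz zt.
  rewrite (@reflected_linear_step s z)// ?ltW//; last first.
    by move=> x sx xz; apply: tot => //; exact: le_lt_trans zt.
  by rewrite /drift !mulrBr -addrA; congr +%R; congr pair; rewrite addrC.
have [J0|J0] := eqVneq (jump X t) 0; last first.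
  rewrite (reflected_jump rY)//; last exact: le_lt_trans st.
  by rewrite lim XE (free_path_jump s0 st tot).
rewrite -(free_path_jump s0 st tot) -XE J0 addr0 reflect_point_id//.
apply: (reflected_linear rY) => //; first exact: ltW.
move=> z sz; rewrite le_eqVlt => /predU1P[->//|zt].
by rewrite XE (free_path_jump0 s0 st tot).
Qed.

End reflected.

Section stages.
Variables (e : path R) (t : R) (t_ge0 : 0 <= t).
Local Notation T := (stage_time e t).

Lemma stage_time_itv n : 0 <= T n <= t.
Proof.
elim: n => [|n /andP[Tn0 Tnt]] /=; first by rewrite lexx.
case: ifPn => // [mt|_]; last by rewrite t_ge0 lexx.
by rewrite (passage_ge0 t_ge0 mt) (passage_le t_ge0 mt).
Qed.

Lemma stage_time_ge0 n : 0 <= T n. Proof. by case/andP: (stage_time_itv n). Qed.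

Lemma stage_time_le n : T n <= t. Proof. by case/andP: (stage_time_itv n). Qed.

Lemma stage_time_nondecreasing n : T n <= T n.+1.
Proof.
rewrite /=; case: ifPn => [mt|_]; last exact: stage_time_le.
rewrite leNgt; apply/negP => lt_inf.
have := passage_gt t_ge0 mt; rewrite ltnNge => /negP; apply.
by apply: total_nondecreasing; [exact: passage_ge0 t_ge0 mt|exact: ltW].
Qed.

Lemma stage_time_constant n x : T n <= x -> x < T n.+1 ->
  total e x = total e (T n).
Proof.
move=> Tx; have x0 : 0 <= x by exact: le_trans (stage_time_ge0 n) Tx.
have Tn0 := stage_time_ge0 n.
rewrite /=; case: ifPn => [mt xinf|]; last first.
  rewrite -leqNgt => tT xt; apply/eqP; rewrite eqn_leq; apply/andP.
  split; last exact: total_nondecreasing.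
  by apply: leq_trans tT; rewrite total_nondecreasing// ltW.
apply/eqP; rewrite eqn_leq; apply/andP; split; last exact: total_nondecreasing.
exact: passage_lt t_ge0 mt x x0 xinf.
Qed.

(** Simultaneous shocks only speed up the progress, so each stage gains at least one count until all
    the counts up to [t] are exhausted. *)
Lemma stage_time_progress n :
  (n <= total e (T n))%N \/ (total e t <= total e (T n))%N.
Proof.
elim: n => [|n IHn]; first by left.
rewrite /=; case: ifPn => [mt|_]; last by right.
left; apply: leq_trans (passage_gt t_ge0 mt).
by case: IHn => // tT; move: mt; rewrite ltnNge tT.
Qed.

(** At stage [total e t] both alternatives of [stage_time_progress] say that no count is left, so
    that the next stage time is [t] itself. *)
Lemma stage_time_end : T (total e t).+1 = t.
Proof.
by rewrite /=; case: ifPn => //; rewrite ltnNge; case: (stage_time_progress (total e t)) => ->.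
Qed.

End stages.

(** The sets whose infima are taken involve counts beyond [t], where the paths may differ. Each
    infimum is nevertheless attained no later than [t], hence belongs to the other set too. *)
Lemma stage_time_ext e e' t n : 0 <= t ->
  (forall i s, 0 <= s -> s <= t -> count e i s = count e' i s) ->
  stage_time e t n = stage_time e' t n.
Proof.
move=> t0 ee'; have tot s : 0 <= s -> s <= t -> total e s = total e' s.
  by move=> s0 st; apply: eq_bigr => i _; rewrite ee'.
elim: n => //= n <-.
have Tn0 := stage_time_ge0 e t0 n; have Tnt := stage_time_le e t0 n.
rewrite -!tot//; case: ifPn => // mt; have mt' := mt; rewrite (tot t)// in mt'.
apply/eqP; rewrite eq_le; apply/andP; split.
  apply: ge_inf; first by exists 0 => x [].
  split; first exact: passage_ge0 t0 mt'.
  by rewrite (tot (inf _)); [exact: passage_gt t0 mt'|exact: passage_ge0 t0 mt'|exact: passage_le t0 mt'].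
apply: ge_inf; first by exists 0 => x [].
split; first exact: passage_ge0 t0 mt.
by rewrite -(tot (inf _)); [exact: passage_gt t0 mt|exact: passage_ge0 t0 mt|exact: passage_le t0 mt].
Qed.

Lemma pure_jump_ext e e' s : (forall i, count e i s = count e' i s) ->
  (forall i k, (k < count e i s)%N -> size_of e i k = size_of e' i k) ->
  pure_jump e s = pure_jump e' s.
Proof.
move=> ee' JJ'; rewrite /pure_jump -!ee'.
by congr pair; congr (- (_ * _) - (_ * _)); apply: eq_bigr => k _; rewrite JJ'.
Qed.

Lemma flow_ext e e' t z : 0 <= t ->
  (forall i s, 0 <= s -> s <= t -> count e i s = count e' i s) ->
  (forall i k, (k < count e i t)%N -> size_of e i k = size_of e' i k) ->
  flow e t z = flow e' t z.
Proof.
move=> t0 ee' JJ'; rewrite /flow.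
have -> : total e' t = total e t by apply: eq_bigr => i _; rewrite ee'.
elim: _.+1 => //= n ->.
have pj m : pure_jump e (stage_time e t m) = pure_jump e' (stage_time e' t m).
  rewrite -(stage_time_ext _ t0 ee'); apply: pure_jump_ext => i.
    by rewrite ee'// ?stage_time_ge0 ?stage_time_le.
  move=> k kl; apply: JJ'; apply: leq_trans kl _; apply: count_nondecreasing.
    exact: stage_time_ge0.
  exact: stage_time_le.
have := pj n.+1; have := pj n; have := stage_time_ext n.+1 t0 ee'.
by rewrite /= => -> -> ->; rewrite (stage_time_ext _ t0 ee').
Qed.

Hypotheses (c1_ge0 : 0 <= c1) (c2_ge0 : 0 <= c2).

Lemma quadrant_drift x t : 0 <= t -> quadrant x -> quadrant (x + drift t).
Proof. by move=> t0 [x1 x2]; split; rewrite addr_ge0// mulr_ge0. Qed.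

(** One rule in place of the two clauses of [reflected_path], free of left limits. It determines the
    trajectory and is stable under restarting at a later time. *)
Definition evolves e (Y : R -> R * R) := forall s t, 0 <= s -> s <= t ->
  (forall x, s <= x -> x < t -> total e x = total e s) -> quadrant (Y s) ->
  Y t = reflect_point r1 r2
    (Y s + drift (t - s) + (pure_jump e t - pure_jump e s)).

Lemma reflected_evolves e X Y u v : X = free_path e ->
  reflected_path c1 c2 r1 r2 X u v Y -> quadrant (u, v) -> evolves e Y.
Proof.
move=> XE rY uv s t s0 st tot Ys; apply: (reflected_step XE rY) => //.
by apply: quadrant_drift => //; rewrite subr_ge0.
Qed.

Section evolving.
Variables (e : path R) (Y : R -> R * R).
Hypotheses (eY : evolves e Y) (Y0 : quadrant (Y 0)).

Lemma evolves_stage t n : 0 <= t ->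
  Y (stage_time e t n) = stage e t (Y 0) n /\ quadrant (stage e t (Y 0) n).
Proof.
move=> t0; elim: n => [|n [Yn Qn]]; first by [].
have Tn0 := stage_time_ge0 e t0 n; have Tnt := stage_time_nondecreasing e t0 n.
split; last exact: reflect_point_quadrant.
rewrite (eY Tn0 Tnt) ?Yn// => x; exact: stage_time_constant.
Qed.

Lemma evolves_flow t : 0 <= t -> Y t = flow e t (Y 0).
Proof.
move=> t0; rewrite -{1}(stage_time_end e t0).
by case: (evolves_stage (total e t).+1 t0).
Qed.

Lemma evolves_quadrant t : 0 <= t -> quadrant (Y t).
Proof. by move=> t0; rewrite evolves_flow//; exact: reflect_point_quadrant. Qed.

Lemma evolves_linear s t : 0 <= s -> s <= t -> total e s = total e t ->
  Y t = Y s + drift (t - s).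
Proof.
move=> s0 st tot; have cst_st x : s <= x -> x < t -> total e x = total e s.
  move=> sx xt; have x0 := le_trans s0 sx; apply/eqP; rewrite eqn_leq {1}tot.
  by rewrite !total_nondecreasing// ltW.
rewrite (eY s0 st cst_st (evolves_quadrant s0)).
rewrite (total_eq_pure_jump s0 st tot) subrr addr0 reflect_point_id//.
by apply: quadrant_drift; [rewrite subr_ge0|exact: evolves_quadrant].
Qed.

Lemma evolves_right_linear t : 0 <= t -> exists2 d, 0 < d &
  forall s, t <= s -> s < t + d -> Y s = Y t + drift (s - t).
Proof.
move=> t0; have := total_right_continuous e t0.
rewrite near_withinE => /nbhs_ballP[d /= d0 dS]; exists d => // s.
rewrite le_eqVlt => /predU1P[<- _|ts sd].
  by rewrite subrr /drift !mulr0 addr0.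
apply: evolves_linear => //; first exact: ltW.
apply/esym/dS => //; rewrite /ball/= distrC ger0_norm ?subr_ge0 ?ltW//.
by rewrite ltrBlDl.
Qed.

End evolving.

End path_dynamics.

(** * Measurability in the driving path *)

HB.instance Definition _ (R : realType) := gen_eqMixin (path R).
HB.instance Definition _ (R : realType) := gen_choiceMixin (path R).

Lemma null_path_right_continuous (R : realType) (i : 'I_3) (t : R) : 0 <= t ->
  \forall s \near t^'+, (fun=> fun=> 0%N) i s = (fun=> fun=> 0%N) i t :> nat.
Proof. by move=> _; exact: nearW. Qed.

Definition null_path (R : realType) : path R :=
  @Path R (fun=> fun=> 0%N) (fun=> fun=> 0) (fun _ _ _ _ _ => leqnn 0)
    (@null_path_right_continuous R).

HB.instance Definition _ (R : realType) := isPointed.Build (path R) (null_path R).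

Section path_measurable.
Context (R : realType).

(** Finite lists of pairs (time, allowed counts) make intersection a concatenation, so that the
    cylinders form a pi-system; the size constraints are a total family, trivial beyond some
    rank. *)
Definition cylinder (l : 'I_3 -> seq (R * set nat)) (V : 'I_3 -> nat -> set R) :
    set (path R) :=
  [set e | (forall i a, a \in l i -> a.2 (count e i a.1))
        /\ (forall i k, V i k (size_of e i k))].

Definition cylinders : set_system (path R) :=
  [set A | exists l V K, [/\ (forall i a, a \in l i -> 0 <= a.1),
    (forall i k, measurable (V i k)),
    (forall i k, (K <= k)%N -> V i k = setT) & A = cylinder l V] ].

Definition path_space := g_sigma_algebraType cylinders.

Lemma cylinders_setI : setI_closed cylinders.
Proof.
move=> A B [l [V [K [l0 mV VK ->]]]] [l' [V' [K' [l'0 mV' VK' ->]]]].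
exists (fun i => l i ++ l' i), (fun i k => V i k `&` V' i k), (maxn K K'); split.
- by move=> i a; rewrite mem_cat => /orP[]; [exact: l0|exact: l'0].
- by move=> i k; exact: measurableI.
- by move=> i k; rewrite geq_max => /andP[Kk K'k]; rewrite VK// VK'// setTI.
- apply/seteqP; split=> [e [[le Ve] [le' Ve']]|e [le Ve]].
    by split=> // i a; rewrite mem_cat => /orP[]; [exact: le|exact: le'].
  by split; split=> [i a al|i k]; [apply: le|have [] := Ve i k|
    apply: le|have [] := Ve i k] => //; rewrite mem_cat al ?orbT.
Qed.

Lemma cylinders_setT : cylinders setT.
Proof.
exists (fun=> [::]), (fun=> fun=> setT), 0%N; split=> //.
by apply/esym/seteqP; split.
Qed.

Lemma measurable_count i t : 0 <= t ->
  measurable_fun [set: path_space] (fun e : path R => count e i t).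
Proof.
move=> t0 _ U _; rewrite setTI; apply: sub_sigma_algebra.
exists (fun j => if j == i then [:: (t, U)] else [::]), (fun=> fun=> setT), 0%N.
split=> //.
  by move=> j a; case: ifP => // _; rewrite inE => /eqP ->.
apply/seteqP; split=> [e Ue|e [le _]]; last first.
  by have := le i (t, U); rewrite eqxx inE eqxx; exact.
by split=> // j a; case: ifPn => // /eqP ->; rewrite inE => /eqP ->.
Qed.

Lemma measurable_size_of i k :
  measurable_fun [set: path_space] (fun e : path R => size_of e i k).
Proof.
move=> _ U mU; rewrite setTI; apply: sub_sigma_algebra.
exists (fun=> [::]), (fun j m => if (j == i) && (m == k) then U else setT), k.+1.
split=> //.
- by move=> j m; case: ifP.
- by move=> j m km; case: ifPn => // /andP[_ /eqP mk]; rewrite mk ltnn in km.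
apply/seteqP; split=> [e Ue|e [_ le]]; last by have := le i k; rewrite !eqxx.
by split=> // j m; case: ifPn => // /andP[/eqP -> /eqP ->].
Qed.

End path_measurable.

Section measurable_composition.
Context d (T : measurableType d).

Lemma measurable_fun_natP (f : T -> nat) :
  (forall k, measurable [set x | (k <= f x)%N]) -> measurable_fun setT f.
Proof.
move=> mf _ U _; rewrite setTI.
have -> : f @^-1` U = \bigcup_(k in U)
    ([set x | (k <= f x)%N] `\` [set x | (k.+1 <= f x)%N]).
  apply/seteqP; split=> [x Ux|x [k Uk [/= kx /negP]]].
    by exists (f x) => //; split=> //=; rewrite ltnn.
  by rewrite -leqNgt => xk; rewrite /preimage/= (_ : f x = k)//; apply/eqP; rewrite eqn_leq xk.
by apply: bigcup_measurable => k _; exact: measurableD.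
Qed.

Lemma measurable_fun_countable_index d' (T' : measurableType d')
    (n : T -> nat) (g : nat -> T -> T') :
  measurable_fun setT n -> (forall k, measurable_fun setT (g k)) ->
  measurable_fun setT (fun x => g (n x) x).
Proof.
move=> mn mg _ A mA; rewrite setTI.
have -> : (fun x => g (n x) x) @^-1` A = \bigcup_k (n @^-1` [set k] `&` g k @^-1` A).
  by apply/seteqP; split=> [x Ax|x [k _ [/= <-]]]//; exists (n x).
apply: bigcupT_measurable => k; apply: measurableI.
  by rewrite -[X in measurable X]setTI; exact: mn.
by rewrite -[X in measurable X]setTI; exact: mg.
Qed.

Lemma measurable_fun_realP (R : realType) (f : T -> R) :
  (forall x, measurable [set t | f t < x]) -> measurable_fun setT f.
Proof.
move=> mf; apply: (measurability _ (RGenInftyO.measurableE R)).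
move=> _ [_ [x ->] <-]; by rewrite setTI (_ : _ @^-1` _ = [set t | f t < x]).
Qed.

End measurable_composition.

(** * Joint measurability of the flow in the starting point and the path *)

Section flow_measurable.
Context (R : realType) (c1 c2 q1 q2 qb1 qb2 r1 r2 : R).
Local Notation E := (path_space R).
Implicit Types (t : R).

(** By monotonicity and right continuity, the count at a random time [tau] is at most k iff it is at
    most k at some rational time after [tau]. Countably many deterministic times thus suffice. *)
Lemma measurable_count_at (i : 'I_3) (tau : path R -> R) :
  (forall e, 0 <= tau e) -> measurable_fun [set: E] tau ->
  measurable_fun [set: E] (fun e => count e i (tau e)).
Proof.
move=> tau0 mtau; apply: measurable_fun_natP => -[|k].
  by rewrite (_ : [set _ | _] = setT)//; apply/seteqP; split.
rewrite (_ : [set _ | _] = ~` \bigcup_(q : rat)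
   ([set e : path R | tau e < ratr q] `&` [set e | (count e i (ratr q) <= k)%N])).
  apply: measurableC; apply: bigcupT_measurable_rat => q.
  have [q0|q0] := ltP (ratr q : R) 0.
    rewrite (_ : _ `&` _ = set0)//; apply/seteqP; split=> // e [/= tq _].
    by have := le_lt_trans (tau0 e) (lt_trans tq q0); rewrite ltxx.
  apply: (@measurableI _ E).
    rewrite -[X in measurable X]setTI.
    exact: (measurable_fun_ltr mtau (measurable_cst _)) measurableT [set true] _.
  rewrite -[X in measurable X]setTI.
  exact: (measurable_count i q0) measurableT [set j | (j <= k)%N] _.
apply/seteqP; split=> e /=.
  move=> ke [q _ [/= tq qk]].
  have := leq_trans ke (count_nondecreasing e i (tau0 e) (ltW tq)).
  by rewrite ltnNge qk.
apply: contra_notP => /negP; rewrite -ltnNge ltnS => ek.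
have := count_right_continuous e i (tau0 e).
rewrite near_withinE => /nbhs_ballP[d /= d0 dE].
have lt_d : tau e < tau e + d by rewrite ltrDl.
have [q] := rat_in_itvoo lt_d.
rewrite in_itv/= => /andP[q1' q2']; exists q => //; split=> //=.
rewrite (dE (ratr q))// /ball/= distrC ger0_norm ?subr_ge0 ?ltW//.
by rewrite ltrBlDl.
Qed.

Lemma measurable_total_at (tau : path R -> R) :
  (forall e, 0 <= tau e) -> measurable_fun [set: E] tau ->
  measurable_fun [set: E] (fun e => total e (tau e)).
Proof.
move=> tau0 mtau; rewrite (_ : (fun e => _) = (fun e : path R =>
    count e ord0 (tau e) + (count e (lift ord0 ord0) (tau e)
     + (count e (lift ord0 (lift ord0 ord0)) (tau e))))%N); last first.
  by apply/funext => e; rewrite /total !big_ord_recl big_ord0 addn0.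
by do 2 (apply: measurable_fun_addn; first exact: measurable_count_at);
  exact: measurable_count_at.
Qed.

Lemma measurable_passage m : measurable_fun [set: E]
  (fun e => inf [set x | 0 <= x /\ (m < total e x)%N]).
Proof.
have infS_ge0 (e : path R) : 0 <= inf [set x : R | 0 <= x /\ (m < total e x)%N].
  have [->|S0] := eqVneq [set x : R | 0 <= x /\ (m < total e x)%N] set0.
    by rewrite inf0.
  by apply: lb_le_inf; [exact/set0P|move=> x []].
have mtot (x : R) : 0 <= x -> measurable ([set e : path R | (m < total e x)%N] : set E).
  move=> x0; rewrite -[X in measurable X]setTI.
  have /= := measurable_total_at (fun=> x0) (measurable_cst x).
  by move=> /(_ measurableT [set j | (m < j)%N]); exact.
apply: measurable_fun_realP => x; have [x0|x0] := leP x 0.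
  rewrite (_ : [set _ | _] = set0)//; apply/seteqP; split=> // e /= ex.
  by have := lt_le_trans (le_lt_trans (infS_ge0 e) ex) x0; rewrite ltxx.
(* The infimum of the empty set is 0, so for positive [x] the event also contains the paths whose
   total count never exceeds [m]; by monotonicity this is tested at integer times. *)
rewrite (_ : [set _ | _] =
   (\bigcup_(q : rat) [set e : path R |
       [/\ 0 <= (ratr q : R), ratr q < x & (m < total e (ratr q))%N]])
   `|` ~` \bigcup_k [set e | (m < total e k%:R)%N]).
  apply: (@measurableU _ E).
    apply: bigcupT_measurable_rat => q.
    have [q0|q0] := leP 0 (ratr q : R); last first.
      by rewrite (_ : [set _ | _] = set0)//; apply/seteqP; split=> // e [].
    have [qx|qx] := ltP (ratr q : R) x; last first.
      by rewrite (_ : [set _ | _] = set0)//; apply/seteqP; split=> // e [].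
    rewrite (_ : [set _ | _] = [set e | (m < total e (ratr q))%N]); first exact: mtot.
    by apply/seteqP; split=> e //= [].
  by apply: (@measurableC _ E); apply: bigcupT_measurable => k; exact: mtot.
apply/seteqP; split=> e /=.
  move=> ex; have [S0|S0] := eqVneq [set x : R | 0 <= x /\ (m < total e x)%N] set0.
    right=> -[k _ /= mk].
    by have : [set x : R | 0 <= x /\ (m < total e x)%N] k%:R by []; rewrite S0.
  left; have [y [y0 my] yx] : exists2 y : R, 0 <= y /\ (m < total e y)%N & y < x.
    by apply: inf_lt => //; exact/set0P.
  have [q] := rat_in_itvoo yx; rewrite in_itv/= => /andP[yq qx].
  exists q => //; split=> //; first exact: le_trans (ltW yq).
  by apply: leq_trans my _; apply: total_nondecreasing => //; exact: ltW.
move=> [[q _ [/= q0 qx mq]]|never].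
  by apply: le_lt_trans qx; apply: ge_inf => //; exists 0 => y [].
have -> : [set y : R | 0 <= y /\ (m < total e y)%N] = set0; last by rewrite inf0.
apply/seteqP; split=> // y [y0 my].
apply: never; exists (Num.trunc y).+1 => //=; apply: leq_trans my _.
by apply: total_nondecreasing => //; apply: ltW; exact: truncnS_gt.
Qed.

Lemma measurable_stage_time t n : 0 <= t ->
  measurable_fun [set: E] (fun e => stage_time e t n).
Proof.
move=> t0; elim: n => [|n IHn] /=; first exact: measurable_cst.
have mtotn := measurable_total_at (fun e => stage_time_ge0 e t0 n) IHn.
apply: measurable_fun_ifT => //.
  apply: measurable_fun_ltn => //.
  exact: (@measurable_total_at (fun=> t)).
apply: (@measurable_fun_countable_index _ E _ R
  (fun e => total e (stage_time e t n))
  (fun m e => inf [set x | 0 <= x /\ (m < total e x)%N])) => // m.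
exact: measurable_passage.
Qed.

Lemma measurable_pure_jump_at (tau : path R -> R) :
  (forall e, 0 <= tau e) -> measurable_fun [set: E] tau ->
  measurable_fun [set: E] (fun e => pure_jump q1 q2 qb1 qb2 e (tau e)).
Proof.
move=> tau0 mtau.
have msum i : measurable_fun [set: E]
    (fun e => \sum_(k < count e i (tau e)) size_of e i k).
  apply: (@measurable_fun_countable_index _ E _ R (fun e => count e i (tau e))
    (fun n e => \sum_(k < n) size_of e i k)); first exact: measurable_count_at.
  move=> n; under eq_fun do rewrite -(big_mkord xpredT).
  by apply: measurable_sum => k; exact: measurable_size_of.
by apply: measurable_fun_pair; apply: measurable_funB;
  do ?apply: measurableT_comp => //; exact: measurable_funM.
Qed.

Lemma measurable_reflect_point :
  measurable_fun [set: R * R] (reflect_point r1 r2).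
Proof.
have m1 : measurable_fun [set: R * R] (fst : R * R -> R) by exact: measurable_fst.
have m2 : measurable_fun [set: R * R] (snd : R * R -> R) by exact: measurable_snd.
apply: measurable_fun_ifT => //.
  by apply: measurable_and; exact: measurable_fun_ler.
apply: measurable_fun_ifT => /=.
- apply: measurable_fun_ltr => //; apply: measurable_minr => //.
  exact: measurable_funM.
- apply: measurable_fun_pair => //; apply: measurable_funB => //.
  exact: measurable_funM.
apply: measurable_fun_ifT => /=.
- apply: measurable_fun_ltr => //; apply: measurable_minr => //.
  exact: measurable_funM.
- apply: measurable_fun_pair => //; apply: measurable_funB => //.
  exact: measurable_funM.
exact: measurable_cst.
Qed.

Lemma measurable_flow t : 0 <= t -> measurable_fun [set: (R * R) * E]
  (fun ze : (R * R) * E => flow c1 c2 q1 q2 qb1 qb2 r1 r2 ze.2 t ze.1).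
Proof.
move=> t0; rewrite /flow.
apply: (@measurable_fun_countable_index _ ((R * R) * E)%type _ (R * R)%type
  (fun ze => (total ze.2 t).+1)
  (fun n ze => stage c1 c2 q1 q2 qb1 qb2 r1 r2 ze.2 t ze.1 n)).
  rewrite (_ : (fun ze => _) = (fun ze : (R * R) * E => 1 + total ze.2 t)%N)//.
  apply: measurable_fun_addn => //.
  apply: (@measurableT_comp _ _ _ _ _ _ (fun e : E => total e t)) => //.
  exact: (@measurable_total_at (fun=> t)).
elim=> [|n IHn]; first exact: measurable_fst.
rewrite [X in measurable_fun _ X](_ : _ = (fun ze : (R * R) * E =>
  reflect_point r1 r2 (stage c1 c2 q1 q2 qb1 qb2 r1 r2 ze.2 t ze.1 n
      + drift c1 c2 (stage_time ze.2 t n.+1 - stage_time ze.2 t n)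
      + (pure_jump q1 q2 qb1 qb2 ze.2 (stage_time ze.2 t n.+1)
         - pure_jump q1 q2 qb1 qb2 ze.2 (stage_time ze.2 t n)))))//.
apply: measurableT_comp; first exact: measurable_reflect_point.
have mT m : measurable_fun setT (fun ze : (R * R) * E => stage_time ze.2 t m).
  apply: (@measurableT_comp _ _ _ _ _ _ (fun e : E => stage_time e t m)) => //.
  exact: measurable_stage_time.
have mP m : measurable_fun setT (fun ze : (R * R) * E =>
    pure_jump q1 q2 qb1 qb2 ze.2 (stage_time ze.2 t m)).
  apply: (@measurableT_comp _ _ _ _ _ _
    (fun e : E => pure_jump q1 q2 qb1 qb2 e (stage_time e t m))) => //.
  apply: measurable_pure_jump_at; last exact: measurable_stage_time.
  by move=> e; exact: stage_time_ge0.
have /measurable_fun_pairP[s1 s2] := IHn.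
have /measurable_fun_pairP[p1 p2] := mP n.
have /measurable_fun_pairP[p1' p2'] := mP n.+1.
apply/measurable_fun_pairP; split.
  apply: measurable_funD; last exact: measurable_funB.
  apply: measurable_funD => //=.
  by apply: measurable_funM => //; apply: measurable_funB; [exact: (mT n.+1)|exact: (mT n)].
apply: measurable_funD; last exact: measurable_funB.
apply: measurable_funD => //=.
by apply: measurable_funM => //; apply: measurable_funB; [exact: (mT n.+1)|exact: (mT n)].
Qed.

End flow_measurable.

(** * Cutting a path at a fixed time into its past and its future *)

Section cut_paths.
Context (R : realType) (h : R) (h_ge0 : 0 <= h) (n : 'I_3 -> nat) (e : path R).

Lemma stopped_nondecreasing i s t : 0 <= s -> s <= t ->
  (count e i (Num.min s h) <= count e i (Num.min t h))%N.
Proof.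
move=> s0 st; apply: count_nondecreasing; first by rewrite le_min s0.
by rewrite le_min ge_min st/= ge_min lexx orbT.
Qed.

Lemma stopped_right_continuous i t : 0 <= t ->
  \forall s \near t^'+, count e i (Num.min s h) = count e i (Num.min t h).
Proof.
move=> t0; have [th|ht] := ltP t h.
  apply: filterS2 (nbhs_right_lt th) (count_right_continuous e i t0) => s sh.
  by rewrite (min_idPl (ltW sh)).
apply: filterS (nbhs_right_gt t) => s ts.
by rewrite (min_idPr _)// (le_trans ht)// ltW.
Qed.

(* When count e i h = n i, erasing the sizes of the later jumps makes
   stopped_path a function of the past of h. *)
Definition stopped_path : path R :=
  @Path R (fun i t => count e i (Num.min t h))
    (fun i k => if (k < n i)%N then size_of e i k else 0)
    stopped_nondecreasing stopped_right_continuous.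

Lemma shifted_nondecreasing i s t : 0 <= s -> s <= t ->
  (count e i (h + s) - count e i h <= count e i (h + t) - count e i h)%N.
Proof.
move=> s0 st; apply: leq_sub2r; apply: count_nondecreasing; first exact: addr_ge0.
by rewrite lerD2l.
Qed.

Lemma shifted_right_continuous i t : 0 <= t -> \forall s \near t^'+,
  (count e i (h + s) - count e i h = count e i (h + t) - count e i h)%N.
Proof.
move=> t0; have := count_right_continuous e i (addr_ge0 h_ge0 t0).
rewrite !near_withinE => /nbhs_ballP[d /= d0 dE]; apply/nbhs_ballP.
exists d => // s /=; rewrite /ball/= => sd ts; rewrite dE//.
  by rewrite /ball/= opprD addrACA subrr add0r.
by rewrite ltrD2l.
Qed.

(** The sizes are renumbered from the prescribed [n i] and not from [count e i h]: each size is then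
    one fixed coordinate of [e]. The two numberings agree on the event where the counts at [h] are
    [n], the only place where this path is meaningful. *)
Definition shifted_path : path R :=
  @Path R (fun i t => count e i (h + t) - count e i h)%N
    (fun i k => size_of e i (n i + k)%N)
    shifted_nondecreasing shifted_right_continuous.

Lemma total_shifted t : 0 <= t -> total e (h + t) = (total e h + total shifted_path t)%N.
Proof.
move=> t0; rewrite /total -big_split/=; apply: eq_bigr => i _.
by rewrite subnKC// count_nondecreasing// lerDl.
Qed.

Context (c1 c2 q1 q2 qb1 qb2 r1 r2 : R).

Lemma pure_jump_shifted t : 0 <= t -> (forall i, count e i h = n i) ->
  pure_jump q1 q2 qb1 qb2 e (h + t) =
  pure_jump q1 q2 qb1 qb2 e h + pure_jump q1 q2 qb1 qb2 shifted_path t.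
Proof.
move=> t0 en; have sumE i : \sum_(k < count e i (h + t)) size_of e i k =
    \sum_(k < count e i h) size_of e i k
    + \sum_(k < count shifted_path i t) size_of shifted_path i k.
  have -> : count e i (h + t) = (count e i h + count shifted_path i t)%N.
    by rewrite /= subnKC// count_nondecreasing// lerDl.
  by rewrite big_split_ord/=; congr (_ + _); apply: eq_bigr => k _; rewrite -en.
rewrite /pure_jump !sumE; congr pair => /=; ring.
Qed.

Lemma evolves_shifted Y : (forall i, count e i h = n i) ->
  evolves c1 c2 q1 q2 qb1 qb2 r1 r2 e Y ->
  evolves c1 c2 q1 q2 qb1 qb2 r1 r2 shifted_path (fun t => Y (h + t)).
Proof.
move=> en eY s t s0 st tot Ys.
have hs0 : 0 <= h + s by exact: addr_ge0.
have hst : h + s <= h + t by rewrite lerD2l.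
rewrite (eY _ _ hs0 hst) //; last first.
  move=> x sx xt; have x0 : 0 <= x - h by rewrite subr_ge0 (le_trans _ sx)// lerDl.
  rewrite -(subrK h x) addrC !total_shifted// tot//.
    by rewrite lerBrDl.
  by rewrite ltrBlDl.
rewrite !pure_jump_shifted//; last exact: le_trans st.
have cancel (V : zmodType) (a b b' : V) : a + b - (a + b') = b - b'.
  by rewrite opprD addrACA subrr add0r.
by rewrite !cancel.
Qed.

End cut_paths.

(** * Escape as a measurable event *)

Section escape.
Context (R : realType) (c1 c2 q1 q2 qb1 qb2 r1 r2 : R).
Hypotheses (r1_gt0 : 0 < r1) (r2_gt0 : 0 < r2) (r12 : 1 < r1 * r2).
Hypotheses (c1_ge0 : 0 <= c1) (c2_ge0 : 0 <= c2).
Local Notation E := (path_space R).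
Local Notation flow := (flow c1 c2 q1 q2 qb1 qb2 r1 r2).
Local Notation evolves := (evolves c1 c2 q1 q2 qb1 qb2 r1 r2).

Definition escaping (Y : R -> R * R) :=
  (Y t).1 @[t --> +oo] --> +oo /\ (Y t).2 / (Y t).1 @[t --> +oo] --> 0.

(** Both limits in the escape event at precision 1/(k + 1), the bound on the quotient being cleared
    of its division. *)
Definition far k (y : R * R) := k.+1%:R <= y.1 /\ k.+1%:R * `|y.2| <= y.1.

Lemma escapingP Y : escaping Y <->
  forall k, exists n : nat, forall t, n%:R <= t -> far k (Y t).
Proof.
split=> [[Yoo Y0] k|Yfar]; last split.
- have near1 : \forall t \near +oo, k.+1%:R <= (Y t).1.
    by move/cvgryPge : Yoo; exact.
  have near2 : \forall t \near +oo, `|(Y t).2 / (Y t).1| <= k.+1%:R^-1.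
    by move/cvgr0Pnorm_le : Y0; apply; rewrite invr_gt0.
  have [M [_ HM]] := filterI near1 near2.
  exists (Num.bound `|M|) => t Mt; have [|Y1 Y2] := HM t.
    by rewrite (lt_le_trans _ Mt)// (le_lt_trans (ler_norm M))// archi_boundP.
  have Y1_gt0 : 0 < (Y t).1 by apply: lt_le_trans Y1.
  split=> //; move: Y2; rewrite normrM normfV (ger0_norm (ltW Y1_gt0)).
  by rewrite ler_pdivrMr// mulrC ler_pdivlMr// mulrC.
- apply/cvgryPge => A; have [n nfar] := Yfar (Num.bound `|A|).
  exists n%:R; split=> // t /ltW /nfar[+ _]; apply: le_trans.
  rewrite (le_trans (ler_norm A))// ltW// (lt_le_trans (archi_boundP _))//.
  by rewrite ler_nat.
- apply/cvgr0Pnorm_le => eps eps0; have [n nfar] := Yfar (Num.bound eps^-1).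
  exists n%:R; split=> // t /ltW /nfar[Y1 Y2].
  have Y1_gt0 : 0 < (Y t).1 by apply: lt_le_trans Y1.
  rewrite normrM normfV (ger0_norm (ltW Y1_gt0)) ler_pdivrMr//.
  rewrite -ler_pdivrMl//; apply: le_trans Y2; rewrite ler_wpM2r//.
  have eps1 : eps^-1 < (Num.bound eps^-1)%:R.
    by apply: archi_boundP; rewrite invr_ge0 ltW.
  by rewrite ltW// (lt_le_trans eps1)// ler_nat.
Qed.

(** The conditions are closed and the drift over a short time is small, so they pass to the limit
    from arbitrarily small positive times. *)
Lemma far_closed k (y : R * R) :
  (forall d, 0 < d -> exists2 x, 0 <= x < d & far k (y + drift c1 c2 x)) ->
  far k y.
Proof.
move=> yfar; have small (C a b : R) : 0 <= C ->
    (forall d, 0 < d -> exists2 x, 0 <= x < d & a <= b + C * x) -> a <= b.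
  move=> C0 ab; apply/ler_addgt0Pr => eps eps0.
  have C1 : 0 < C + 1 by rewrite ltr_wpDl.
  have [x /andP[x0 xd] /le_trans] := ab (eps / (C + 1)) (divr_gt0 eps0 C1).
  apply; rewrite lerD2l; rewrite ltr_pdivlMr// in xd.
  by apply: le_trans (ltW xd); rewrite mulrC ler_wpM2l// lerDl.
split.
  by apply: (small c1) => // d /yfar[x xd [+ _]]; exists x.
(* A drift during [x] adds c1 x to the first coordinate and changes (k + 1) times the modulus of the
   second by at most (k + 1) c2 x. *)
apply: (small (c1 + k.+1%:R * c2)) => [|d /yfar[x /andP[x0 xd] [_ /= H]]].
  by rewrite addr_ge0// mulr_ge0.
exists x; first by rewrite x0.
have : k.+1%:R * (`|y.2| - `|c2 * x|) <= k.+1%:R * `|y.2 + c2 * x|.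
  by rewrite ler_wpM2l// lerB_normD.
rewrite (ger0_norm (mulr_ge0 c2_ge0 x0)); lra.
Qed.

(* Rational times suffice by right continuity, and make the set measurable. *)
Definition escape_set : set ((R * R) * E) :=
  [set ze | forall k, exists n : nat, forall q : rat, n%:R <= (ratr q : R) ->
    far k (flow ze.2 (ratr q) ze.1)].

Lemma measurable_escape_set : measurable escape_set.
Proof.
pose D k (n : nat) (q : rat) : set ((R * R) * E) :=
  [set ze | n%:R <= (ratr q : R) -> far k (flow ze.2 (ratr q) ze.1)].
have mD k n q : measurable (D k n q).
  have [nq|nq] := boolP (n%:R <= (ratr q : R)); last first.
    by rewrite (_ : D k n q = setT)//; apply/seteqP; split=> // ze _ nq'; rewrite nq' in nq.
  have q0 : 0 <= (ratr q : R) by apply: le_trans nq.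
  have /measurable_fun_pairP[/= m1 m2] :=
    measurable_flow c1 c2 q1 q2 qb1 qb2 r1 r2 q0.
  rewrite (_ : D k n q = [set ze | (k.+1%:R <= (flow ze.2 (ratr q) ze.1).1)
    && (k.+1%:R * `|(flow ze.2 (ratr q) ze.1).2| <= (flow ze.2 (ratr q) ze.1).1)]).
    rewrite -[X in measurable X]setTI.
    have mfar : measurable_fun [set: (R * R) * E] (fun ze : (R * R) * E =>
        (k.+1%:R <= (flow ze.2 (ratr q) ze.1).1)
        && (k.+1%:R * `|(flow ze.2 (ratr q) ze.1).2| <= (flow ze.2 (ratr q) ze.1).1)).
      apply: measurable_and; first exact: measurable_fun_ler.
      apply: measurable_fun_ler => //; apply: measurable_funM => //.
      exact: measurableT_comp.
    exact: mfar measurableT [set true] _.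
  apply/seteqP; split=> ze; rewrite /D/= /far.
    by move=> /(_ nq)[-> ->].
  by move=> /andP[].
rewrite (_ : escape_set = \bigcap_k \bigcup_n ~` \bigcup_(q : rat) ~` D k n q).
  apply: bigcapT_measurable => k; apply: bigcupT_measurable => n.
  apply: measurableC; apply: bigcupT_measurable_rat => q; exact: measurableC.
apply/seteqP; split=> ze /= H.
  by move=> k _; have [n Hn] := H k; exists n => // -[q _]; apply; exact: Hn.
move=> k; have [n _ Hn] := H k I; exists n => q; apply: contra_notP Hn.
by move=> nD; exists q.
Qed.

(** Passing from rational to real times: just after a real time [t] the trajectory is [Y t] plus a
    vanishing drift, and [far_closed] applies along rational times decreasing to [t]. *)
Lemma escaping_flow e Y : evolves e Y -> quadrant (Y 0) ->
  escaping Y <-> escape_set (Y 0, e).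
Proof.
move=> eY Y0; have YE := evolves_flow r1_gt0 r2_gt0 r12 eY Y0.
rewrite escapingP; split=> H k; have [n Hn] := H k; exists n.
  by move=> q nq; rewrite -YE; [exact: Hn|exact: le_trans nq].
move=> t nt; have t0 : 0 <= t by apply: le_trans nt.
have [d d0 dY] := evolves_right_linear r1_gt0 r2_gt0 r12 c1_ge0 c2_ge0 eY Y0 t0.
apply: far_closed => d' d'0.
have lt_t : t < t + Num.min d d' by rewrite ltrDl lt_min d0.
have [q] := rat_in_itvoo lt_t; rewrite in_itv/= => /andP[tq].
rewrite -ltrBlDl lt_min => /andP[qd qd'].
exists (ratr q - t); first by rewrite qd' subr_ge0 ltW.
rewrite -dY ?(ltW tq)//; last by rewrite -ltrBlDl.
by rewrite YE; [apply: Hn; exact: le_trans (ltW tq)|exact: le_trans (ltW tq)].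
Qed.

End escape.

(** * The Markov property of the driving processes *)

Section poisson_markov.
Context d (T : measurableType d) (R : realType) (P : probability T R).
Variables (rate : R) (N : R -> T -> nat).
Hypothesis poissonN : poisson_process P rate N.
Implicit Types (h t : R) (A : set T) (l : seq (R * set nat)).

Definition increment_event (t : nat -> R) (U : nat -> set nat) (j : nat) : set T :=
  [set w | U j (N (t j.+1) w - N (t j) w)%N].

(** Shaped after [poisson_independent_increments]: constraints on the successive increments of a
    grid ending at [h], stored as an infinite sequence of which [K] steps count. *)
Definition past_event h A := exists (t : nat -> R) (K : nat) (U : nat -> set nat),
  [/\ 0 <= t 0%N, {homo t : m n / (m <= n)%N >-> m <= n}, t K = h
    & A = \big[setI/setT]_(0 <= j < K) increment_event t U j].

Definition constrained h l : set T :=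
  [set w | forall a, a \in l -> a.2 (N (h + a.1) w - N h w)%N].

(** The remaining constraints as seen from the time [t0] later, once the increment up to it is known
    to be [m]. *)
Definition rebase m (t0 : R) l : seq (R * set nat) :=
  [seq (a.1 - t0, [set n | a.2 (m + n)%N]) | a <- l].

Lemma measurable_increment s t (U : set nat) : 0 <= s -> s <= t ->
  measurable [set w | U (N t w - N s w)%N].
Proof.
move=> s0 st; rewrite -[X in measurable X]setTI.
apply: (measurable_fun_subn (poisson_measurable poissonN (le_trans s0 st))
  (poisson_measurable poissonN s0)) => //.
Qed.

Lemma past_event_setT h : 0 <= h -> past_event h setT.
Proof. by move=> h0; exists (fun=> h), 0%N, (fun=> setT); split=> //; rewrite big_nil. Qed.

Lemma past_event_measurable h A : past_event h A -> measurable A.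
Proof.
move=> [t [K [U [t0 tnd _ ->]]]]; apply: bigsetI_measurable => j _.
apply: measurable_increment; last exact: tnd.
by apply: (le_trans t0); exact: tnd.
Qed.

(** The grid is continued by the constant value h' after its K-th point, which adds exactly one
    increment, independent of the previous ones. *)
Lemma past_event_step h h' A (U : set nat) : h <= h' -> past_event h A ->
  past_event h' (A `&` [set w | U (N h' w - N h w)%N]) /\
  P (A `&` [set w | U (N h' w - N h w)%N])
    = (P A * poisson_prob (rate * (h' - h)) 0%N U)%E.
Proof.
move=> hh' [t [K [V [t0 tnd tK ->]]]].
pose t' j := if (j <= K)%N then t j else h'.
pose V' j := if (j < K)%N then V j else U.
have t'nd : {homo t' : m n / (m <= n)%N >-> m <= n}.
  move=> m n mn; rewrite /t'; case: (leqP n K) => nK; last first.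
    case: ifP => // mK; apply: le_trans hh'; rewrite -tK; exact: tnd.
  by rewrite (leq_trans mn nK); exact: tnd.
have t'0 : 0 <= t' 0%N by rewrite /t' leq0n.
have past : \big[setI/setT]_(0 <= j < K) increment_event t V j
    = \big[setI/setT]_(0 <= j < K) increment_event t' V' j.
  apply: eq_big_nat => j /andP[_ jK].
  by rewrite /increment_event /t' /V' jK (ltnW jK).
have last : [set w | U (N h' w - N h w)%N] = increment_event t' V' K.
  by rewrite /increment_event /t' /V' leqnn !ltnn tK.
have indep n : P (\big[setI/setT]_(0 <= j < n) increment_event t' V' j)
    = (\prod_(0 <= j < n) P (increment_event t' V' j))%E.
  rewrite /index_iota subn0.
  apply: (poisson_independent_increments poissonN t'0 t'nd).
    exact: iota_uniq.
  by move=> i _; exists (V' i) => //; rewrite setTI.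
have step : (\big[setI/setT]_(0 <= j < K) increment_event t V j) `&`
    [set w | U (N h' w - N h w)%N]
  = \big[setI/setT]_(0 <= j < K.+1) increment_event t' V' j.
  by rewrite big_nat_recr//= past last.
split; rewrite step.
  by exists t', K.+1, V'; split=> //; rewrite /t' ltnn.
rewrite indep big_nat_recr//= -indep past -last; congr (_ * _)%E.
apply: (poisson_increment poissonN) => //; rewrite -tK.
by apply: (le_trans t0); exact: tnd.
Qed.

Lemma constrained_cons h a l w : 0 <= h -> 0 <= a.1 ->
  all (fun b => a.1 <= b.1) l ->
  constrained h (a :: l) w <-> a.2 (N (h + a.1) w - N h w)%N /\
    constrained (h + a.1) (rebase (N (h + a.1) w - N h w) a.1 l) w.
Proof.
move=> h0 a0 /allP al.
have incE b : b \in l -> (N (h + b.1) w - N h w =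
    (N (h + a.1) w - N h w) + (N (h + a.1 + (b.1 - a.1)) w - N (h + a.1) w))%N.
  move=> bl; have -> : h + a.1 + (b.1 - a.1) = h + b.1 by ring.
  have ha : h <= h + a.1 by rewrite lerDl.
  have := poisson_nondecreasing poissonN w h0 ha.
  have ha0 : 0 <= h + a.1 by exact: addr_ge0.
  have hab : h + a.1 <= h + b.1 by rewrite lerD2l; exact: al.
  have := poisson_nondecreasing poissonN w ha0 hab.
  by lia.
split=> [H|[Ha H] b].
  split; first by apply: H; rewrite inE eqxx.
  by move=> _ /mapP[b bl ->] /=; rewrite -incE//; apply: H; rewrite inE bl orbT.
rewrite inE => /predU1P[->//|bl]; rewrite incE//.
apply: (H (b.1 - a.1, [set n | b.2 (N (h + a.1) w - N h w + n)%N])).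
by apply/mapP; exists b.
Qed.

Lemma rebase_all m (a : R * set nat) l : all (fun b => a.1 <= b.1) l ->
  all (fun b => 0 <= b.1) (rebase m a.1 l).
Proof. by rewrite all_map; apply: sub_all => b /=; rewrite subr_ge0. Qed.

Definition earlier (a b : R * set nat) := a.1 <= b.1.

Lemma rebase_sorted m t0 l : sorted earlier l -> sorted earlier (rebase m t0 l).
Proof.
by rewrite sorted_map; apply: sub_sorted => a b; rewrite /earlier/= lerD2r.
Qed.

Lemma earlier_trans : transitive earlier.
Proof. by move=> b a c; exact: le_trans. Qed.

Lemma sorted_cons_all (a : R * set nat) l : sorted earlier (a :: l) ->
  sorted earlier l /\ all (fun b => a.1 <= b.1) l.
Proof.
move=> /= al; split; first exact: path_sorted al.
exact: (order_path_min earlier_trans al).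
Qed.

Lemma measurable_constrained h l : 0 <= h -> all (fun b => 0 <= b.1) l ->
  measurable (constrained h l).
Proof.
move=> h0; elim: l => [_|a l IHl /= /andP[a0 al]].
  by rewrite (_ : constrained _ _ = setT)//; apply/seteqP; split.
rewrite (_ : constrained h (a :: l) =
    [set w | a.2 (N (h + a.1) w - N h w)%N] `&` constrained h l).
  apply: measurableI; last exact: IHl.
  by apply: measurable_increment => //; rewrite lerDl.
apply/seteqP; split=> [w H|w [Ha Hl] b].
  by split=> [|b bl]; [apply: (H a)|apply: H]; rewrite inE ?eqxx// bl orbT.
by rewrite inE => /predU1P[->//|]; exact: Hl.
Qed.

(* Conditioning on the value of the first constrained increment. *)
Lemma constrained_decomposition h A F (a : R * set nat) l : 0 <= h -> 0 <= a.1 ->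
  all (fun b => a.1 <= b.1) l -> measurable A -> measurable F ->
  P (A `&` constrained h (a :: l) `&` F) =
  (\sum_(m <oo) P ((A `&` [set w | (a.2 `&` [set m]) (N (h + a.1) w - N h w)%N])
     `&` constrained (h + a.1) (rebase m a.1 l) `&` F))%E.
Proof.
move=> h0 a0 al mA mF.
have decE : A `&` constrained h (a :: l) `&` F = \bigcup_m
  ((A `&` [set w | (a.2 `&` [set m]) (N (h + a.1) w - N h w)%N])
     `&` constrained (h + a.1) (rebase m a.1 l) `&` F).
  apply/seteqP; split=> [w [[Aw /(constrained_cons w h0 a0 al)[aw cw]] Fw]|].
    by exists (N (h + a.1) w - N h w)%N.
  move=> w [m _ [[[Aw [aw /= mw]] cw] Fw]]; split=> //; split=> //.
  by apply/(constrained_cons w h0 a0 al); rewrite mw -{1}mw.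
rewrite decE measure_bigcup//=; first by apply: eq_eseriesl => m; rewrite in_setT.
  move=> m _; apply: measurableI => //; apply: measurableI.
    apply: measurableI => //.
    by apply: (@measurable_increment h (h + a.1) (a.2 `&` [set m])); rewrite ?lerDl.
  by apply: measurable_constrained; [exact: addr_ge0|exact: rebase_all].
apply/trivIsetP => m n _ _ /eqP mn; apply/seteqP; split=> // w [].
move=> [[[_ [_ /= mw]] _] _] [[[_ [_ /= nw]] _] _].
by apply: mn; rewrite -mw -nw.
Qed.

(** The order of quantifiers is the point: [phi] is fixed before [h] and [A], which expresses
    independence of the past and stationarity at once. By induction on the number of constraints:
    given the value of the first increment, the rest is a rebased shorter list with an enlarged
    past. *)
Lemma future_law l : sorted earlier l -> all (fun b => 0 <= b.1) l ->
  exists2 phi, (0 <= phi)%E &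
  forall h A, 0 <= h -> past_event h A -> P (A `&` constrained h l) = (P A * phi)%E.
Proof.
have [n] := ubnP (size l); elim: n l => // n IHn [|a l] /= ln sl al.
  exists 1%E => // h A h0 pA; rewrite mule1 (_ : constrained _ _ = setT) ?setIT//.
  by apply/seteqP; split.
have [sl' al'] := sorted_cons_all sl; have /andP[a0 _] := al.
have /choice[phi phiP] m : exists phi, (0 <= phi)%E /\ forall h A, 0 <= h ->
    past_event h A -> P (A `&` constrained h (rebase m a.1 l)) = (P A * phi)%E.
  have [||| phi phi0 H] := IHn (rebase m a.1 l); last by exists phi.
  - by rewrite size_map.
  - exact: rebase_sorted.
  - exact: rebase_all.
exists (\sum_(m <oo) poisson_prob (rate * a.1) 0%N (a.2 `&` [set m]) * phi m)%E.
  by apply: nneseries_ge0 => m _ _; rewrite mule_ge0// (phiP m).1.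
move=> h A h0 pA; rewrite -[X in P X]setIT.
rewrite constrained_decomposition//; last exact: past_event_measurable pA.
have PAE : P A = (fine (P A))%:E.
  by rewrite fineK// fin_num_measure//; exact: past_event_measurable pA.
rewrite PAE -nneseriesZl; last by move=> m _; rewrite mule_ge0// (phiP m).1.
  apply: eq_eseriesr => m _; rewrite setIT.
  have ha : h <= h + a.1 by rewrite lerDl.
  have [pA' PA'] := past_event_step (a.2 `&` [set m]) ha pA.
  rewrite (phiP m).2//; last by exact: addr_ge0.
  by rewrite PA' addrAC subrr add0r muleA PAE.
Qed.

(** The constraints before [h] are moved one at a time into the past event, at the price of a sum
    over the value of each increment; when none is left, [future_law] gives the factor, which is the
    same in every term. *)
Lemma past_future l l' h h0 A : 0 <= h0 -> past_event h0 A ->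
  sorted earlier l -> all (fun b => 0 <= b.1) l -> all (fun b => h0 + b.1 <= h) l ->
  h0 <= h -> sorted earlier l' -> all (fun b => 0 <= b.1) l' ->
  P (A `&` constrained h0 l `&` constrained h l') =
  (P (A `&` constrained h0 l) * P (constrained 0 l'))%E.
Proof.
move=> + + + + + + sl' al'.
have [phi phi0 phiP] := future_law sl' al'.
have phiE : P (constrained 0 l') = phi.
  have := phiP 0 setT (lexx 0) (past_event_setT (lexx 0)).
  by rewrite setTI probability_setT mul1e.
have phi_fin : phi = (fine phi)%:E.
  by rewrite -phiE fineK// fin_num_measure//; exact: measurable_constrained.
rewrite phiE.
have [n] := ubnP (size l); elim: n l h0 A => // n IHn [|a l] /= h0 A ln h00 pA sl al alh h0h.
  have -> : constrained h0 [::] = setT by apply/seteqP; split.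
  have pA' : past_event h A.
    have [] := past_event_step setT h0h pA.
    by rewrite (_ : [set w | _] = setT) ?setIT.
  by rewrite setIT phiP//; exact: le_trans h00 h0h.
have [sl1 al1] := sorted_cons_all sl; have /andP[a0 _] := al.
have /andP[ah alh'] := alh.
have mA := past_event_measurable pA.
rewrite constrained_decomposition//; last first.
  by apply: measurable_constrained => //; exact: le_trans h00 h0h.
rewrite -[in RHS](setIT (A `&` _)) constrained_decomposition// muleC phi_fin -nneseriesZl//.
apply: eq_eseriesr => m _; rewrite setIT muleC -phi_fin.
have ha : h0 <= h0 + a.1 by rewrite lerDl.
have [pA' PA'] := past_event_step (a.2 `&` [set m]) ha pA.
rewrite IHn//.
- by rewrite size_map.
- exact: addr_ge0.
- exact: rebase_sorted.
- exact: rebase_all.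
- by rewrite all_map; apply: sub_all alh' => b /=; rewrite addrACA subrr addr0 => /le_trans; apply.
Qed.

Lemma sort_earlier l : exists2 l', sorted earlier l' & l' =i l.
Proof.
exists (sort earlier l); last exact: mem_sort.
by apply: sort_sorted => a b; exact: le_total.
Qed.

(** As the count starts at 0, constraints at times capped by [h] are constraints on increments since
    0; sorting them by time puts them in the form required by [past_future]. *)
Lemma poisson_markov l l' h : 0 <= h ->
  (forall a, a \in l -> 0 <= a.1) -> (forall a, a \in l' -> 0 <= a.1) ->
  P ([set w | forall a, a \in l -> a.2 (N (Num.min a.1 h) w)] `&` constrained h l') =
  (P [set w | forall a, a \in l -> a.2 (N (Num.min a.1 h) w)] *
   P [set w | forall a, a \in l' -> a.2 (N a.1 w)])%E.
Proof.
move=> h0 al al'; pose lh : seq (R * set nat) := [seq (Num.min a.1 h, a.2) | a <- l].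
have [s ss sl] := sort_earlier lh; have [s' ss' sl'] := sort_earlier l'.
have cE : [set w | forall a, a \in l -> a.2 (N (Num.min a.1 h) w)] = constrained 0 s.
  apply/seteqP; split=> w /= H a.
    by rewrite sl => /mapP[b bl ->] /=; rewrite add0r (poisson_start poissonN) subn0; exact: H.
  move=> al1; have := H (Num.min a.1 h, a.2); rewrite /= add0r (poisson_start poissonN) subn0.
  by apply; rewrite sl; apply/mapP; exists a.
have cE' k : constrained k l' = constrained k s'.
  by apply/seteqP; split=> w H a; [rewrite sl'|rewrite -sl']; exact: H.
have -> : [set w | forall a, a \in l' -> a.2 (N a.1 w)] = constrained 0 l'.
  by apply/seteqP; split=> w /= H a /H; rewrite add0r (poisson_start poissonN) subn0.
rewrite cE !cE' -(setTI (constrained 0 s)).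
apply: past_future => //; first exact: past_event_setT.
- by apply/allP => a; rewrite sl => /mapP[b bl ->] /=; rewrite le_min h0 al.
- by apply/allP => a; rewrite sl => /mapP[b bl ->] /=; rewrite add0r ge_min lexx orbT.
- by apply/allP => a; rewrite sl'; exact: al'.
Qed.

End poisson_markov.

Lemma measurable_count_constraints d (T : measurableType d) (R : realType)
    (N : R -> T -> nat) (f : R -> R) (l : seq (R * set nat)) :
  (forall a, a \in l -> measurable_fun setT (N (f a.1))) ->
  measurable [set w | forall a, a \in l -> a.2 (N (f a.1) w)].
Proof.
elim: l => [_|a l IHl al].
  by rewrite (_ : [set _ | _] = setT)//; apply/seteqP; split.
rewrite (_ : [set _ | _] = N (f a.1) @^-1` a.2 `&`
    [set w | forall b, b \in l -> b.2 (N (f b.1) w)]).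
  apply: measurableI; last by apply: IHl => b bl; apply: al; rewrite inE bl orbT.
  by rewrite -[X in measurable X]setTI; apply: al => //; rewrite inE eqxx.
apply/seteqP; split=> [w H|w [Ha Hl] b].
  by split=> [|b bl]; [apply: (H a)|apply: H]; rewrite inE ?eqxx// bl orbT.
by rewrite inE => /predU1P[->//|]; exact: Hl.
Qed.

Lemma measurable_bigcap_ord d (T : measurableType d) n (F : 'I_n -> set T) :
  (forall i, measurable (F i)) -> measurable (\bigcap_i F i).
Proof.
move=> mF; rewrite (_ : \bigcap_i F i = \big[setI/setT]_(i <- enum 'I_n) F i).
  by apply: bigsetI_measurable.
by rewrite -bigcap_seq; apply/seteqP; split=> x Fx i _; apply: Fx => //=; rewrite mem_enum.
Qed.

Lemma measurable_path_fun d (T : measurableType d) (R : realType) (f : T -> path R) :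
  (forall i t, 0 <= t -> measurable_fun setT (fun w => count (f w) i t)) ->
  (forall i k, measurable_fun setT (fun w => size_of (f w) i k)) ->
  measurable_fun setT (f : T -> path_space R).
Proof.
move=> mN mJ; apply: (@measurability _ _ T (path_space R) setT _ (@cylinders R)) => //.
move=> _ [_ [l [V [K [l0 mV VK ->]]]] <-]; rewrite setTI.
rewrite (_ : _ @^-1` _ =
    (\bigcap_i [set w | forall a, a \in l i -> a.2 (count (f w) i a.1)])
   `&` \bigcap_i \bigcap_k ((fun w => size_of (f w) i k) @^-1` V i k)).
  apply: measurableI.
    apply: measurable_bigcap_ord => i.
    apply: (@measurable_count_constraints _ T R (fun t w => count (f w) i t) id (l i)).
    by move=> a al; apply: mN; exact: l0 al.
  apply: measurable_bigcap_ord => i; apply: bigcapT_measurable => k.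
  by rewrite -[X in measurable X]setTI; exact: mJ.
apply/seteqP; split=> w [wl wV]; split=> i.
- by move=> _; exact: wl.
- by move=> _ k _; exact: wV.
- by move=> a; exact: wl.
- by move=> k; exact: wV.
Qed.

(** * Independence of past and future for the whole family of shocks *)

Section shock_markov.
Context d (T : measurableType d) (R : realType) (P : probability T R).
Variables (lam lam1 lam2 : R) (Ns : 'I_3 -> R -> T -> nat).
Variable J : 'I_3 -> nat -> {RV P >-> R}.
Hypothesis model : shock_model lam lam1 lam2 Ns J.

Let poissonN i := shock_poisson model i.

Definition sample_path (w : T) : path R :=
  @Path R (fun i t => Ns i t w) (fun i k => J i k w)
    (fun i => poisson_nondecreasing (poissonN i) w)
    (fun i => poisson_right_continuous (poissonN i) w).

Lemma indep_product (A : 'I_3 -> set T) (V : 'I_3 -> nat -> set R) (K : nat) :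
  (forall i, sigma_process (Ns i) (A i)) -> (forall i k, measurable (V i k)) ->
  P ((\bigcap_i A i) `&` [set w | forall i k, (k < K)%N -> V i k (J i k w)]) =
  ((\prod_(i < 3) P (A i)) *
   \prod_(i < 3) \prod_(0 <= k < K) exponential_prob 1%R (V i k))%E.
Proof.
move=> mA mV.
pose E (x : 'I_3 + 'I_3 * nat) := match x with
  | inl i => A i | inr ik => J ik.1 ik.2 @^-1` V ik.1 ik.2 end.
pose s : seq ('I_3 + 'I_3 * nat) :=
  [seq inl i | i <- enum 'I_3] ++ [seq inr (i, k) | i <- enum 'I_3, k <- iota 0 K].
have us : uniq s.
  rewrite cat_uniq map_inj_uniq ?enum_uniq//=; last by move=> i j [].
  rewrite allpairs_uniq ?enum_uniq ?iota_uniq//; last by move=> [i k] [j m] _ _ [-> ->].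
  rewrite andbT; apply/hasPn => x /allpairsP[[i k] [_ _ ->]] /=.
  by apply/negP => /mapP[].
have indep : P (\big[setI/setT]_(x <- s) E x) = (\prod_(x <- s) P (E x))%E.
  apply: (shock_independent model us) => -[i _|[i k] _] /=; first exact: mA.
  by exists (V i k) => //; rewrite setTI.
have -> : \bigcap_i A i `&` [set w | forall i k, (k < K)%N -> V i k (J i k w)]
    = \big[setI/setT]_(x <- s) E x.
  rewrite -bigcap_seq; apply/seteqP; split=> [w [wA wV] x /=|w wE].
    rewrite mem_cat => /orP[/mapP[i _ ->]|/allpairsP[[i k] /= [_ ik ->]]].
      exact: wA.
    by apply: wV; rewrite mem_iota in ik.
  split=> [i _|i k kK]; first by apply: (wE (inl i)) => /=; rewrite mem_cat map_f// mem_enum.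
  apply: (wE (inr (i, k))) => /=; rewrite mem_cat; apply/orP; right.
  by apply/allpairsP; exists (i, k); rewrite mem_enum mem_iota.
rewrite indep /s big_cat big_map big_allpairs_dep/= !big_enum/= /index_iota subn0.
congr (_ * _)%E.
apply: eq_bigr => i _; apply: eq_bigr => k _.
exact: (shock_exponential model).
Qed.

Lemma sigma_process_constraints i (l : seq (R * set nat)) (f : R -> R) :
  (forall a, a \in l -> 0 <= f a.1) ->
  sigma_process (Ns i) [set w | forall a, a \in l -> a.2 (Ns i (f a.1) w)].
Proof.
move=> l0; set G := \bigcup_(t in [set t : R | 0 <= t]) sigma_rv (Ns i t).
rewrite -[sigma_process _]/(@measurable _ (g_sigma_algebraType G)).
apply: (@measurable_count_constraints _ (g_sigma_algebraType G) R (Ns i) f) => a al.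
move=> _ U _; rewrite setTI; apply: sub_sigma_algebra; exists (f a.1); first exact: l0.
by exists U => //; rewrite setTI.
Qed.

Lemma sigma_process_increments i h (l : seq (R * set nat)) : 0 <= h ->
  (forall a, a \in l -> 0 <= a.1) ->
  sigma_process (Ns i) (constrained (Ns i) h l).
Proof.
move=> h0 l0; set G := \bigcup_(t in [set t : R | 0 <= t]) sigma_rv (Ns i t).
have mN t : 0 <= t -> measurable_fun [set: g_sigma_algebraType G] (Ns i t).
  move=> t0 _ U _; rewrite setTI; apply: sub_sigma_algebra; exists t => //.
  by exists U => //; rewrite setTI.
rewrite -[sigma_process _]/(@measurable _ (g_sigma_algebraType G)).
apply: (@measurable_count_constraints _ (g_sigma_algebraType G) R
  (fun t w => Ns i (h + t) w - Ns i h w)%N id l) => a al.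
by apply: measurable_fun_subn; apply: mN; rewrite ?addr_ge0// l0.
Qed.

Lemma sigma_processI i A B : sigma_process (Ns i) A -> sigma_process (Ns i) B ->
  sigma_process (Ns i) (A `&` B).
Proof. exact: (@measurableI _ (g_sigma_algebraType _)). Qed.

Lemma measurable_sample_path : measurable_fun setT (sample_path : T -> path_space R).
Proof.
apply: measurable_path_fun => [i t t0|i k]; last exact: measurable_funPT.
exact: (poisson_measurable (poissonN i) t0).
Qed.

Section fixed_time.
Variables (h : R) (h_ge0 : 0 <= h) (n : 'I_3 -> nat).

Definition count_event : set T := [set w | forall i, Ns i h w = n i].

Local Notation past := (fun w => stopped_path h_ge0 n (sample_path w)).
Local Notation future := (fun w => shifted_path h_ge0 n (sample_path w)).

Lemma prod_exponential_shift (V : nat -> set R) (k K' K : nat) : (K' + k <= K)%N ->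
  (forall j, (K' <= j)%N -> V j = setT) ->
  (\prod_(0 <= j < K) exponential_prob 1%R (if (j < k)%N then setT else V (j - k)%N)
   = \prod_(0 <= j < K') exponential_prob 1%R (V j))%E.
Proof.
move=> kK VK'; rewrite (big_cat_nat _ (n := k))//=; last first.
  by apply: leq_trans kK; exact: leq_addl.
rewrite [X in (X * _)%E]big_nat_cond [X in (X * _)%E]big1 ?mul1e; last first.
  by move=> j /andP[/andP[_ ->] _]; rewrite probability_setT.
rewrite -{1}(add0n k) big_addn (big_cat_nat _ (n := K'))//=; last by lia.
rewrite [X in (_ * X)%E]big_nat_cond [X in (_ * X)%E]big1 ?mule1; last first.
  move=> j /andP[/andP[K'j _] _]; rewrite ltnNge leq_addl/= addnK VK'//.
  by rewrite probability_setT.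
by apply: eq_big_nat => j _; rewrite ltnNge leq_addl/= addnK.
Qed.

Lemma cylinder_prob l V K : (forall i a, a \in l i -> 0 <= a.1) ->
  (forall i k, measurable (V i k)) -> (forall i k, (K <= k)%N -> V i k = setT) ->
  P (sample_path @^-1` cylinder l V) =
  (\prod_(i < 3) P [set w | forall a, a \in l i -> a.2 (Ns i a.1 w)] *
   \prod_(i < 3) \prod_(0 <= k < K) exponential_prob 1%R (V i k))%E.
Proof.
move=> l0 mV VK; rewrite -indep_product//; last first.
  by move=> i; apply: (@sigma_process_constraints i (l i) id); exact: l0.
congr (P _); apply/seteqP; split=> w [wl wV]; split=> i.
- by move=> _; exact: wl.
- by move=> k _; exact: wV.
- by move=> a; exact: wl.
- move=> k; have [kK|Kk] := ltnP k K; first exact: wV.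
  by rewrite VK.
Qed.

Lemma markov_cylinder C D : cylinders C -> cylinders D ->
  P (count_event `&` past @^-1` C `&` future @^-1` D) =
  (P (count_event `&` past @^-1` C) * P (sample_path @^-1` D))%E.
Proof.
move=> [l [V [K [l0 mV VK ->]]]] [l' [V' [K' [l'0 mV' VK' ->]]]].
(* [Wp] and [Wf] are what the past and the future require of the single size [J i k]. Given the
   counts [n], the future only reads the sizes of rank at least [n i]; for those the stopped path
   carries 0, so the past requirement is either everything or impossible. *)
pose Wp i k := [set x : R | V i k (if (k < n i)%N then x else 0)].
pose Wf i k := if (k < n i)%N then setT else V' i (k - n i)%N.
pose K'' := (K + (K' + \sum_(i < 3) n i))%N.
pose lp i : seq (R * set nat) := (h, [set n i]) :: l i.
pose Ap i := [set w | forall a, a \in lp i -> a.2 (Ns i (Num.min a.1 h) w)].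
have lp0 i a : a \in lp i -> 0 <= a.1.
  by rewrite inE => /predU1P[->//|]; exact: l0.
have WpT i k : (n i <= k)%N -> Wp i k = setT \/ Wp i k = set0.
  rewrite /Wp ltnNge => -> /=; have [H|H] := pselect (V i k 0); [left|right];
    by apply/seteqP; split.
have mWp i k : measurable (Wp i k).
  have [kn|/WpT[]->//] := ltnP k (n i).
  by rewrite /Wp kn; exact: mV.
have mWf i k : measurable (Wf i k) by rewrite /Wf; case: ifP.
have niK i : (n i <= \sum_(i < 3) n i)%N by rewrite (bigD1 i)//= leq_addr.
have WfK i k : (K'' <= k)%N -> Wf i k = setT.
  by move=> kK; rewrite /Wf; case: ifPn => // _; rewrite VK'//; have := niK i; lia.
have WpK i k : (K'' <= k)%N -> Wp i k = setT.
  by move=> kK; rewrite /Wp VK//; lia.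
have sAp i : sigma_process (Ns i) (Ap i).
  apply: (@sigma_process_constraints i (lp i) (fun t => Num.min t h)) => a al.
  by rewrite le_min h_ge0 (lp0 i).
have pastE : count_event `&` past @^-1` cylinder l V =
    \bigcap_i Ap i `&` [set w | forall i k, (k < K'')%N -> Wp i k (J i k w)].
  apply/seteqP; split=> [w [wn [wl wV]]|w [wA wW]]; split.
  - by move=> i _ a; rewrite inE => /predU1P[->/=|]; [rewrite minxx; exact: wn|exact: wl].
  - by move=> i k _; exact: wV.
  - by move=> i; have := wA i I (h, [set n i]); rewrite /= minxx; apply; rewrite inE eqxx.
  - split=> i => [a al|k]; first by apply: wA => //; rewrite inE al orbT.
    have [kK|Kk] := ltnP k K''; first exact: wW.
    by rewrite (_ : V i k = setT)// VK//; lia.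
have jointE : count_event `&` past @^-1` cylinder l V `&` future @^-1` cylinder l' V' =
    \bigcap_i (Ap i `&` constrained (Ns i) h (l' i)) `&`
    [set w | forall i k, (k < K'')%N -> (Wp i k `&` Wf i k) (J i k w)].
  rewrite pastE; apply/seteqP; split=> [w [[wA wW] [wl' wV']]|w [wA wW]]; split.
  - by move=> i _; split; [exact: wA|exact: wl'].
  - move=> i k kK; split; first exact: wW.
    rewrite /Wf; case: ifPn => //; rewrite -leqNgt => nk.
    by have := wV' i (k - n i)%N; rewrite /= subnKC.
  - by split=> i => [_|k kK]; [have [] := wA i I|have [] := wW i k kK].
  - split=> i => [a al|k]; first by have [_] := wA i I; exact.
    have [kK|Kk] := ltnP (n i + k)%N K''; last first.
      by rewrite VK'//; have := niK i; lia.
    have [_] := wW i _ kK; rewrite /Wf ifF ?addKn//.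
    by apply/negbTE; rewrite -leqNgt leq_addr.
rewrite jointE (@indep_product (fun i => Ap i `&` constrained (Ns i) h (l' i))
  (fun i k => Wp i k `&` Wf i k)); last 2 first.
  move=> i; apply: sigma_processI => //.
  by apply: sigma_process_increments => // a; exact: l'0.
  by move=> i k; exact: measurableI.
rewrite pastE indep_product// (cylinder_prob l'0 mV' VK').
rewrite [RHS]muleACA; congr (_ * _)%E; rewrite -big_split/=; apply: eq_bigr => i _.
  by apply: (poisson_markov (poissonN i)) => // a; [exact: lp0|exact: l'0].
rewrite -(@prod_exponential_shift _ (n i) K' K''); last 2 first.
  by have := niK i; lia.
  by move=> j; exact: VK'.
rewrite -big_split/=; apply: eq_bigr => k _; rewrite -/(Wf i k).
(* The probability of the intersection factorizes without any independence here, since for each size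
   one of the two requirements is the full set or the past one is empty. *)
have [kn|nk] := ltnP k (n i); first by rewrite /Wf kn setIT probability_setT// mule1.
case: (WpT i k nk) => ->; first by rewrite setTI probability_setT// mul1e.
by rewrite set0I !measure0// mul0e.
Qed.

End fixed_time.

End shock_markov.

Lemma finite_measure_ext d (T : measurableType d) (R : realType) (G : set_system T)
    (m1 m2 : {measure set T -> \bar R}) :
  @measurable _ T = <<s G >> -> setI_closed G -> G setT ->
  (m1 setT < +oo)%E -> (forall A, G A -> m1 A = m2 A) ->
  forall A, measurable A -> m1 A = m2 A.
Proof.
move=> mG GI GT m1oo m12 A mA.
by apply: (measure_unique G (fun=> setT)) => //; rewrite bigcup_const//.
Qed.

Definition pushforward_measure d d' (T : measurableType d) (T' : measurableType d')
    (R : realType) (m : {measure set T -> \bar R}) (X : {mfun T >-> T'}) :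
    {measure set T' -> \bar R} :=
  measure_function_pushforward__canonical__measure_function_Measure m
    (measurable_funPT X).

Lemma ge0_integral_mrestr d (T : measurableType d) (R : realType)
    (m : {measure set T -> \bar R}) (B : set T) (mB : measurable B) (f : T -> \bar R) :
  measurable_fun setT f -> (forall x, 0 <= f x)%E ->
  (\int[mrestr m mB]_x f x = \int[m]_(x in B) f x)%E.
Proof.
move=> mf f0; rewrite (@ge0_negligible_integral _ _ _ (mrestr m mB) setT (~` B))//.
- rewrite setTD setCK; apply: eq_measure_integral => A mA AB.
  by rewrite -[LHS]/(m (A `&` B)) setIidl.
- exact: measurableC.
- by rewrite /= /mrestr setICl measure0.
Qed.

Lemma measurable_stopped_path (R : realType) (h : R) (h_ge0 : 0 <= h) n :
  measurable_fun [set: path_space R] (stopped_path h_ge0 n : _ -> path_space R).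
Proof.
apply: measurable_path_fun => [i t t0|i k] /=.
  by apply: measurable_count; rewrite le_min t0.
by case: (k < n i)%N; [exact: measurable_size_of|exact: measurable_cst].
Qed.

Lemma measurable_shifted_path (R : realType) (h : R) (h_ge0 : 0 <= h) n :
  measurable_fun [set: path_space R] (shifted_path h_ge0 n : _ -> path_space R).
Proof.
apply: measurable_path_fun => [i t t0|i k] /=; last exact: measurable_size_of.
by apply: measurable_fun_subn; apply: measurable_count; rewrite ?addr_ge0.
Qed.

Section markov_sets.
Context d (T : measurableType d) (R : realType) (P : probability T R).
Variables (lam lam1 lam2 : R) (Ns : 'I_3 -> R -> T -> nat).
Variable J : 'I_3 -> nat -> {RV P >-> R}.
Hypothesis model : shock_model lam lam1 lam2 Ns J.

Local Notation xi := (sample_path model).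

Definition sample_path_mfun : {mfun T >-> path_space R} :=
  mfun_Sub (mem_set (measurable_sample_path model)).

Definition path_law : probability (path_space R) R :=
  distribution P sample_path_mfun.

Section fixed_time.
Variables (h : R) (h_ge0 : 0 <= h) (n : 'I_3 -> nat).

Local Notation B := (count_event Ns h n).
Local Notation past := (fun w => stopped_path h_ge0 n (xi w)).
Local Notation future := (fun w => shifted_path h_ge0 n (xi w)).

Lemma measurable_past : measurable_fun setT (past : T -> path_space R).
Proof.
exact: measurableT_comp (measurable_stopped_path h_ge0 n) (measurable_sample_path model).
Qed.

Lemma measurable_future : measurable_fun setT (future : T -> path_space R).
Proof.
exact: measurableT_comp (measurable_shifted_path h_ge0 n) (measurable_sample_path model).
Qed.

Let past_mfun : {mfun T >-> path_space R} := mfun_Sub (mem_set measurable_past).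
Let future_mfun : {mfun T >-> path_space R} := mfun_Sub (mem_set measurable_future).

Lemma measurable_count_event : measurable B.
Proof.
rewrite (_ : B = \bigcap_i (Ns i h @^-1` [set n i])).
  apply: measurable_bigcap_ord => i; rewrite -[X in measurable X]setTI.
  exact: (poisson_measurable (shock_poisson model i) h_ge0).
by apply/seteqP; split=> w wn i => [_|]; [exact: wn|exact: (wn i I)].
Qed.

(** Uniqueness of finite measures on a pi-system, used twice: the future set is extended from
    cylinders for a fixed past cylinder, then the past set for a fixed measurable future. *)
Lemma markov_sets C D : measurable (C : set (path_space R)) ->
  measurable (D : set (path_space R)) ->
  P (B `&` past @^-1` C `&` future @^-1` D) =
  (P (B `&` past @^-1` C) * path_law D)%E.
Proof.
have mB := measurable_count_event.
have mpre (X : {mfun T >-> path_space R}) A :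
    measurable (A : set (path_space R)) -> measurable (X @^-1` A).
  by move=> mA; rewrite -[X in measurable X]setTI; exact: measurable_funPT.
have mcyl A : cylinders A -> measurable (A : set (path_space R)).
  exact: sub_sigma_algebra.
pose ext := @finite_measure_ext _ (path_space R) R (@cylinders R).
have step1 C' : cylinders C' -> forall D', measurable (D' : set (path_space R)) ->
    P (B `&` past @^-1` C' `&` future @^-1` D') =
    (P (B `&` past @^-1` C') * path_law D')%E.
  move=> cC' D' mD'; have mBC : measurable (B `&` past @^-1` C').
    by apply: measurableI => //; apply: (mpre past_mfun); exact: mcyl.
  pose r : {nonneg R} := NngNum (fine_ge0 (measure_ge0 P (B `&` past @^-1` C'))).
  have rE : P (B `&` past @^-1` C') = r%:num%:E by rewrite fineK// fin_num_measure.
  pose m1 : {measure set (path_space R) -> \bar R} :=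
    pushforward_measure (mrestr P mBC) future_mfun.
  pose m2 : {measure set (path_space R) -> \bar R} := mscale r path_law.
  have m1E A : m1 A = P (B `&` past @^-1` C' `&` future @^-1` A).
    by rewrite /m1 /= /pushforward /mrestr setIC.
  have m2E A : m2 A = (P (B `&` past @^-1` C') * path_law A)%E by rewrite rE.
  rewrite -m1E -m2E; apply: (ext m1 m2 erefl (@cylinders_setI R) (@cylinders_setT R)) => //.
    by rewrite m1E preimage_setT setIT rE ltry.
  by move=> A cA; rewrite m1E m2E; exact: markov_cylinder.
move=> mC mD; have mBD : measurable (B `&` future @^-1` D).
  by apply: measurableI => //; exact: (mpre future_mfun).
pose r : {nonneg R} := NngNum (fine_ge0 (measure_ge0 path_law D)).
have rE : path_law D = r%:num%:E by rewrite fineK// fin_num_measure.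
pose m1 : {measure set (path_space R) -> \bar R} :=
  pushforward_measure (mrestr P mBD) past_mfun.
pose m2 : {measure set (path_space R) -> \bar R} :=
  mscale r (pushforward_measure (mrestr P mB) past_mfun).
have m1E A : m1 A = P (B `&` past @^-1` A `&` future @^-1` D).
  by rewrite -[LHS]/(P (past @^-1` A `&` (B `&` future @^-1` D))) setICA setIA.
have m2E A : m2 A = (P (B `&` past @^-1` A) * path_law D)%E.
  by rewrite rE muleC /m2 /= /mscale /pushforward /mrestr setIC.
rewrite -m1E -m2E; apply: (ext m1 m2 erefl (@cylinders_setI R) (@cylinders_setT R)) => //.
  rewrite m1E preimage_setT setIT.
  by rewrite (le_lt_trans (probability_le1 P mBD))// ltry.
by move=> A cA; rewrite m1E m2E; exact: step1.
Qed.

(** On the event of counts [n], the joint law of a function of the past and of the future is a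
    product measure, because the two agree on rectangles. The right-hand side is the product measure
    of [K] computed by sections. *)
Lemma markov_integral d' (S : measurableType d') (g : path_space R -> S)
    (K : set (S * path_space R)) :
  measurable_fun setT g -> measurable K ->
  P (B `&` [set w | K (g (past w), future w)]) =
  (\int[P]_(w in B) path_law (xsection K (g (past w))))%E.
Proof.
move=> mg mK; have mB := measurable_count_event.
have mV : measurable_fun setT (fun w => g (past w)).
  exact: measurableT_comp mg measurable_past.
pose V : {mfun T >-> S} := mfun_Sub (mem_set mV).
have mVF : measurable_fun setT (fun w => (g (past w), future w : path_space R)).
  exact: measurable_fun_pair mV measurable_future.
pose VF : {mfun T >-> (S * path_space R)%type} := mfun_Sub (mem_set mVF).
pose m1 : {measure set (S * path_space R) -> \bar R} :=
  pushforward_measure (mrestr P mB) VF.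
pose mu1 : {measure set S -> \bar R} := pushforward_measure (mrestr P mB) V.
pose m2 : {measure set (S * path_space R) -> \bar R} := (mu1 \x path_law)%E.
have m2E A : measurable A ->
    m2 A = (\int[P]_(w in B) path_law (xsection A (g (past w))))%E.
  move=> mA; have mf := measurable_fun_xsection path_law mA.
  rewrite -[LHS]/(\int[pushforward (mrestr P mB) V]_x (path_law \o xsection A) x)%E.
  rewrite ge0_integral_pushforward//.
  rewrite preimage_setT ge0_integral_mrestr//.
  exact: measurableT_comp mf mV.
rewrite -m2E// -[LHS]/(P (B `&` (VF @^-1` K))) setIC -[LHS]/(m1 K).
pose G := [set X `*` Y | X in @measurable _ S & Y in @measurable _ (path_space R)].
apply: (@finite_measure_ext _ _ R G) => //.
- exact: measurable_prod_measurableType.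
- move=> _ _ [X mX [Y mY <-]] [X' mX' [Y' mY' <-]].
  exists (X `&` X'); first exact: measurableI.
  by exists (Y `&` Y'); [exact: measurableI|rewrite setXI].
- by exists setT => //; exists setT => //; rewrite setXTT.
- rewrite -[X in (X < _)%E]/(P ((VF @^-1` setT) `&` B)) preimage_setT setTI.
  by rewrite (le_lt_trans (probability_le1 P mB))// ltry.
move=> _ [X mX [Y mY <-]]; rewrite [RHS]product_measure1E//.
rewrite -[LHS]/(P ((VF @^-1` (X `*` Y)) `&` B)) -[X in _ = (X * _)%E]/(P ((V @^-1` X) `&` B)).
rewrite [in RHS]setIC -(@markov_sets (g @^-1` X) Y)//; last first.
  by rewrite -[X in measurable X]setTI; exact: mg.
by congr (P _); rewrite setIC -setIA.
Qed.

End fixed_time.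
End markov_sets.

(** * One-step equation of the escape probability *)

Section small_flows.
Context (R : realType) (c1 c2 q1 q2 qb1 qb2 r1 r2 : R).
Hypotheses (c1_ge0 : 0 <= c1) (c2_ge0 : 0 <= c2).
Hypotheses (r1_gt0 : 0 < r1) (r2_gt0 : 0 < r2) (r12 : 1 < r1 * r2).
Local Notation flow := (flow c1 c2 q1 q2 qb1 qb2 r1 r2).
Local Notation drift := (drift c1 c2).
Implicit Types (e : path R) (z : R * R).

Lemma flow_no_jump e h z : 0 <= h -> total e h = 0%N -> quadrant z ->
  flow e h z = z + drift h.
Proof.
move=> h0 eh Qz; have e0 : total e 0 = 0%N.
  by apply/eqP; rewrite -leqn0 -eh total_nondecreasing.
rewrite /flow eh /= e0 eh ltnn subr0.
rewrite (total_eq_pure_jump _ _ _ _ (lexx 0) h0) ?eh//.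
by rewrite subrr addr0 reflect_point_id//; exact: quadrant_drift.
Qed.

Lemma stageS e t z n : stage c1 c2 q1 q2 qb1 qb2 r1 r2 e t z n.+1 =
  reflect_point r1 r2 (stage c1 c2 q1 q2 qb1 qb2 r1 r2 e t z n
      + drift (stage_time e t n.+1 - stage_time e t n)
      + (pure_jump q1 q2 qb1 qb2 e (stage_time e t n.+1)
         - pure_jump q1 q2 qb1 qb2 e (stage_time e t n))).
Proof. by []. Qed.

Definition single_jump (i : 'I_3) (x : R) : R * R :=
  tnth [tuple (x / qb1, x / qb2); (x / q1, 0); (0, x / q2)] i.

Definition unit_count (i j : 'I_3) : nat := (i == j).

(** Two stages, the second reflection being trivial. The jump time [s] is chosen before [z]: it
    depends on the path only, so one may integrate over the starting point with [s] fixed. *)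
Lemma flow_one_jump e h i : 0 <= h -> (forall j, count e j 0 = 0%N) ->
  (forall j, count e j h = unit_count i j) ->
  exists2 s, 0 <= s <= h & forall z, flow e h z =
    reflect_point r1 r2 (z + drift s - single_jump i (size_of e i 0)) + drift (h - s).
Proof.
move=> h0 e0 eh.
have toth : total e h = 1%N.
  rewrite /total (bigD1 i)//= big1 ?eh /unit_count ?eqxx// => j ji.
  by rewrite eh /unit_count eq_sym (negbTE ji).
have tot0 : total e 0 = 0%N by rewrite /total big1.
exists (stage_time e h 1); first exact: stage_time_itv.
have s0 := stage_time_ge0 e h0 1; have sh := stage_time_le e h0 1.
have prog := stage_time_progress e h0 1; move=> z.
have T2 : stage_time e h 2 = h.
  by rewrite -[in RHS](stage_time_end e h0) toth.
rewrite /flow toth !stageS T2 [stage_time e h 0]/=.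
move: (stage_time e h 1) s0 sh prog T2 => s s0 sh prog T2.
have tots : total e s = total e h.
  apply/eqP; rewrite eqn_leq (total_nondecreasing e s0 sh) toth.
  by move: prog; rewrite toth => -[].
have Js : pure_jump q1 q2 qb1 qb2 e s - pure_jump q1 q2 qb1 qb2 e 0
    = - single_jump i (size_of e i 0).
  rewrite /pure_jump !e0 !big_ord0 !mulr0 !subr0 oppr0 subr0.
  rewrite !(total_eq_count _ s0 sh tots) !eh /unit_count.
  case: i eh => -[|[|[|//]]] i3 eh /=; rewrite /single_jump (tnth_nth 0)/=;
  congr pair; rewrite /= ?big_ord0 ?big_ord1 ?mulr0 ?subr0 ?oppr0 ?sub0r //;
  by rewrite mulrC; congr (- (size_of e _ _ / _)); apply: val_inj.
rewrite [stage _ _ _ _ _ _ _ _ _ _ _ 0]/= subr0 Js (total_eq_pure_jump _ _ _ _ s0 sh tots).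
rewrite subrr addr0 [LHS]reflect_point_id//.
apply: quadrant_drift => //; first by rewrite subr_ge0.
exact: reflect_point_quadrant.
Qed.

End small_flows.

Section escape_markov.
Context d (T : measurableType d) (R : realType) (P : probability T R).
Variables (c1 c2 q1 q2 qb1 qb2 r1 r2 lam lam1 lam2 : R).
Hypotheses (c1_ge0 : 0 <= c1) (c2_ge0 : 0 <= c2).
Hypotheses (r1_gt0 : 0 < r1) (r2_gt0 : 0 < r2) (r12 : 1 < r1 * r2).
Variables (Ns : 'I_3 -> R -> T -> nat) (J : 'I_3 -> nat -> {RV P >-> R}).
Hypothesis model : shock_model lam lam1 lam2 Ns J.
Variable Y : R -> R -> T -> R -> R * R.
Hypothesis reflected : forall u v : R, 0 <= u -> 0 <= v -> forall w,
  reflected_path c1 c2 r1 r2 (free_process c1 c2 q1 q2 qb1 qb2 Ns J w) u v (Y u v w).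

Local Notation xi := (sample_path model).
Local Notation flow := (flow c1 c2 q1 q2 qb1 qb2 r1 r2).
Local Notation escape_set := (escape_set c1 c2 q1 q2 qb1 qb2 r1 r2).

(** Built from the law of the driving path and a measurable set, this function is measurable and
    bounded on the whole plane, which cannot be read off [escape_prob1]. *)
Definition escape_law (z : R * R) : R :=
  fine (path_law model (xsection escape_set z)).

Lemma free_processE w :
  free_process c1 c2 q1 q2 qb1 qb2 Ns J w = free_path c1 c2 q1 q2 qb1 qb2 (xi w).
Proof.
by apply/funext => t; rewrite /free_process /free_path; congr pair; rewrite /= addrA.
Qed.

Lemma Y_evolves u v w : quadrant (u, v) ->
  evolves c1 c2 q1 q2 qb1 qb2 r1 r2 (xi w) (Y u v w) /\ Y u v w 0 = (u, v).
Proof.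
move=> Quv; have [u0 v0] := Quv; have rY := reflected u0 v0 w; split.
  exact: reflected_evolves (free_processE w) rY Quv.
by rewrite (reflected_start rY).
Qed.

Lemma escape_prob1E u v : quadrant (u, v) -> escape_prob1 P Y u v = escape_law (u, v).
Proof.
move=> Quv; rewrite /escape_law /escape_prob1; congr fine.
rewrite -[RHS]/(P (xi @^-1` xsection escape_set (u, v))); congr (P _).
apply/seteqP; split=> w; have [eY Y0] := Y_evolves w Quv.
  have := escaping_flow r1_gt0 r2_gt0 r12 c1_ge0 c2_ge0 eY; rewrite Y0 => /(_ Quv)[H _] /H.
  by rewrite /= /xsection/= inE.
have := escaping_flow r1_gt0 r2_gt0 r12 c1_ge0 c2_ge0 eY; rewrite Y0 => /(_ Quv)[_ H].
by rewrite /= /xsection/= inE => /H.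
Qed.

Lemma measurable_escape_law : measurable_fun setT escape_law.
Proof.
apply: (measurableT_comp (fine_measurable _)) => //.
apply: measurable_fun_xsection.
exact: measurable_escape_set.
Qed.

Lemma escape_law_itv z : 0 <= escape_law z <= 1.
Proof.
have mx : measurable (xsection escape_set z : set (path_space R)).
  by apply: measurable_xsection; exact: measurable_escape_set.
rewrite /escape_law fine_ge0//= -lee_fin fineK ?fin_num_measure//.
exact: probability_le1.
Qed.

Section fixed_time.
Variables (h : R) (h_ge0 : 0 <= h).

(** Escape only concerns the tail of the trajectory, and after [h] the trajectory is the one driven
    by the shifted path from the position reached at [h]. *)
Lemma sample_flow_shift u v w n : quadrant (u, v) -> (forall i, Ns i h w = n i) ->
  escape_set ((u, v), xi w) <->
  escape_set (flow (xi w) h (u, v), shifted_path h_ge0 n (xi w)).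
Proof.
move=> Quv wn; have [eY Y0] := Y_evolves w Quv.
have Q0 : quadrant (Y u v w 0) by rewrite Y0.
have Yh := evolves_flow r1_gt0 r2_gt0 r12 eY Q0 h_ge0.
have eY' := @evolves_shifted _ h h_ge0 n (xi w) c1 c2 q1 q2 qb1 qb2 r1 r2 (Y u v w) wn eY.
have Q0' : quadrant (Y u v w (h + 0)).
  by rewrite addr0; apply: (evolves_quadrant r1_gt0 r2_gt0 r12 eY Q0 h_ge0).
have := escaping_flow r1_gt0 r2_gt0 r12 c1_ge0 c2_ge0 eY Q0.
have := escaping_flow r1_gt0 r2_gt0 r12 c1_ge0 c2_ge0 eY' Q0'.
rewrite /= addr0 Yh Y0 => <- <-.
rewrite !escapingP; split=> H k; have [n0 Hn] := H k.
  exists n0 => t nt; apply: Hn; apply: (le_trans nt); by rewrite lerDr.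
exists (n0 + Num.bound h)%N => t nt; rewrite -(subrK h t) addrC; apply: Hn.
rewrite lerBrDr (le_trans _ nt)// natrD lerD2l ltW//; exact: archi_boundP.
Qed.

Lemma markov_escape z n : quadrant z ->
  P (count_event Ns h n `&` [set w | escape_set (z, xi w)]) =
  (\int[P]_(w in count_event Ns h n) (escape_law (flow (xi w) h z))%:E)%E.
Proof.
case: z => u v Quv.
(* The position at [h] is a function of the stopped path alone, which brings the event into the form
   of [markov_integral]. *)
have past_flow w : count_event Ns h n w ->
    flow (stopped_path h_ge0 n (xi w)) h (u, v) = flow (xi w) h (u, v).
  move=> wn; apply: flow_ext => //= [i s s0 sh|i k].
    by rewrite (min_idPl sh).
  by rewrite minxx wn => ->.
pose g (e : path_space R) := flow e h (u, v).
have mg : measurable_fun [set: path_space R] g.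
  exact: measurableT_comp (measurable_flow c1 c2 q1 q2 qb1 qb2 r1 r2 h_ge0)
    (pair1_measurable (u, v)).
transitivity (P (count_event Ns h n `&`
    [set w | escape_set (g (stopped_path h_ge0 n (xi w)), shifted_path h_ge0 n (xi w))])).
  congr (P _); apply/seteqP; split=> w [wn] /=; rewrite /g past_flow//.
    by move=> /(sample_flow_shift Quv wn).
  by move=> H; split=> //; apply/(sample_flow_shift Quv wn).
rewrite markov_integral//; last exact: measurable_escape_set.
apply: eq_integral => w; rewrite inE => wn; rewrite /g past_flow// fineK//.
apply: fin_num_measure; apply: measurable_xsection; exact: measurable_escape_set.
Qed.

End fixed_time.

End escape_markov.

Section poisson_values.
Context (R : realType).

(** For [r = 0], which occurs when [lam = 0], the law is a Dirac mass and the convention 0^0 = 1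
    keeps the same formula. *)
Lemma poisson_prob_set1 (r : R) k : 0 <= r ->
  poisson_prob r 0%N [set k] = (r ^+ k / k`!%:R * expR (- r))%:E.
Proof.
rewrite le_eqVlt => /predU1P[<-|r0].
  rewrite /poisson_prob ltxx oppr0 expR0 mulr1 diracE.
  case: k => [|k]; first by rewrite mem_set// expr0 fact0 divr1.
  by rewrite memNset// exprS !mul0r.
by rewrite /poisson_prob r0 esum_set1 ?lee_fin ?poisson_pmf_ge0// /poisson_pmf r0.
Qed.

End poisson_values.

(** * Splitting the escape event by the number of shocks before h *)

Section one_step.
Context d (T : measurableType d) (R : realType) (P : probability T R).
Variables (c1 c2 q1 q2 qb1 qb2 r1 r2 lam lam1 lam2 : R).
Hypotheses (c1_ge0 : 0 <= c1) (c2_ge0 : 0 <= c2).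
Hypotheses (r1_gt0 : 0 < r1) (r2_gt0 : 0 < r2) (r12 : 1 < r1 * r2).
Hypotheses (lam_ge0 : 0 <= lam) (lam1_ge0 : 0 <= lam1) (lam2_ge0 : 0 <= lam2).
Variables (Ns : 'I_3 -> R -> T -> nat) (J : 'I_3 -> nat -> {RV P >-> R}).
Hypothesis model : shock_model lam lam1 lam2 Ns J.

Local Notation xi := (sample_path model).
Local Notation flow := (flow c1 c2 q1 q2 qb1 qb2 r1 r2).
Local Notation escape_set := (escape_set c1 c2 q1 q2 qb1 qb2 r1 r2).
Local Notation Lam := (lam + lam1 + lam2).

Definition rate (i : 'I_3) : R := tnth [tuple lam; lam1; lam2] i.

Lemma rate_ge0 i : 0 <= rate i.
Proof. by case: i => -[|[|[|//]]] i3; rewrite /rate (tnth_nth 0). Qed.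

Lemma sum_rate : \sum_(i < 3) rate i = Lam.
Proof. by rewrite !big_ord_recl big_ord0 /rate !(tnth_nth 0)/= addr0 addrA. Qed.

Lemma count_event_prob h n : 0 <= h ->
  P (count_event Ns h n) =
  (\prod_(i < 3) ((rate i * h) ^+ n i / (n i)`!%:R * expR (- (rate i * h))))%:E.
Proof.
move=> h0; have mE := measurable_count_event model h0 n.
pose l i : seq (R * set nat) := [:: (h, [set n i])].
have -> : count_event Ns h n = sample_path model @^-1` cylinder l (fun=> fun=> setT).
  apply/seteqP; split=> [w wn|w [wn _] i]; last by have := wn i (h, [set n i]); rewrite inE eqxx; exact.
  by split=> // i a; rewrite inE => /eqP ->; exact: wn.
rewrite (@cylinder_prob _ _ _ _ _ _ _ _ _ model l (fun=> fun=> setT) 0%N)//; last first.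
  by move=> i a; rewrite inE => /eqP ->.
rewrite [X in (_ * X)%E]big1 ?mule1; last by move=> i _; rewrite big_nil.
rewrite -prodEFin; apply: eq_bigr => i _; rewrite -poisson_prob_set1; last first.
  by rewrite mulr_ge0// rate_ge0.
have := poisson_increment (shock_poisson model i) (lexx 0) h0 [set n i].
rewrite subr0 => <-; congr (P _); apply/seteqP; split=> w /=.
  by move=> /(_ (h, [set n i])); rewrite inE eqxx (poisson_start (shock_poisson model i)) subn0; exact.
by rewrite (poisson_start (shock_poisson model i)) subn0 => wn a; rewrite inE => /eqP ->.
Qed.

Lemma no_jump_prob h : 0 <= h -> P (count_event Ns h (fun=> 0%N)) = (expR (- (Lam * h)))%:E.
Proof.
move=> h0; rewrite count_event_prob//; congr EFin.
under eq_bigr do rewrite expr0 fact0 divr1 mul1r.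
by rewrite -expR_sum sumrN -mulr_suml sum_rate.
Qed.

Lemma one_jump_prob h i : 0 <= h ->
  P (count_event Ns h (unit_count i)) = (rate i * h * expR (- (Lam * h)))%:E.
Proof.
move=> h0; rewrite count_event_prob// big_split/= -expR_sum sumrN -mulr_suml sum_rate.
congr (_ * _)%:E; rewrite (bigD1 i)//= big1 ?mulr1.
  by rewrite /unit_count eqxx expr1 divr1.
by move=> j ji; rewrite /unit_count eq_sym (negbTE ji) expr0 divr1.
Qed.

Lemma count_event_disjoint h n n' : (exists i, n i != n' i) ->
  count_event Ns h n `&` count_event Ns h n' = set0.
Proof.
move=> [i nn']; apply/seteqP; split=> // w [wn wn'].
by move: nn'; rewrite -(wn i) -(wn' i) eqxx.
Qed.

(** At least two shocks before [h], of equal or different kinds. *)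
Definition other_counts h : set T :=
  ~` (count_event Ns h (fun=> 0%N) `|` \big[setU/set0]_(i < 3) count_event Ns h (unit_count i)).

Lemma prob_count_split h E : 0 <= h -> measurable E ->
  P E = (P (count_event Ns h (fun=> 0%N) `&` E)
    + \sum_(i < 3) P (count_event Ns h (unit_count i) `&` E)
    + P (other_counts h `&` E))%E.
Proof.
move=> h0 mE; have mB n := measurable_count_event model h0 n.
have mU : measurable (\big[setU/set0]_(i < 3) count_event Ns h (unit_count i)).
  by apply: bigsetU_measurable.
set B0 := count_event Ns h (fun=> 0%N).
set U := \big[setU/set0]_(i < 3) count_event Ns h (unit_count i).
have disj i : B0 `&` count_event Ns h (unit_count i) = set0.
  by apply: count_event_disjoint; exists i; rewrite /unit_count eqxx.
have B0U : B0 `&` U = set0.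
  by rewrite big_distrr/= big1// => i _; exact: disj.
rewrite (measureDI P mE (mB (fun=> 0%N))) -/B0.
have mD : measurable (E `\` B0) by apply: measurableD => //; exact: mB.
rewrite (measureDI P mD mU) -/U [RHS]addeC [X in _ = (_ + X)%E]addeC addeA; congr (_ + _)%E; last by rewrite setIC.
congr (P _ + _)%E.
  by rewrite /other_counts -/B0 -/U !setDE -setIA -setCU setIC.
have -> : (E `\` B0) `&` U = \big[setU/set0]_(i < 3) (count_event Ns h (unit_count i) `&` E).
  rewrite setDE -setIA [X in E `&` X](_ : _ = U); last first.
    by apply/setIidPr => w Uw Bw; have : (B0 `&` U) w by []; rewrite B0U.
  by rewrite setIC big_distrl.
rewrite measure_bigsetU_ord//.
  by move=> i; apply: measurableI.
apply/trivIsetP => i j _ _ ij; rewrite setIACA.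
rewrite [X in X `&` _](_ : _ = set0) ?set0I//.
apply: count_event_disjoint; exists i.
by rewrite /unit_count eqxx [j == i]eq_sym (negbTE ij).
Qed.

Definition step_part h n (z : R * R) : R :=
  fine (\int[P]_(w in count_event Ns h n) (escape_law c1 c2 q1 q2 qb1 qb2 r1 r2 model
    (flow (xi w) h z))%:E)%E.

Variable Y : R -> R -> T -> R -> R * R.
Hypothesis reflected : forall u v : R, 0 <= u -> 0 <= v -> forall w,
  reflected_path c1 c2 r1 r2 (free_process c1 c2 q1 q2 qb1 qb2 Ns J w) u v (Y u v w).

Local Notation pesc := (escape_law c1 c2 q1 q2 qb1 qb2 r1 r2 model).

Lemma other_counts_prob h : 0 <= h ->
  fine (P (other_counts h)) = 1 - expR (- (Lam * h)) * (1 + Lam * h).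
Proof.
move=> h0; have := prob_count_split h0 measurableT.
rewrite probability_setT !setIT no_jump_prob//.
under eq_bigr do rewrite setIT one_jump_prob//.
rewrite sumEFin -mulr_suml -mulr_suml sum_rate.
have mO : measurable (other_counts h).
  apply: measurableC; apply: measurableU; first exact: (measurable_count_event model h0).
  by apply: bigsetU_measurable => i _; exact: (measurable_count_event model h0).
rewrite -[P (other_counts h)]fineK ?fin_num_measure// -!EFinD => -[E1]; rewrite /=; lra.
Qed.

(** The difference is the probability of escaping with at least two shocks before [h], hence lies
    between 0 and the probability of such shocks. *)
Lemma one_step_law z h : quadrant z -> 0 <= h ->
  0 <= pesc z - step_part h (fun=> 0%N) z
       - \sum_(i < 3) step_part h (unit_count i) z
    <= 1 - expR (- (Lam * h)) * (1 + Lam * h).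
Proof.
move=> Qz h0; pose E := xi @^-1` xsection escape_set z.
have mE : measurable E.
  rewrite -[X in measurable X]setTI; apply: (measurable_sample_path model) => //.
  by apply: measurable_xsection; exact: measurable_escape_set.
have mO : measurable (other_counts h).
  apply: measurableC; apply: measurableU; first exact: (measurable_count_event model h0).
  by apply: bigsetU_measurable => i _; exact: (measurable_count_event model h0).
have EE : E = [set w | escape_set (z, xi w)].
  by apply/seteqP; split=> w; rewrite /E/= /xsection/= inE.
have part n : P (count_event Ns h n `&` E) = (step_part h n z)%:E.
  rewrite /step_part EE -(markov_escape c1_ge0 c2_ge0 r1_gt0 r2_gt0 r12 model reflected)//.
  rewrite fineK//; apply: fin_num_measure.
  by apply: measurableI; [exact: (measurable_count_event model h0)|rewrite -EE].
have PE : P E = (pesc z)%:E.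
  rewrite /escape_law fineK//; apply: fin_num_measure.
  by apply: measurable_xsection; exact: measurable_escape_set.
have := prob_count_split h0 mE; rewrite PE part; under eq_bigr do rewrite part.
have POE : P (other_counts h `&` E) = (fine (P (other_counts h `&` E)))%:E.
  by rewrite fineK// fin_num_measure//; exact: measurableI.
rewrite POE sumEFin -!EFinD => -[->].
have -> : step_part h (fun=> 0%N) z + \sum_(i < 3) step_part h (unit_count i) z
   + fine (P (other_counts h `&` E)) - step_part h (fun=> 0%N) z
   - \sum_(i < 3) step_part h (unit_count i) z = fine (P (other_counts h `&` E)) by ring.
rewrite fine_ge0//= -other_counts_prob// fine_le ?fin_num_measure//.
- exact: measurableI.
- by apply: le_measure; rewrite ?inE//; exact: measurableI.
Qed.

Lemma step_part_no_jump z h : quadrant z -> 0 <= h ->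
  step_part h (fun=> 0%N) z = expR (- (Lam * h)) * pesc (z + drift c1 c2 h).
Proof.
move=> Qz h0; rewrite /step_part (eq_integral
  (fun=> (pesc (z + drift c1 c2 h))%:E)); last first.
  move=> w; rewrite inE => wn; rewrite flow_no_jump//.
  by rewrite /total big1// => i _; exact: wn.
have mB := measurable_count_event model h0 (fun=> 0%N).
by rewrite integral_cst// [X in (_ * X)%E]no_jump_prob//= mulrC.
Qed.

Lemma step_part_ge0 h n z : 0 <= step_part h n z.
Proof.
rewrite fine_ge0// integral_ge0// => w _.
by rewrite lee_fin; case/andP: (escape_law_itv c1 c2 q1 q2 qb1 qb2 r1 r2 model (flow (xi w) h z)).
Qed.

Lemma measurable_escape_flow h : 0 <= h -> measurable_fun [set: (R * R) * T]
  (fun zw : (R * R) * T => pesc (flow (xi zw.2) h zw.1)).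
Proof.
move=> h0; apply: (measurableT_comp (measurable_escape_law c1 c2 q1 q2 qb1 qb2 r1 r2 model)).
apply: (measurableT_comp (measurable_flow c1 c2 q1 q2 qb1 qb2 r1 r2 h0)
  (_ : measurable_fun setT (fun zw : (R * R) * T => (zw.1, xi zw.2 : path_space R)))).
apply: measurable_fun_pair => //.
exact: measurableT_comp (measurable_sample_path model) measurable_snd.
Qed.

Lemma step_part_le h n z : 0 <= h -> step_part h n z <= fine (P (count_event Ns h n)).
Proof.
move=> h0; have mB := measurable_count_event model h0 n.
have mf : measurable_fun setT (fun w => (pesc (flow (xi w) h z))%:E).
  apply/measurable_EFinP.
  exact: measurableT_comp (measurable_escape_flow h0) (pair1_measurable z).
have p01 w := escape_law_itv c1 c2 q1 q2 qb1 qb2 r1 r2 model (flow (xi w) h z).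
have le1 : (\int[P]_(w in count_event Ns h n) (pesc (flow (xi w) h z))%:E
    <= P (count_event Ns h n))%E.
  rewrite -[leRHS]mul1e -integral_cst//; apply: ge0_le_integral => //.
  - by move=> w _; rewrite lee_fin; case/andP: (p01 w).
  - exact: measurable_funTS.
  - by move=> w _; rewrite lee_fin; case/andP: (p01 w).
have PB : P (count_event Ns h n) \is a fin_num by exact: fin_num_measure.
apply: fine_le => //; rewrite ge0_fin_numE.
  by apply: le_lt_trans le1 _; rewrite -ge0_fin_numE.
by apply: integral_ge0 => w _; rewrite lee_fin; case/andP: (p01 w).
Qed.

(** Up to [h] the trajectory is pure drift unless a shock occurs, which has probability 1 - exp(-
    Lam h), at most Lam h. Only displacements along the drift are controlled in this way. *)
Lemma escape_law_lipschitz z h : quadrant z -> 0 <= h ->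
  `|pesc (z + drift c1 c2 h) - pesc z| <= Lam * h.
Proof.
move=> Qz h0; have := one_step_law Qz h0; rewrite step_part_no_jump//.
set S := \sum_(i < 3) _; set e := expR _.
have S0 : 0 <= S by apply: sumr_ge0 => i _; exact: step_part_ge0.
have SL : S <= Lam * h * e.
  rewrite -sum_rate !mulr_suml; apply: ler_sum => i _.
  by apply: le_trans (step_part_le _ _ h0) _; rewrite one_jump_prob.
have e1 : 1 - Lam * h <= e by have := expR_ge1Dx (- (Lam * h)).
have /andP[p0 p1] := escape_law_itv c1 c2 q1 q2 qb1 qb2 r1 r2 model (z + drift c1 c2 h).
have e0 : e <= 1.
  by rewrite /e -expR0 ler_expR oppr_le0 mulr_ge0// !addr_ge0.
have := mulr_ge0 p0 (_ : 0 <= 1 - e); rewrite subr_ge0 => /(_ e0) H1.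
have := mulr_ge0 (_ : 0 <= 1 - pesc (z + drift c1 c2 h)) (_ : 0 <= 1 - e).
rewrite !subr_ge0 => /(_ p1 e0) H2 /andP[Hl Hu].
rewrite ler_norml; apply/andP; split; lra.
Qed.

End one_step.

(** * Weighted integrals and Laplace transforms *)

Definition bounded_by d (T : measurableType d) (R : realType) (M : R) (f : T -> R) :=
  measurable_fun setT f /\ forall x, 0 <= f x <= M.

Section weighted_integral.
Context d (T : measurableType d) (R : realType) (m : {measure set T -> \bar R}).
Implicit Types (k f g : T -> R) (M : R).

(** One notion serves Laplace kernels, their truncations and indicators of events: against such a
    weight every bounded measurable function is integrable. *)
Definition weight k := [/\ measurable_fun setT k, (forall x, 0 <= k x) &
  (\int[m]_x (k x)%:E < +oo)%E].

Definition wint k f : R := \int[m]_x (k x * f x).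

Definition mass k : R := \int[m]_x (k x).

Lemma massE k : weight k -> (mass k)%:E = (\int[m]_x (k x)%:E)%E.
Proof.
move=> [mk k0 kfin]; rewrite /mass /Rintegral fineK// ge0_fin_numE//.
by apply: integral_ge0 => x _; rewrite lee_fin.
Qed.

Lemma mass_ge0 k : weight k -> 0 <= mass k.
Proof. by move=> [_ k0 _]; apply: Rintegral_ge0. Qed.

Section fixed_weight.
Variables (k : T -> R) (wk : weight k).

Let k0 x : 0 <= k x. Proof. by case: wk. Qed.
Let mk : measurable_fun setT k. Proof. by case: wk. Qed.

Lemma wint_integrable M f : bounded_by M f ->
  m.-integrable setT (EFin \o (fun x => k x * f x)).
Proof.
move=> [mf f01]; have intk : m.-integrable setT (EFin \o k).
  apply/integrableP; split; first exact/measurable_EFinP.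
  by under eq_integral do rewrite /= ger0_norm//; case: wk.
have intMk : m.-integrable setT (EFin \o (fun x => M * k x)).
  by have := integrableZl measurableT M intk; apply: eq_integrable.
apply: (le_integrable measurableT _ _ intMk) => //.
  by apply/measurable_EFinP; exact: measurable_funM.
move=> x _ /=; have /andP[fx0 fxM] := f01 x.
rewrite lee_fin !ger0_norm ?mulr_ge0// ?(le_trans fx0)//.
by rewrite mulrC ler_wpM2r.
Qed.

Lemma wintE M f : bounded_by M f ->
  (wint k f)%:E = (\int[m]_x (k x * f x)%:E)%E.
Proof.
by move=> bf; rewrite /wint /Rintegral fineK//; apply: integrable_fin_num => //;
  exact: wint_integrable bf.
Qed.

Lemma wint_cst c : 0 <= c -> wint k (fun=> c) = c * mass k.
Proof.
move=> c0; apply: EFin_inj; rewrite (@wintE c); last by split=> // x; rewrite c0 lexx.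
under eq_integral do rewrite mulrC EFinM.
rewrite ge0_integralZl//; first by rewrite EFinM massE.
- exact/measurable_EFinP.
- by move=> x _; rewrite lee_fin.
Qed.

Lemma wintD M f g : bounded_by M f -> bounded_by M g ->
  wint k (fun x => f x + g x) = wint k f + wint k g.
Proof.
move=> bf bg; rewrite /wint; under eq_Rintegral do rewrite mulrDr.
by rewrite RintegralD//; [exact: wint_integrable bf|exact: wint_integrable bg].
Qed.

Lemma wint_ge0 M f : bounded_by M f -> 0 <= wint k f.
Proof.
move=> [_ f0]; apply: Rintegral_ge0 => x _; rewrite mulr_ge0//.
by case/andP: (f0 x).
Qed.

Lemma wint_le M f g : bounded_by M f -> bounded_by M g ->
  (forall x, k x != 0 -> f x <= g x) -> wint k f <= wint k g.
Proof.
move=> bf bg fg; apply: le_Rintegral => //;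
  [exact: wint_integrable bf|exact: wint_integrable bg|].
move=> x _; have [->|kx] := eqVneq (k x) 0; first by rewrite !mul0r.
by rewrite ler_wpM2l// fg.
Qed.

Lemma wint_eq f g : (forall x, k x != 0 -> f x = g x) -> wint k f = wint k g.
Proof.
move=> fg; apply: eq_Rintegral => x _; have [->|kx] := eqVneq (k x) 0.
  by rewrite !mul0r.
by rewrite fg.
Qed.

Lemma bounded_byW M M' f : M <= M' -> bounded_by M f -> bounded_by M' f.
Proof. by move=> MM' [mf f0]; split=> // x; case/andP: (f0 x) => -> /le_trans; apply. Qed.

Lemma bounded_by_ge0 M f (x : T) : bounded_by M f -> 0 <= M.
Proof. by move=> [_ /(_ x)/andP[f0]]; exact: le_trans. Qed.

Lemma wint_dist M eps f g : bounded_by M f -> bounded_by M g ->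
  (forall x, k x != 0 -> `|f x - g x| <= eps) -> 0 <= eps ->
  `|wint k f - wint k g| <= eps * mass k.
Proof.
move=> bf bg fg eps0; have M0 := bounded_by_ge0 point bf.
have be : bounded_by (M + eps) (fun _ : T => eps) by split=> // x; rewrite eps0 lerDr.
have MW : M <= M + eps by rewrite lerDl.
have bS (h : T -> R) : bounded_by M h -> bounded_by (M + eps) (fun x => h x + eps).
  move=> [mh h0]; split; first exact: measurable_funD.
  by move=> x; case/andP: (h0 x) => hx0 hxM; rewrite addr_ge0//= lerD2r.
have half (h h' : T -> R) : bounded_by M h -> bounded_by M h' ->
    (forall x, k x != 0 -> h x <= h' x + eps) -> wint k h <= wint k h' + eps * mass k.
  move=> bh bh' hh'; rewrite -wint_cst// -(wintD (bounded_byW MW bh') be).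
  by apply: (@wint_le (M + eps)) hh'; [exact: bounded_byW bh|exact: bS].
rewrite ler_distl; apply/andP; split.
  rewrite lerBlDr; apply: half => // x /fg; rewrite ler_distlC => /andP[_].
  by [].
by apply: half => // x /fg; rewrite ler_distlC => /andP[+ _]; rewrite lerBlDr.
Qed.

Lemma wint_bound M f : bounded_by M f -> wint k f <= M * mass k.
Proof.
move=> bf; have M0 := bounded_by_ge0 point bf.
rewrite -wint_cst//; apply: (wint_le bf) => [|x _].
  by split=> // x; rewrite M0 lexx.
by case: bf => _ /(_ x)/andP[].
Qed.

Lemma wintZ M c f : 0 <= c -> bounded_by M f -> wint k (fun x => c * f x) = c * wint k f.
Proof.
move=> c0 bf; rewrite /wint -RintegralZl//; last exact: wint_integrable bf.
by apply: eq_Rintegral => x _; rewrite mulrCA.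
Qed.

End fixed_weight.
End weighted_integral.

Section wint_fubini.
Context d1 d2 (T1 : measurableType d1) (T2 : measurableType d2) (R : realType).
Variables (m1 : {sigma_finite_measure set T1 -> \bar R}).
Variables (m2 : {sigma_finite_measure set T2 -> \bar R}).
Variables (k1 : T1 -> R) (k2 : T2 -> R) (w1 : weight m1 k1) (w2 : weight m2 k2).
Variables (M : R) (f : T1 * T2 -> R).
Hypothesis bf : bounded_by M f.

Lemma bounded_by_pair1 x : bounded_by M (fun y => f (x, y)).
Proof.
case: bf => mf f0; split=> [|y]; last exact: f0.
exact: measurableT_comp mf (pair1_measurable x).
Qed.

Lemma bounded_by_pair2 y : bounded_by M (fun x => f (x, y)).
Proof.
case: bf => mf f0; split=> [|x]; last exact: f0.
exact: measurableT_comp mf (pair2_measurable y).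
Qed.

Lemma wint_bounded1 : bounded_by (M * mass m2 k2) (fun x => wint m2 k2 (fun y => f (x, y))).
Proof.
split=> [|x]; last first.
  rewrite (wint_ge0 w2 (bounded_by_pair1 x)).
  exact: (wint_bound w2 (bounded_by_pair1 x)).
apply/measurable_EFinP; rewrite (_ : _ \o _ =
  fubini_F m2 (fun xy : T1 * T2 => (k2 xy.2 * f xy)%:E)); last first.
  by apply/funext => x; rewrite /= (wintE w2 (bounded_by_pair1 x)).
have [mk2 k20 _] := w2; have [mf f0] := bf.
apply: measurable_fun_fubini_tonelli_F => /=.
  by apply/measurable_EFinP; apply: measurable_funM => //; exact: measurableT_comp mk2 _.
by move=> [x y] /=; rewrite lee_fin mulr_ge0//; case/andP: (f0 (x, y)).
Qed.

Lemma wint_bounded2 : bounded_by (M * mass m1 k1) (fun y => wint m1 k1 (fun x => f (x, y))).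
Proof.
split=> [|y]; last first.
  rewrite (wint_ge0 w1 (bounded_by_pair2 y)).
  exact: (wint_bound w1 (bounded_by_pair2 y)).
apply/measurable_EFinP; rewrite (_ : _ \o _ =
  fubini_G m1 (fun xy : T1 * T2 => (k1 xy.1 * f xy)%:E)); last first.
  by apply/funext => y; rewrite /= (wintE w1 (bounded_by_pair2 y)).
have [mk1 k10 _] := w1; have [mf f0] := bf.
apply: measurable_fun_fubini_tonelli_G => /=.
  by apply/measurable_EFinP; apply: measurable_funM => //; exact: measurableT_comp mk1 _.
by move=> [x y] /=; rewrite lee_fin mulr_ge0//; case/andP: (f0 (x, y)).
Qed.

Lemma wint_fubini : wint m1 k1 (fun x => wint m2 k2 (fun y => f (x, y))) =
  wint m2 k2 (fun y => wint m1 k1 (fun x => f (x, y))).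
Proof.
have [mk1 k10 _] := w1; have [mk2 k20 _] := w2; have [mf f0] := bf.
have f0' z : 0 <= f z by case/andP: (f0 z).
apply: EFin_inj; rewrite (wintE w1 wint_bounded1) (wintE w2 wint_bounded2).
pose g (z : T1 * T2) := (k1 z.1 * (k2 z.2 * f z))%:E.
have mg : measurable_fun setT g.
  apply/measurable_EFinP; apply: measurable_funM; first exact: measurableT_comp mk1 _.
  by apply: measurable_funM => //; exact: measurableT_comp mk2 _.
have g0 z : (0 <= g z)%E by rewrite lee_fin !mulr_ge0.
transitivity (\int[m1]_x \int[m2]_y g (x, y))%E.
  apply: eq_integral => x _; rewrite EFinM (wintE w2 (bounded_by_pair1 x)).
  rewrite -ge0_integralZl//.
  - by apply/measurable_EFinP; apply: measurable_funM => //; case: (bounded_by_pair1 x).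
  - by move=> y _; rewrite lee_fin mulr_ge0.
  - by rewrite lee_fin.
transitivity (\int[m2]_y \int[m1]_x g (x, y))%E; first exact: (fubini_tonelli g).
apply: eq_integral => y _.
rewrite EFinM (wintE w1 (bounded_by_pair2 y)) -ge0_integralZl//.
- by apply: eq_integral => x _; rewrite /g/= -EFinM mulrCA.
- by apply/measurable_EFinP; apply: measurable_funM => //; case: (bounded_by_pair2 y).
- by move=> x _; rewrite lee_fin mulr_ge0.
- by rewrite lee_fin.
Qed.

End wint_fubini.

Section lebesgue_substitution.
Context (R : realType).
Local Notation mu := (@lebesgue_measure R).

Lemma measurable_shift (a : R) : measurable_fun [set: R] (fun x : R => x + a).
Proof. by apply: measurable_funD. Qed.

Lemma lebesgue_measure_shift (a : R) (A : set R) : measurable A ->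
  pushforward mu ((fun x => x + a) : _ -> measurableTypeR R) A = mu A.
Proof.
move=> mA; apply/esym/lebesgue_measure_unique => //=.
  exact: measurable_shift.
move=> mf _ [[x y]] _ <-; rewrite /pushforward.
have -> : (fun z : R => z + a) @^-1` [set` Interval (BRight x) (BRight y)] =
    `]x - a, y - a]%classic.
  by apply/seteqP; split=> z /=; rewrite !in_itv/= ltrBlDr lerBrDr.
rewrite !lebesgue_measure_itv/= !lte_fin ltrD2r; case: ifP => // _.
by rewrite -!EFinB; congr EFin; ring.
Qed.

Lemma ge0_integral_shift (a : R) (f : R -> \bar R) : measurable_fun setT f ->
  (forall x, 0 <= f x)%E -> (\int[mu]_x f ((x : R) + a)%R = \int[mu]_x f x)%E.
Proof.
move=> mf f0.
transitivity (\int[pushforward mu ((fun x => x + a)%R : R -> measurableTypeR R)]_x f x)%E.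
  by rewrite ge0_integral_pushforward//; exact: measurable_shift.
by apply: eq_measure_integral => [|mf1 A mA _]; [exact: measurable_shift|exact: lebesgue_measure_shift].
Qed.

Lemma ge0_integral_opp (f : R -> \bar R) : measurable_fun setT f ->
  (forall x, 0 <= f x)%E -> (\int[mu]_x f (- (x : R))%R = \int[mu]_x f x)%E.
Proof.
move=> mf f0.
transitivity (\int[pushforward mu ((-%R) : R -> measurableTypeR R)]_x f x)%E.
  by rewrite ge0_integral_pushforward.
by apply: eq_measure_integral => A mA _; exact: lebesgue_measureN.
Qed.

End lebesgue_substitution.

(** * The exponential weight on the half-line and its translations *)

Section laplace_weight.
Context (R : realType).
Local Notation mu := (@lebesgue_measure R).
Implicit Types (s delta M : R) (f g : R -> R).

(* Extending the weight by 0 turns half-line integrals into integrals over R,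
   to which translations apply. *)
Definition lapk s (x : R) : R := if 0 <= x then expR (- s * x) else 0.
Definition lapk_lt s delta (x : R) : R := if x < delta then lapk s x else 0.
Definition lapk_ge s delta (x : R) : R := if x < delta then 0 else lapk s x.

Lemma lapk_ge0 s x : 0 <= lapk s x.
Proof. by rewrite /lapk; case: ifP => // _; exact: expR_ge0. Qed.

Lemma lapk_neq0 s x : lapk s x != 0 -> 0 <= x.
Proof. by rewrite /lapk; case: ifPn => //; rewrite eqxx. Qed.

Lemma measurable_lapk s : measurable_fun [set: R] (lapk s).
Proof.
apply: measurable_fun_ifT => //.
  by apply: measurable_fun_ler.
by apply: measurableT_comp; [exact: measurable_expR|exact: measurable_funM].
Qed.

Lemma integral_lapk s : 0 < s -> (\int[mu]_x (lapk s x)%:E = (s^-1)%:E)%E.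
Proof.
move=> s0; have := integral_exponential_pdf s0.
under eq_integral => x _.
  rewrite (_ : exponential_pdf s x = s * lapk s x); last first.
    rewrite /exponential_pdf patchE /lapk mem_setE in_itv/= andbT.
    by case: ifP => _; rewrite ?mulr0.
  rewrite EFinM; over.
rewrite ge0_integralZl//; first last.
- by rewrite lee_fin ltW.
- by move=> x _; rewrite lee_fin lapk_ge0.
- by apply/measurable_EFinP; exact: measurable_lapk.
move=> H; have : ((s^-1)%:E * (s%:E * \int[mu]_x (lapk s x)%:E) = (s^-1)%:E)%E.
  by rewrite H mule1.
by rewrite muleA -EFinM mulVf ?gt_eqF// mul1e.
Qed.

Lemma weight_lapk s : 0 < s -> weight mu (lapk s).
Proof.
move=> s0; split; [exact: measurable_lapk|exact: lapk_ge0|].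
by rewrite integral_lapk// ltry.
Qed.

Lemma mass_lapk s : 0 < s -> mass mu (lapk s) = s^-1.
Proof. by move=> s0; rewrite /mass /Rintegral integral_lapk. Qed.

Lemma laplaceE f s : laplace f s = wint mu (lapk s) f.
Proof.
rewrite /laplace /wint Rintegral_mkcond; apply: eq_Rintegral => x _.
rewrite patchE mem_setE in_itv/= andbT /lapk.
by case: ifP; rewrite ?mul0r.
Qed.

Lemma weight_dominated (k k' : R -> R) : measurable_fun setT k ->
  (forall x, 0 <= k x <= k' x) -> weight mu k' -> weight mu k.
Proof.
move=> mk kk' [mk' k'0 k'fin]; split=> // [x|]; first by case/andP: (kk' x).
apply: le_lt_trans k'fin; apply: ge0_le_integral => //.
- by move=> x _; rewrite lee_fin; case/andP: (kk' x).
- exact/measurable_EFinP.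
- exact/measurable_EFinP.
- by move=> x _; rewrite lee_fin; case/andP: (kk' x).
Qed.

Lemma weight_lapk_lt s delta : 0 < s -> weight mu (lapk_lt s delta).
Proof.
move=> s0; apply: (weight_dominated _ _ (weight_lapk s0)).
  apply: measurable_fun_ifT => //; first exact: measurable_fun_ltr.
  exact: measurable_lapk.
by move=> x; rewrite /lapk_lt; case: ifP => _; rewrite ?lexx lapk_ge0.
Qed.

Lemma weight_lapk_ge s delta : 0 < s -> weight mu (lapk_ge s delta).
Proof.
move=> s0; apply: (weight_dominated _ _ (weight_lapk s0)).
  apply: measurable_fun_ifT => //; first exact: measurable_fun_ltr.
  exact: measurable_lapk.
by move=> x; rewrite /lapk_ge; case: ifP => _; rewrite ?lexx lapk_ge0.
Qed.

Lemma wint_lapk_split s delta M f : 0 < s -> bounded_by M f ->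
  wint mu (lapk s) f = wint mu (lapk_lt s delta) f + wint mu (lapk_ge s delta) f.
Proof.
move=> s0 bf; rewrite /wint -RintegralD//.
- apply: eq_Rintegral => x _; rewrite /lapk_lt /lapk_ge.
  by case: ifP => _; rewrite mul0r ?addr0 ?add0r.
- exact: (wint_integrable (weight_lapk_lt delta s0) bf).
- exact: (wint_integrable (weight_lapk_ge delta s0) bf).
Qed.

Lemma bounded_by_shift M f delta : bounded_by M f -> bounded_by M (fun x : R => f (x + delta)).
Proof.
by move=> [mf f0]; split=> // ; exact: measurableT_comp mf (measurable_shift delta).
Qed.

Lemma wint_lapk_shift s delta M f : 0 < s -> 0 <= delta -> bounded_by M f ->
  wint mu (lapk s) (fun x : R => f (x + delta)) = expR (s * delta) * wint mu (lapk_ge s delta) f.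
Proof.
move=> s0 delta0 bf; have [mf f0] := bf; apply: EFin_inj.
rewrite (wintE (weight_lapk s0) (bounded_by_shift delta bf)) EFinM.
rewrite (wintE (weight_lapk_ge delta s0) bf) -ge0_integralZl//; first last.
- move=> x _; rewrite lee_fin mulr_ge0//; last by case/andP: (f0 x).
  by case: (weight_lapk_ge delta s0).
- apply/measurable_EFinP; apply: measurable_funM => //.
  by case: (weight_lapk_ge delta s0).
pose G (y : R) := (lapk s (y - delta) * f y)%:E.
transitivity (\int[mu]_x G ((x : R) + delta)%R)%E.
  by apply: eq_integral => x _; rewrite /G addrK.
rewrite ge0_integral_shift//; first last.
- move=> x; rewrite lee_fin mulr_ge0 ?lapk_ge0//; by case/andP: (f0 x).
- apply/measurable_EFinP; apply: measurable_funM => //.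
  exact: measurableT_comp (measurable_lapk s) (measurable_shift (- delta)).
apply: eq_integral => x _; rewrite /G -EFinM mulrA; congr (_ * _)%:E.
rewrite /lapk_ge /lapk subr_ge0; case: ltP => [|xd]; first by rewrite mulr0.
rewrite (le_trans delta0 xd) -expRD; congr expR; ring.
Qed.

Lemma mass_lapk_lt s delta : 0 < s -> 0 <= delta ->
  delta - s * delta ^+ 2 <= mass mu (lapk_lt s delta) <= delta.
Proof.
move=> s0 delta0; have w := weight_lapk_lt delta s0.
pose k (x : R) : R := if (0 <= x) && (x < delta) then 1 else 0.
have mk : measurable_fun setT k.
  by apply: measurable_fun_ifT => //; apply: measurable_and;
    [exact: measurable_fun_ler|exact: measurable_fun_ltr].
have intk : (\int[mu]_x (k x)%:E = delta%:E)%E.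
  transitivity (\int[mu]_x (\1_(`[0%R, delta[%classic : set R) (x : R))%:E)%E.
    by apply: eq_integral => x _; rewrite /k indicE mem_setE in_itv/=; case: ifP.
  rewrite integral_indic//= setIT lebesgue_measure_itv/= lte_fin.
  case: ltP => [_|d0]; first by rewrite oppr0 adde0.
  by congr EFin; apply/eqP; rewrite eq_le delta0 d0.
have wk : weight mu k.
  by split=> // [x|]; [rewrite /k; case: ifP|rewrite intk ltry].
have massk : mass mu k = delta by apply: EFin_inj; rewrite massE.
have [mw w0 _] := w.
(* The absolute value keeps the function below 1 on the whole line, as [bounded_by] demands; on the
   support of [k] it changes nothing. *)
have bw : bounded_by 1 (fun x : R => expR (- s * `|x|)).
  split=> [|x].
    apply: measurableT_comp; first exact: measurable_expR.
    by apply: measurable_funM => //; exact: measurableT_comp.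
  by rewrite expR_ge0 -[leRHS]expR0 ler_expR mulNr oppr_le0 mulr_ge0// ltW.
have wE : mass mu (lapk_lt s delta) = wint mu k (fun x : R => expR (- s * `|x|)).
  apply: eq_Rintegral => x _; rewrite /lapk_lt /k /lapk.
  case: ltP => xd; last by rewrite andbF mul0r.
  by rewrite andbT; case: ifP => x0; rewrite ?mul0r// mul1r ger0_norm.
rewrite wE; apply/andP; split; last first.
  by apply: (le_trans (wint_bound wk bw)); rewrite massk mul1r.
(* Beyond this threshold the lower bound delta (1 - s delta) is negative; below it, the exponential
   is at least 1 - s delta on the interval. *)
have [sd|sd] := leP (s * delta) 1; last first.
  apply: le_trans (wint_ge0 wk bw); rewrite expr2 mulrA -{1}(mul1r delta) -mulrBl.
  by rewrite mulr_le0_ge0// subr_le0 ltW.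
have bc : bounded_by 1 (fun _ : R => 1 - s * delta).
  by split=> // x; rewrite subr_ge0 sd lerBlDr lerDl mulr_ge0// ltW.
have := wint_le wk bc bw; rewrite wint_cst ?subr_ge0// massk mulrBl mul1r -mulrA -expr2.
apply=> x; rewrite /k; case: ifP => [/andP[x0 xd] _|_]; last by rewrite eqxx.
rewrite ger0_norm//; apply: le_trans (expR_ge1Dx _).
by rewrite mulNr lerD2l lerN2 ler_wpM2l// ltW.
Qed.

(** Translating by [delta] adds the layer [0, delta[ and removes the fraction 1 - exp(- s delta) of
    an integral at most M / s. Both effects lie between 0 and M delta and have opposite signs, so a
    single M delta bounds them together. *)
Lemma wint_lapk_close s M eps delta f g : 0 < s -> 0 <= delta -> 0 <= eps ->
  bounded_by M f -> bounded_by M g ->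
  (forall x, 0 <= x -> `|f (x + delta) - g x| <= eps) ->
  `|wint mu (lapk s) f - wint mu (lapk s) g| <= M * delta + eps / s.
Proof.
move=> s0 d0 e0 bf bg fg; have M0 := bounded_by_ge0 point bf.
have wl := weight_lapk_lt delta s0; have wg := weight_lapk_ge delta s0.
have wk := weight_lapk s0; have bfd := bounded_by_shift delta bf.
rewrite (wint_lapk_split delta s0 bf).
have shiftE : wint mu (lapk_ge s delta) f =
    expR (- (s * delta)) * wint mu (lapk s) (fun x : R => f (x + delta)).
  by rewrite (wint_lapk_shift s0 d0 bf) mulrA -expRD addNr expR0 mul1r.
have := wint_dist wk bfd bg (fun x kx => fg x (lapk_neq0 kx)) e0.
rewrite mass_lapk// shiftE => close.
have A0 := wint_ge0 wl bf.
have AM : wint mu (lapk_lt s delta) f <= M * delta.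
  apply: (le_trans (wint_bound wl bf)); rewrite ler_wpM2l//.
  by case/andP: (mass_lapk_lt s0 d0).
have B0 := wint_ge0 wk bfd.
have BM := wint_bound wk bfd; rewrite mass_lapk// in BM.
have e1 : expR (- (s * delta)) <= 1.
  by rewrite -expR0 ler_expR oppr_le0 mulr_ge0// ltW.
have e2 : 1 - s * delta <= expR (- (s * delta)) by have := expR_ge1Dx (- (s * delta)).
have C0 : 0 <= (1 - expR (- (s * delta))) * wint mu (lapk s) (fun x : R => f (x + delta)).
  by rewrite mulr_ge0// subr_ge0.
have CM : (1 - expR (- (s * delta))) * wint mu (lapk s) (fun x : R => f (x + delta)) <= M * delta.
  apply: (@le_trans _ _ (s * delta * (M / s))).
    apply: ler_pM => //; first by rewrite subr_ge0.
    by rewrite lerBlDr -lerBlDl.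
  by rewrite [leLHS](_ : _ = M * delta)//; field; rewrite gt_eqF.
move: close; rewrite !ler_norml => /andP[cl cu]; apply/andP; split; lra.
Qed.

End laplace_weight.

(** * Orders of magnitude in a small time h *)

Section small_order.
Context (R : realType) (h0 : R) (h0_gt0 : 0 < h0) (h0_le1 : h0 <= 1).
Implicit Types (f g : R -> R).

Definition bigo n f := exists2 C, 0 <= C &
  forall h, 0 < h -> h <= h0 -> `|f h| <= C * h ^+ n.

Lemma bigoD n f g : bigo n f -> bigo n g -> bigo n (fun h => f h + g h).
Proof.
move=> [C C0 fC] [D D0 gD]; exists (C + D) => [|h h1 h2]; first exact: addr_ge0.
by rewrite mulrDl (le_trans (ler_normD _ _))// lerD// ?fC// gD.
Qed.

Lemma bigoN n f : bigo n f -> bigo n (fun h => - f h).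
Proof. by move=> [C C0 fC]; exists C => // h h1 h2; rewrite normrN fC. Qed.

Lemma bigoM n m f g : bigo n f -> bigo m g -> bigo (n + m) (fun h => f h * g h).
Proof.
move=> [C C0 fC] [D D0 gD]; exists (C * D) => [|h h1 h2]; first exact: mulr_ge0.
by rewrite normrM exprD mulrACA ler_pM// ?fC// gD.
Qed.

Lemma bigo_cst c : bigo 0 (fun=> c).
Proof. by exists `|c| => // h _ _; rewrite expr0 mulr1. Qed.

Lemma bigo_id : bigo 1 id.
Proof. by exists 1 => // h h1 _; rewrite expr1 mul1r gtr0_norm. Qed.

Lemma bigoW n m f : (m <= n)%N -> bigo n f -> bigo m f.
Proof.
move=> mn [C C0 fC]; exists C => // h h1 h2; apply: le_trans (fC _ h1 h2) _.
by rewrite ler_wpM2l// ler_wiXn2l// ?(le_trans h2)// (ltW h1).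
Qed.

Lemma bigo2_linear_eq0 x : bigo 2 (fun h => h * x) -> x = 0.
Proof.
move=> [C C0 xC]; apply/eqP; rewrite -normr_eq0; apply/eqP/le_anti.
rewrite normr_ge0 andbT; apply/ler_addgt0Pr => eps eps0; rewrite add0r.
have C1 : 0 < C + 1 by rewrite ltr_wpDl.
pose h := Num.min h0 (eps / (C + 1)).
have h_gt0 : 0 < h by rewrite lt_min h0_gt0 divr_gt0.
have := xC h h_gt0; rewrite ge_min lexx => /(_ isT).
rewrite normrM gtr0_norm// expr2 mulrCA ler_pM2l// => /le_trans; apply.
apply: (@le_trans _ _ ((C + 1) * h)); first by rewrite ler_wpM2r ?(ltW h_gt0)// lerDl.
by rewrite mulrC -ler_pdivlMr// ge_min lexx orbT.
Qed.

End small_order.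

(** The upper bound comes from exp(- x) >= 1 - x, inverted, and from (1 - x)(1 + x + 2 x^2) = 1 +
    x^2 (1 - 2 x). *)
Lemma expR_taylor2 (R : realType) (x : R) : x <= 2^-1 ->
  0 <= expR x - 1 - x <= 2 * x ^+ 2.
Proof.
move=> x2; have x1 : 0 < 1 - x by rewrite subr_gt0 (le_lt_trans x2)// invf_lt1// ltr1n.
have := expR_ge1Dx x; rewrite -lerBrDl => e1; rewrite subr_ge0 e1/=.
have := expR_ge1Dx (- x); rewrite expRN => e2.
have e3 : expR x <= (1 - x)^-1.
  by rewrite -[leLHS]invrK lef_pV2// ?posrE ?invr_gt0 ?expR_gt0.
have e4 : (1 - x)^-1 <= 1 + x + 2 * x ^+ 2.
  rewrite -div1r ler_pdivrMr//.
  have : 0 <= x ^+ 2 * (1 - 2 * x).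
    rewrite mulr_ge0 ?sqr_ge0// subr_ge0 mulrC -ler_pdivlMr// div1r//.
  by rewrite !expr2 => H; nra.
by rewrite lerBlDr lerBlDr (le_trans e3)// (le_trans e4)//; lra.
Qed.

Section double_laplace.
Context (R : realType) (s1 s2 : R).
Hypotheses (s1_gt0 : 0 < s1) (s2_gt0 : 0 < s2).
Local Notation mu := (@lebesgue_measure R).
Local Notation k1 := (lapk s1).
Local Notation k2 := (lapk s2).
Implicit Types (f g : R * R -> R) (M : R).

Definition double_laplace f : R := wint mu k2 (fun v => wint mu k1 (fun u => f (u, v))).

Local Notation lap2 := double_laplace.

Let w1 : weight mu k1. Proof. exact: weight_lapk. Qed.
Let w2 : weight mu k2. Proof. exact: weight_lapk. Qed.

Lemma bounded_fst M f v : bounded_by M f -> bounded_by M (fun u => f (u, v)).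
Proof. by move=> bf; exact: bounded_by_pair2 bf v. Qed.

Lemma bounded_snd M f u : bounded_by M f -> bounded_by M (fun v => f (u, v)).
Proof. by move=> bf; exact: bounded_by_pair1 bf u. Qed.

Lemma bounded_wint1 M f (k : R -> R) : weight mu k -> bounded_by M f ->
  bounded_by (M * mass mu k) (fun v : R => wint mu k (fun u => f (u, v))).
Proof. by move=> wk bf; exact: (wint_bounded2 (m1 := mu) wk bf). Qed.

Lemma bounded_wint2 M f (k : R -> R) : weight mu k -> bounded_by M f ->
  bounded_by (M * mass mu k) (fun u : R => wint mu k (fun v => f (u, v))).
Proof. by move=> wk bf; exact: (wint_bounded1 (m2 := mu) wk bf). Qed.

Lemma wint_swap M f (k k' : R -> R) : weight mu k -> weight mu k' -> bounded_by M f ->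
  wint mu k' (fun v => wint mu k (fun u => f (u, v))) =
  wint mu k (fun u => wint mu k' (fun v => f (u, v))).
Proof. by move=> wk wk' bf; rewrite -(wint_fubini (m1 := mu) (m2 := mu) wk wk' bf). Qed.

Lemma lap2_eq f g : (forall z, quadrant z -> f z = g z) -> lap2 f = lap2 g.
Proof.
move=> fg; apply: wint_eq => v /lapk_neq0 v0; apply: wint_eq => u /lapk_neq0 u0.
exact: fg.
Qed.

Lemma lap2_dist M eps f g : bounded_by M f -> bounded_by M g -> 0 <= eps ->
  (forall z, quadrant z -> `|f z - g z| <= eps) -> `|lap2 f - lap2 g| <= eps / (s1 * s2).
Proof.
move=> bf bg e0 fg; have -> : eps / (s1 * s2) = eps * mass mu k1 * mass mu k2.
  by rewrite !mass_lapk// invfM mulrA.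
apply: (wint_dist w2 (bounded_wint1 w1 bf) (bounded_wint1 w1 bg)); last first.
  by rewrite mulr_ge0// mass_ge0.
move=> v /lapk_neq0 v0; apply: (wint_dist w1 (bounded_fst v bf) (bounded_fst v bg)) => //.
by move=> u /lapk_neq0 u0; exact: fg.
Qed.

Lemma bounded_shift M f (a b : R) : bounded_by M f ->
  bounded_by M (fun z : R * R => f (z + (a, b))).
Proof.
move=> [mf f0]; split=> //; apply: (measurableT_comp mf).
by apply/measurable_fun_pairP; split; apply: measurable_funD.
Qed.

Lemma lap2_shift_close M f a b : 0 <= a -> 0 <= b -> bounded_by M f ->
  `|lap2 f - lap2 (fun z => f (z + (a, b)))| <= M * (b / s1 + a / s2).
Proof.
move=> a0 b0 bf; have M0 := bounded_by_ge0 point bf.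
have bfs := bounded_shift a b bf.
have := wint_lapk_close s2_gt0 b0 (mulr_ge0 M0 a0)
  (bounded_wint1 w1 bf) (bounded_wint1 w1 bfs).
rewrite mass_lapk// (_ : M / s1 * b + M * a / s2 = M * (b / s1 + a / s2)); last by field; rewrite !gt_eqF.
apply=> v v0.
have := @wint_lapk_close _ s1 M 0 a (fun u => f (u, v + b)) (fun u => f ((u, v) + (a, b))).
rewrite mul0r addr0; apply => //; [exact: bounded_fst|exact: (bounded_fst v bfs)|].
by move=> u u0; rewrite subrr normr0.
Qed.

End double_laplace.

(** Two overlapping strips: X is the first, Z the second in full, o their common corner and Y the
    second without the corner. Counting the corner once costs at most its size. *)
Lemma ler_distD_overlap (R : realDomainType) (X Y Z o t u e e' eo : R) :
  `|X - t| <= e -> `|Z - u| <= e' -> Z = o + Y -> 0 <= o -> o <= eo ->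
  `|X + Y - (t + u)| <= e + e' + eo.
Proof.
by rewrite !ler_norml => /andP[? ?] /andP[? ?] ? ? ?; apply/andP; split; lra.
Qed.

(** * The boundary terms and the limit h -> 0 *)

Section kernel_limit.
Context (R : realType) (s1 s2 c1 c2 Lam : R).
Hypotheses (s1_gt0 : 0 < s1) (s2_gt0 : 0 < s2) (c1_gt0 : 0 < c1) (c2_gt0 : 0 < c2).
Hypothesis Lam_ge0 : 0 <= Lam.
Local Notation mu := (@lebesgue_measure R).
Local Notation k1 := (lapk s1).
Local Notation k2 := (lapk s2).
Local Notation lap2 := (double_laplace s1 s2).
Variable q : R * R -> R.
Hypothesis bq : bounded_by 1 q.
Hypothesis q_lip : forall z t, quadrant z -> 0 <= t ->
  `|q (z + drift c1 c2 t) - q z| <= Lam * t.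

Let w1 : weight mu k1. Proof. exact: weight_lapk. Qed.
Let w2 : weight mu k2. Proof. exact: weight_lapk. Qed.

Local Notation F1 := (wint mu k1 (fun u => q (u, 0))).
Local Notation F2 := (wint mu k2 (fun v => q (0, v))).
Local Notation D1 v := (wint mu k1 (fun u => q (u, v))).
Local Notation D2 u := (wint mu k2 (fun v => q (u, v))).

(** The drift carries (0, v) to (u, v + c2 u / c1) in time u / c1. The Lipschitz bound compares the
    values at these two points, and the displacement in v is a translation under the Laplace
    integral. *)
Lemma D2_close u : 0 <= u -> `|D2 u - F2| <= (c2 / c1 + Lam / (c1 * s2)) * u.
Proof.
move=> u0; have t0 : 0 <= u / c1 by rewrite divr_ge0// ltW.
have := wint_lapk_close s2_gt0 (mulr_ge0 (ltW c2_gt0) t0) (mulr_ge0 Lam_ge0 t0)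
  (bounded_snd u bq) (bounded_snd 0 bq).
rewrite (_ : 1 * (c2 * (u / c1)) + Lam * (u / c1) / s2 = (c2 / c1 + Lam / (c1 * s2)) * u).
  apply=> v v0; have := q_lip (_ : quadrant (0, v)) t0; rewrite /drift.
  rewrite (_ : (0, v) + _ = (u, v + c2 * (u / c1))); first by apply.
  by congr pair; rewrite /= add0r mulrCA divff ?mulr1// gt_eqF.
by field; rewrite !gt_eqF.
Qed.

Lemma D1_close v : 0 <= v -> `|D1 v - F1| <= (c1 / c2 + Lam / (c2 * s1)) * v.
Proof.
move=> v0; have t0 : 0 <= v / c2 by rewrite divr_ge0// ltW.
have := wint_lapk_close s1_gt0 (mulr_ge0 (ltW c1_gt0) t0) (mulr_ge0 Lam_ge0 t0)
  (bounded_fst v bq) (bounded_fst 0 bq).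
rewrite (_ : 1 * (c1 * (v / c2)) + Lam * (v / c2) / s1 = (c1 / c2 + Lam / (c2 * s1)) * v).
  apply=> u u0; have := q_lip (_ : quadrant (u, 0)) t0; rewrite /drift.
  rewrite (_ : (u, 0) + _ = (u + c1 * (v / c2), v)); first by apply.
  by congr pair; rewrite /= add0r mulrCA divff ?mulr1// gt_eqF.
by field; rewrite !gt_eqF.
Qed.

(* The mass of the boundary layer left uncovered by the translated quadrant. *)
Definition layer h : R :=
  wint mu (lapk_lt s2 (c2 * h)) (fun v => D1 v)
  + wint mu (lapk_ge s2 (c2 * h)) (fun v => wint mu (lapk_lt s1 (c1 * h)) (fun u => q (u, v))).

(** Exact, without error term: two one-dimensional translations give the exponential factor and
    truncate the kernels. The expansion in [h] is left to [layer_expansion] and [kernel_limit]. *)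
Lemma lap2_drift h : 0 <= h ->
  lap2 (fun z => q (z + drift c1 c2 h)) =
  expR ((c1 * s1 + c2 * s2) * h) * (lap2 q - layer h).
Proof.
move=> h0; have ch1 : 0 <= c1 * h by rewrite mulr_ge0// ltW.
have ch2 : 0 <= c2 * h by rewrite mulr_ge0// ltW.
have wg1 := weight_lapk_ge (c1 * h) s1_gt0; have wl1 := weight_lapk_lt (c1 * h) s1_gt0.
have wg2 := weight_lapk_ge (c2 * h) s2_gt0; have wl2 := weight_lapk_lt (c2 * h) s2_gt0.
have bG := bounded_wint1 wg1 bq.
transitivity (expR (s1 * (c1 * h)) * wint mu k2 (fun v =>
    wint mu (lapk_ge s1 (c1 * h)) (fun u => q (u, v + c2 * h)))).
  rewrite -(wintZ w2 (expR_ge0 _) (bounded_by_shift (c2 * h) bG)).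
  apply: eq_Rintegral => v _; congr (_ * _).
  by rewrite -(wint_lapk_shift s1_gt0 ch1 (bounded_fst (v + c2 * h) bq)).
rewrite (wint_lapk_shift s2_gt0 ch2 bG) mulrA -expRD; congr (expR _ * _); first ring.
rewrite /layer /double_laplace (wint_lapk_split (c2 * h) s2_gt0 (bounded_wint1 w1 bq)).
rewrite opprD addrACA subrr add0r; apply/eqP; rewrite eq_sym subr_eq; apply/eqP.
(* [wintD] wants a common bound for the two summands; this sum dominates the mass of each truncated
   kernel. *)
rewrite addrC -(@wintD _ _ _ _ _ wg2 (mass mu k1 + (mass mu (lapk_lt s1 (c1 * h)) + mass mu (lapk_ge s1 (c1 * h))))).
- apply: eq_Rintegral => v _; congr (_ * _).
  exact: (wint_lapk_split (c1 * h) s1_gt0 (bounded_fst v bq)).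
- apply: bounded_byW (bounded_wint1 wl1 bq).
  by rewrite mul1r addrCA lerDl addr_ge0 ?mass_ge0.
- apply: bounded_byW bG.
  by rewrite mul1r addrA lerDr addr_ge0 ?mass_ge0.
Qed.

(** Two errors over a strip of width c delta: [K] measures replacing D by its boundary value, and s
    M replacing the mass of the strip by its width. *)
Lemma strip_close (s c delta K M D0 : R) (D : R -> R) : 0 < s -> 0 < c -> 0 <= K ->
  bounded_by M D -> 0 <= D0 <= M ->
  (forall u, 0 <= u -> `|D u - D0| <= K * u) -> 0 <= delta ->
  `|wint mu (lapk_lt s (c * delta)) D - delta * (c * D0)|
    <= (K + s * M) * c ^+ 2 * delta ^+ 2.
Proof.
move=> s0 c0 K0 bD /andP[D00 D0M] DK d0.
have cd0 : 0 <= c * delta by rewrite mulr_ge0// ltW.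
have wl := weight_lapk_lt (c * delta) s0.
have bD0 : bounded_by M (fun _ : R => D0) by split=> // x; rewrite D00.
have /andP[ml mu'] := mass_lapk_lt s0 cd0.
have := wint_dist wl bD bD0 (eps := K * (c * delta)) _ (mulr_ge0 K0 cd0).
rewrite (wint_cst wl D00) => /(_ _)/wrap[].
  move=> x; rewrite /lapk_lt; case: ltP => [xd kx|_]; last by rewrite eqxx.
  have x0 := lapk_neq0 kx; apply: (le_trans (DK _ x0)).
  by rewrite ler_wpM2l// ltW.
move=> close.
have close' : `|wint mu (lapk_lt s (c * delta)) D - D0 * mass mu (lapk_lt s (c * delta))|
    <= K * (c * delta) ^+ 2.
  apply: (le_trans close).
  by rewrite expr2 [leRHS]mulrA ler_wpM2l// mulr_ge0.
have massc : `|D0 * mass mu (lapk_lt s (c * delta)) - delta * (c * D0)| <= s * M * (c * delta) ^+ 2.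
  rewrite (_ : delta * (c * D0) = D0 * (c * delta)); last ring.
  rewrite -mulrBr normrM (ger0_norm D00) [s * M]mulrC -mulrA ler_pM//.
  by rewrite ler_norml; apply/andP; split; lra.
rewrite -(subrKA (D0 * mass mu (lapk_lt s (c * delta)))).
apply: (le_trans (ler_normD _ _)); rewrite -mulrA -exprMn mulrDl.
exact: lerD.
Qed.

Lemma layer_expansion : exists2 C, 0 <= C & forall h, 0 <= h ->
  `|layer h - h * (c2 * F1 + c1 * F2)| <= C * h ^+ 2.
Proof.
have bD1 := bounded_wint1 w1 bq; have bD2 := bounded_wint2 w2 bq.
have F1M : 0 <= F1 <= 1 * mass mu k1 by case: bD1.
have F2M : 0 <= F2 <= 1 * mass mu k2 by case: bD2.
have K1 : 0 <= c1 / c2 + Lam / (c2 * s1).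
  by rewrite addr_ge0 ?divr_ge0 ?mulr_ge0// ltW.
have K2 : 0 <= c2 / c1 + Lam / (c1 * s2).
  by rewrite addr_ge0 ?divr_ge0 ?mulr_ge0// ltW.
pose C1 := (c1 / c2 + Lam / (c2 * s1) + s2 * (1 * mass mu k1)) * c2 ^+ 2.
pose C2 := (c2 / c1 + Lam / (c1 * s2) + s1 * (1 * mass mu k2)) * c1 ^+ 2.
have C1_ge0 : 0 <= C1.
  by rewrite mulr_ge0 ?sqr_ge0// addr_ge0// mulr_ge0 ?(ltW s2_gt0)// mul1r mass_ge0.
have C2_ge0 : 0 <= C2.
  by rewrite mulr_ge0 ?sqr_ge0// addr_ge0// mulr_ge0 ?(ltW s1_gt0)// mul1r mass_ge0.
exists (C1 + C2 + c1 * c2) => [|h h0].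
  by rewrite !addr_ge0// mulr_ge0// ltW.
have ch1 : 0 <= c1 * h by rewrite mulr_ge0// ltW.
have ch2 : 0 <= c2 * h by rewrite mulr_ge0// ltW.
have wl1 := weight_lapk_lt (c1 * h) s1_gt0.
have wl2 := weight_lapk_lt (c2 * h) s2_gt0.
have bW := bounded_wint1 wl1 bq.
have S1 := strip_close s2_gt0 c2_gt0 K1 bD1 F1M D1_close h0; rewrite -/C1 in S1.
have S2 := strip_close s1_gt0 c1_gt0 K2 bD2 F2M D2_close h0; rewrite -/C2 in S2.
rewrite /layer.
have splitE := wint_lapk_split (c2 * h) s2_gt0 bW.
rewrite (wint_swap wl1 w2 bq) in splitE.
have corner0 := wint_ge0 wl2 bW.
have cornerM : wint mu (lapk_lt s2 (c2 * h))
    (fun v => wint mu (lapk_lt s1 (c1 * h)) (fun u => q (u, v))) <= c1 * c2 * h ^+ 2.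
  apply: (le_trans (wint_bound wl2 bW)); rewrite mul1r.
  have /andP[_ m1] := mass_lapk_lt s1_gt0 ch1; have /andP[_ m2] := mass_lapk_lt s2_gt0 ch2.
  rewrite (_ : c1 * c2 * h ^+ 2 = (c1 * h) * (c2 * h)); last by ring.
  by apply: ler_pM => //; exact: mass_ge0.
rewrite mulrDr !(mulrDl _ _ (h ^+ 2)).
exact: (ler_distD_overlap S1 S2 splitE corner0 cornerM).
Qed.

(* The bound below is the Laplace transform of the one-step equation. *)
Lemma kernel_limit (L K : R) : 0 <= K ->
  (forall h, 0 < h -> h <= 1 ->
    `|lap2 q - expR (- (Lam * h)) * lap2 (fun z => q (z + drift c1 c2 h))
      - h * expR (- (Lam * h)) * L| <= K * h ^+ 2) ->
  (Lam - (c1 * s1 + c2 * s2)) * lap2 q + c2 * F1 + c1 * F2 = L.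
Proof.
move=> K0 step; set a := c1 * s1 + c2 * s2 - Lam.
have [C C0 layC] := layer_expansion.
(* Chosen so that a h and - Lam h stay below 1/2, the range of [expR_taylor2]. *)
pose h0 : R := (2 * (`|a| + Lam + 1))^-1.
have den_gt0 : 0 < `|a| + Lam + 1 by rewrite ltr_wpDl// addr_ge0.
have h0_gt0 : 0 < h0 by rewrite invr_gt0 mulr_gt0.
have h0_le1 : h0 <= 1.
  rewrite invf_le1 ?mulr_gt0//.
  have e : 1 <= `|a| + Lam + 1 by rewrite lerDr addr_ge0.
  by rewrite (le_trans e)// ler_peMl ?ler1n// ltW.
apply/eqP; rewrite -subr_eq0; apply/eqP.
apply: (bigo2_linear_eq0 h0_gt0).
have small (b : R) : `|b| <= `|a| + Lam -> forall h, 0 < h -> h <= h0 -> b * h <= 2^-1.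
  move=> bab h h_gt0 hh; apply: (@le_trans _ _ ((`|a| + Lam + 1) * h0)).
    apply: (@le_trans _ _ ((`|a| + Lam + 1) * h)); last by rewrite ler_wpM2l// ltW.
    rewrite ler_wpM2r ?(ltW h_gt0)//.
    by rewrite (le_trans (ler_norm b))// (le_trans bab)// lerDl.
  by rewrite /h0 invfM mulrCA divff ?mulr1// gt_eqF.
have tay (b : R) : `|b| <= `|a| + Lam ->
    bigo h0 2 (fun h => expR (b * h) - 1 - b * h).
  move=> bab; exists (2 * b ^+ 2) => [|h h1 h2]; first by rewrite mulr_ge0// sqr_ge0.
  have /andP[e0 e1] := expR_taylor2 (small b bab h h1 h2).
  by rewrite ger0_norm// (le_trans e1)// exprMn mulrA.
have oa := tay a; have oL := tay (- Lam).
have aA : `|a| <= `|a| + Lam by rewrite lerDl.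
have LA : `|- Lam| <= `|a| + Lam by rewrite normrN ger0_norm// lerDr.
have bS : bigo h0 2 (fun h => layer h - h * (c2 * F1 + c1 * F2)).
  by exists C => // h h1 h2; exact/layC/ltW.
have br : bigo h0 2 (fun h => lap2 q
    - expR (- (Lam * h)) * lap2 (fun z => q (z + drift c1 c2 h))
    - h * expR (- (Lam * h)) * L).
  by exists K => // h h1 h2; apply: step => //; exact: le_trans h0_le1.
have bS1 : bigo h0 1 layer.
  have := bigoD (bigoW h0_le1 (leqnSn 1) bS) (bigoM (bigo_id h0) (bigo_cst h0 (c2 * F1 + c1 * F2))).
  by move=> [C' C'0 H]; exists C' => // h h1 h2; have := H h h1 h2; rewrite /= subrK.
have bid := bigo_id h0.
have e1 := bigoD (bigoM (bigo_cst h0 a) bid) (bigoW h0_le1 (leqnSn 1) (oa aA)).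
have t1 := bigoN (bigoM e1 bS1).
have t2 := bigoM (oa aA) (bigo_cst h0 (lap2 q)).
have e2 := bigoD (bigoM (bigo_cst h0 (- Lam)) bid) (bigoW h0_le1 (leqnSn 1) (oL LA)).
have t3 := bigoM (bigoM bid e2) (bigo_cst h0 L).
(* The sum of these five second-order quantities is exactly h times the difference of the two sides
   of the equation. *)
have [C' C'0 H] := bigoD (bigoD br (bigoN bS)) (bigoD (bigoD t1 t2) t3).
exists C' => // h h1 h2; have := H h h1 h2; apply: le_trans.
rewrite le_eqVlt; apply/orP; left; apply/eqP; congr (`| _ |).
rewrite (lap2_drift (ltW h1)) mulrA -expRD mulNr.
rewrite (_ : - (Lam * h) + _ = a * h); last by rewrite /a; ring.
rewrite /a; ring.
Qed.

End kernel_limit.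

Section parametric_laplace.
Context (R : realType) (s1 s2 : R) d (S : measurableType d).
Hypotheses (s1_gt0 : 0 < s1) (s2_gt0 : 0 < s2).
Local Notation mu := (@lebesgue_measure R).
Local Notation lap2 := (double_laplace s1 s2).
Variables (M : R) (f : (R * R) * S -> R).
Hypothesis bf : bounded_by M f.

Let w1 : weight mu (lapk s1). Proof. exact: weight_lapk. Qed.
Let w2 : weight mu (lapk s2). Proof. exact: weight_lapk. Qed.

Let G (vw : R * S) := wint mu (lapk s1) (fun u => f ((u, vw.1), vw.2)).

Let brearr : bounded_by M (fun x : R * (R * S) => f ((x.1, x.2.1), x.2.2)).
Proof.
have [mf f0] := bf; split=> //; apply: (measurableT_comp mf).
by apply: measurable_fun_pair; [apply: measurable_fun_pair => //|];
  exact: measurableT_comp.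
Qed.

Let bG : bounded_by (M * mass mu (lapk s1)) G.
Proof. exact: (wint_bounded2 (m1 := mu) w1 brearr). Qed.

Lemma lap2_bounded : bounded_by (M / s1 / s2) (fun w => lap2 (fun z => f (z, w))).
Proof.
have := wint_bounded2 (m1 := mu) w2 bG; rewrite !mass_lapk//.
Qed.

Lemma lap2_wint (m : {sigma_finite_measure set S -> \bar R}) (k : S -> R) :
  weight m k ->
  lap2 (fun z => wint m k (fun w => f (z, w))) =
  wint m k (fun w => lap2 (fun z => f (z, w))).
Proof.
move=> wk; rewrite /double_laplace.
rewrite -(wint_fubini (m1 := mu) (m2 := m) w2 wk bG).
apply: wint_eq => v _.
have bv : bounded_by M (fun x : R * S => f ((x.1, v), x.2)).
  have [mf f0] := bf; split=> //; apply: (measurableT_comp mf).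
  by apply: measurable_fun_pair => //; apply: measurable_fun_pair.
exact: (wint_fubini (m1 := mu) (m2 := m) w1 wk bv).
Qed.

End parametric_laplace.

Section lap2_linear.
Context (R : realType) (s1 s2 : R).
Hypotheses (s1_gt0 : 0 < s1) (s2_gt0 : 0 < s2).
Local Notation mu := (@lebesgue_measure R).
Local Notation lap2 := (double_laplace s1 s2).

Lemma lap2D M f g : bounded_by M f -> bounded_by M g ->
  lap2 (fun z => f z + g z) = lap2 f + lap2 g.
Proof.
move=> bf bg; have w1 := weight_lapk s1_gt0; have w2 := weight_lapk s2_gt0.
rewrite /double_laplace -(wintD w2 (bounded_wint1 w1 bf) (bounded_wint1 w1 bg)).
by apply: wint_eq => v _; rewrite -(wintD w1 (bounded_fst v bf) (bounded_fst v bg)).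
Qed.

Lemma lap2Z M c f : 0 <= c -> bounded_by M f -> lap2 (fun z => c * f z) = c * lap2 f.
Proof.
move=> c0 bf; have w1 := weight_lapk s1_gt0; have w2 := weight_lapk s2_gt0.
rewrite /double_laplace -(wintZ w2 c0 (bounded_wint1 w1 bf)).
by apply: wint_eq => v _; rewrite -(wintZ w1 c0 (bounded_fst v bf)).
Qed.

End lap2_linear.

Section exponential_expectation.
Context (R : realType).
Local Notation mu := (@lebesgue_measure R).

(** Layer cake: [H x] is the length of [0, H x[. Exchanging the integrals leaves the probabilities
    of the sets where y < H x, and on sets [exponential_prob] is by definition the integral of its
    density. *)
Lemma integral_exponential_prob (M : R) (H : R -> R) : bounded_by M H ->
  (\int[exponential_prob 1%R]_x (H x)%:E = \int[mu]_x (lapk 1 x * H x)%:E)%E.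
Proof.
move=> [mH H0].
pose k (x y : R) : R := if (0 <= y) && (y < H x) then 1 else 0.
have mk : measurable_fun setT (fun xy : R * R => (k xy.1 xy.2)%:E).
  apply/measurable_EFinP; apply: measurable_fun_ifT => //.
  apply: measurable_and.
    by apply: measurable_fun_ler => //; exact: measurable_snd.
  apply: measurable_fun_ltr; first exact: measurable_snd.
  exact: measurableT_comp mH measurable_fst.
have k0 (xy : R * R) : (0 <= (k xy.1 xy.2)%:E)%E by rewrite lee_fin /k; case: ifP.
have kH x : (\int[mu]_y (k x y)%:E = (H x)%:E)%E.
  transitivity (\int[mu]_y (\1_(`[0%R, H x[%classic : set R) (y : R))%:E)%E.
    by apply: eq_integral => y _; rewrite /k indicE mem_setE in_itv/=; case: ifP.
  rewrite integral_indic//= setIT lebesgue_measure_itv/= lte_fin.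
  case: ltP => [_|Hx]; first by rewrite oppr0 adde0.
  by congr EFin; apply/eqP; rewrite eq_le Hx andbT; case/andP: (H0 x).
pose S (y : R) : set R := [set x : R | (0 <= y) && (y < H x)].
have swapE (m : {sigma_finite_measure set (measurableTypeR R) -> \bar R}) :
    (\int[m]_x (H x)%:E = \int[mu]_y m (S y))%E.
  transitivity (\int[m]_x \int[mu]_y (k x y)%:E)%E.
    by apply: eq_integral => x _; rewrite kH.
  transitivity (\int[mu]_y \int[m]_x (k x y)%:E)%E.
    exact: (fubini_tonelli (m1 := m) (m2 := mu) (fun xy : R * R => (k xy.1 xy.2)%:E)).
  apply: eq_integral => y _.
  have mS : measurable (S y).
    rewrite -[X in measurable X]setTI.
    have mb : measurable_fun setT (fun x => (0 <= y) && (y < H x)).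
      by apply: measurable_and => //; exact: measurable_fun_ltr.
    exact: mb measurableT [set true] _.
  transitivity (\int[m]_x (\1_(S y) x)%:E)%E; last by rewrite integral_indic// setIT.
  apply: eq_integral => x _; rewrite /k indicE /S.
  by case: ifPn => [H1|/negP H1]; [rewrite mem_set|rewrite memNset].
pose ex : probability (measurableTypeR R) R :=
  exponential_distribution_exponential_prob__canonical__probability_measure_Probability
    (ltr01 : 0 < (1 : R)).
transitivity (\int[mu]_y ex (S y))%E; first exact: (swapE ex).
transitivity (\int[mu]_y \int[mu]_x (lapk 1 x * k x y)%:E)%E.
  apply: eq_integral => y _; rewrite -[LHS]/(\int[mu]_(x in S y) (exponential_pdf 1 x)%:E)%E integral_mkcond.
  apply: eq_integral => x _; rewrite patchE /k /S.
  have pdfE : exponential_pdf 1 x = lapk 1 x.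
    rewrite /exponential_pdf patchE mem_setE in_itv/= andbT /lapk.
    by case: ifP => // _; rewrite mul1r.
  have -> : (x \in [set x0 : R | 0 <= y < H x0]) = (0 <= y < H x) by apply/idP/idP; rewrite inE.
  by case: ifP => _; rewrite ?mulr1 ?mulr0 ?pdfE.
transitivity (\int[mu]_x \int[mu]_y (lapk 1 x * k x y)%:E)%E.
  apply: esym; apply: (fubini_tonelli (m1 := mu) (m2 := mu)
    (fun xy : R * R => (lapk 1 xy.1 * k xy.1 xy.2)%:E)).
    apply/measurable_EFinP; apply: measurable_funM; last exact/measurable_EFinP.
    exact: measurableT_comp (measurable_lapk 1) measurable_fst.
  by move=> xy; rewrite lee_fin mulr_ge0 ?lapk_ge0// -lee_fin.
apply: eq_integral => x _; rewrite EFinM -kH -ge0_integralZl//.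
- by apply/measurable_EFinP; move/measurable_EFinP : mk => mk; exact: measurableT_comp mk (pair1_measurable x).
- by move=> y _; exact: (k0 (x, y)).
- by rewrite lee_fin lapk_ge0.
Qed.

End exponential_expectation.

(** * Laplace transform of a reflected shock *)

Section tails.
Context (R : realType).
Local Notation mu := (@lebesgue_measure R).

Lemma integral_expR_tail (N m : R) : 0 < N ->
  (\int[mu]_j (if m <= j then expR (- N * j) else 0)%:E = (expR (- N * m) / N)%:E)%E.
Proof.
move=> N0.
transitivity (\int[mu]_j (expR (- N * m) * lapk N ((j : R) + - m)%R)%:E)%E.
  apply: eq_integral => j _; congr EFin; rewrite /lapk subr_ge0.
  by case: ifP => _; rewrite ?mulr0// -expRD; congr expR; ring.
rewrite (ge0_integral_shift (- m) (f := fun j : R => (expR (- N * m) * lapk N j)%:E)).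
- under eq_integral do rewrite EFinM.
  rewrite ge0_integralZl//; first by rewrite integral_lapk// EFinM.
  + by apply/measurable_EFinP; exact: measurable_lapk.
  + by move=> x _; rewrite lee_fin lapk_ge0.
- by apply/measurable_EFinP; apply: measurable_funM => //; exact: measurable_lapk.
- by move=> x; rewrite lee_fin mulr_ge0 ?expR_ge0 ?lapk_ge0.
Qed.

Lemma integral_expR_itv (b0 b1 : bool) (a b kap : R) : kap != 0 -> a <= b ->
  (\int[mu]_m (if (m : R) \in Interval (BSide b0 a) (BSide b1 b) then expR (kap * m) else 0)%:E
   = ((expR (kap * b) - expR (kap * a)) / kap)%:E)%E.
Proof.
move=> k0 ab.
have mf A : measurable_fun A (fun m : R => (expR (kap * m))%:E).
  apply: measurable_funTS; apply/measurable_EFinP.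
  by apply: measurableT_comp; [exact: measurable_expR|exact: measurable_funM].
transitivity (\int[mu]_(m in [set` Interval (BSide b0 a) (BSide b1 b)]) (expR (kap * m))%:E)%E.
  rewrite [RHS]integral_mkcond; apply: eq_integral => m _.
  by rewrite patchE mem_setE; case: ifP.
rewrite (integral_itv_bndoo _ _ (mf _)) -(integral_itv_bndoo true false (mf _)).
move: ab; rewrite le_eqVlt => /predU1P[->|ab].
  by rewrite set_itv1 integral_set1 subrr mul0r.
have dF (x : R) : is_derive x (1:R) (fun m : R => expR (kap * m) / kap) (expR (kap * x)).
  by apply: is_derive_eq; rewrite /GRing.scale/=; field.
have cF (x : R) : {for x, continuous (fun m : R => expR (kap * m) / kap)}.
  by apply: differentiable_continuous; apply/derivable1_diffP; case: (dF x).
rewrite (continuous_FTC2 (F := fun m : R => expR (kap * m) / kap) ab).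
- by rewrite -EFinB mulrBl.
- apply: continuous_subspaceT => x.
  by apply: continuous_comp; [exact: mulrl_continuous|exact: continuous_expR].
- split.
  + by move=> x _; case: (dF x).
  + exact/cvg_at_right_filter/cF.
  + exact/cvg_at_left_filter/cF.
- by move=> x _; rewrite derive1E; exact: derive_val.
Qed.

End tails.

(** * Splitting a reflected shock along the regions of the reflection *)

Section shock_transform.
Context (R : realType).
Local Notation mu := (@lebesgue_measure R).
Implicit Types (f : R * R -> R) (g : R -> R) (M s a b r : R).

(* The double Laplace transform of z |-> E f (z - (J a, J b)), J standard exponential. *)
Definition shock s1 s2 a b f : R :=
  wint mu (lapk 1) (fun j : R => double_laplace s1 s2 (fun z => f (z - (j * a, j * b)))).

Definition in_quadrant f (x : R * R) : R := if (0 <= x.1) && (0 <= x.2) then f x else 0.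

Definition side1 r1 r2 g (x : R * R) : R :=
  if x.1 < Num.min (r2 * x.2) 0 then g (x.2 - r1 * x.1) else 0.

Definition side2 r1 r2 g (x : R * R) : R := side1 r2 r1 g (x.2, x.1).

Definition cone r1 r2 (x : R * R) : R :=
  if [|| (0 <= x.1) && (0 <= x.2), x.1 < Num.min (r2 * x.2) 0
    | x.2 < Num.min (r1 * x.1) 0] then 0 else 1.

Section fixed_shock.
Variables (s1 s2 a b : R).
Hypotheses (s1_gt0 : 0 < s1) (s2_gt0 : 0 < s2).
Local Notation E := (shock s1 s2 a b).

Lemma bounded_shocked M f : bounded_by M f ->
  bounded_by M (fun x : (R * R) * R => f (x.1 - (x.2 * a, x.2 * b))).
Proof.
move=> [mf f0]; split=> //; apply: (measurableT_comp mf).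
have m1 : measurable_fun setT (fun x : (R * R) * R => x.1) by exact: measurable_fst.
have /measurable_fun_pairP[/= m11 m12] := m1.
by apply/measurable_fun_pairP; split; apply: measurable_funB => //; apply: measurable_funM.
Qed.

Lemma bounded_lap2_shocked M f : bounded_by M f ->
  bounded_by (M / s1 / s2) (fun j : R => double_laplace s1 s2 (fun z => f (z - (j * a, j * b)))).
Proof. by move=> bf; exact: lap2_bounded (bounded_shocked bf). Qed.

Lemma shockD M f f' : bounded_by M f -> bounded_by M f' ->
  E (fun x => f x + f' x) = E f + E f'.
Proof.
move=> bf bf'; rewrite /shock.
rewrite -(wintD (weight_lapk ltr01) (bounded_lap2_shocked bf) (bounded_lap2_shocked bf')).
apply: wint_eq => j _; apply: (@lap2D _ _ _ _ _ M) => //.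
- exact: (bounded_by_pair2 (bounded_shocked bf)).
- exact: (bounded_by_pair2 (bounded_shocked bf')).
Qed.

Lemma shockZ M c f : 0 <= c -> bounded_by M f -> E (fun x => c * f x) = c * E f.
Proof.
move=> c0 bf; rewrite /shock.
rewrite -(wintZ (weight_lapk ltr01) c0 (bounded_lap2_shocked bf)).
apply: wint_eq => j _; apply: (@lap2Z _ _ _ _ _ M) => //.
exact: (bounded_by_pair2 (bounded_shocked bf)).
Qed.

Lemma lap2_cst c : 0 <= c -> double_laplace s1 s2 (fun=> c) = c / s1 / s2.
Proof.
move=> c0; rewrite /double_laplace (wint_cst (weight_lapk s1_gt0) c0).
by rewrite !mass_lapk// (wint_cst (weight_lapk s2_gt0)) ?mass_lapk// divr_ge0// ltW.
Qed.

Lemma shock_cst c : 0 <= c -> E (fun=> c) = c / s1 / s2.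
Proof.
move=> c0; rewrite /shock lap2_cst// (wint_cst (weight_lapk ltr01)).
  by rewrite mass_lapk// invr1 mulr1.
by rewrite !divr_ge0// ltW.
Qed.

End fixed_shock.

Lemma shock_swap s1 s2 a b M f : 0 < s1 -> 0 < s2 -> bounded_by M f ->
  shock s1 s2 a b f = shock s2 s1 b a (fun x => f (x.2, x.1)).
Proof.
move=> s10 s20 bf; apply: wint_eq => j _.
have bfj : bounded_by M (fun z : R * R => f (z - (j * a, j * b))).
  exact: (bounded_by_pair2 (bounded_shocked a b bf)).
exact: (wint_swap (weight_lapk s10) (weight_lapk s20) bfj).
Qed.

Lemma bounded_in_quadrant M f : 0 <= M -> bounded_by M f -> bounded_by M (in_quadrant f).
Proof.
move=> M0 [mf f0]; split=> [|x]; last by rewrite /in_quadrant; case: ifP => _; rewrite ?f0 ?lexx.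
by apply: measurable_fun_ifT => //; apply: measurable_and; apply: measurable_fun_ler.
Qed.

Lemma bounded_swap M f : bounded_by M f -> bounded_by M (fun x => f (x.2, x.1)).
Proof.
by move=> [mf f0]; split=> //; apply: (measurableT_comp mf); exact: measurable_fun_pair.
Qed.

Lemma bounded_side1 r1 r2 M g : 0 <= M -> bounded_by M g -> bounded_by M (side1 r1 r2 g).
Proof.
move=> M0 [mg g0]; split=> [|x]; last by rewrite /side1; case: ifP => _; rewrite ?g0 ?lexx.
apply: measurable_fun_ifT => //; last first.
  by apply: (measurableT_comp mg); apply: measurable_funB => //; exact: measurable_funM.
apply: measurable_fun_ltr => //; apply: measurable_minr => //; exact: measurable_funM.
Qed.

Lemma bounded_side2 r1 r2 M g : 0 <= M -> bounded_by M g -> bounded_by M (side2 r1 r2 g).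
Proof. by move=> M0 /(bounded_side1 r2 r1 M0)/bounded_swap; apply. Qed.

Lemma bounded_cone r1 r2 : bounded_by 1 (cone r1 r2).
Proof.
split=> [|x]; last by rewrite /cone; case: ifP => _; rewrite ?ler01 ?lexx.
have mr r : measurable_fun setT (fun x : R * R => Num.min (r * x.2) 0).
  by apply: measurable_minr => //; exact: measurable_funM.
have mr' r : measurable_fun setT (fun x : R * R => Num.min (r * x.1) 0).
  by apply: measurable_minr => //; exact: measurable_funM.
apply: measurable_fun_ifT => //; apply: measurable_or.
  by apply: measurable_and; apply: measurable_fun_ler.
by apply: measurable_or; apply: measurable_fun_ltr.
Qed.

(** The terms may be added because the two side regions are disjoint: in both of them one would have
    x2 < r1 x1 < r1 r2 x2 < x2 with x2 negative. *)
Lemma reflect_regions r1 r2 (x : R * R) : 0 < r1 -> 0 < r2 -> 1 < r1 * r2 ->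
  forall f, f (reflect_point r1 r2 x) = in_quadrant f x
    + (side1 r1 r2 (fun v => f (0, v)) x + (side2 r1 r2 (fun u => f (u, 0)) x
       + f (0, 0) * cone r1 r2 x)).
Proof.
move=> r10 r20 r12 f; rewrite /cone /side2 /side1 /in_quadrant /reflect_point /=.
case: ifPn => [/andP[x0 y0]|xy] /=.
  have -> : x.1 < Num.min (r2 * x.2) 0 = false by rewrite lt_min !ltNge x0 andbF.
  have -> : x.2 < Num.min (r1 * x.1) 0 = false by rewrite lt_min !ltNge y0 andbF.
  by rewrite mulr0 !addr0.
case: ifPn => [|H1] /=.
  rewrite lt_min => /andP[xry x0].
  have -> : x.2 < Num.min (r1 * x.1) 0 = false.
    apply/negbTE; rewrite lt_min negb_and -!leNgt; have [|y0] := leP 0 x.2; first by rewrite orbT.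
    rewrite orbF leNgt; apply/negP => yrx; nra.
  by rewrite mulr0 add0r !addr0.
by case: ifPn => [H2|H2]; rewrite ?mulr0 ?mulr1 ?add0r ?addr0.
Qed.

Section expansion.
Variables (s1 s2 a b r1 r2 : R).
Hypotheses (s1_gt0 : 0 < s1) (s2_gt0 : 0 < s2) (a_ge0 : 0 <= a) (b_ge0 : 0 <= b).
Hypotheses (r1_gt0 : 0 < r1) (r2_gt0 : 0 < r2) (r12 : 1 < r1 * r2).
Local Notation E := (shock s1 s2 a b).
Local Notation N := (1 + s1 * a + s2 * b).

Lemma wint_lapk_delay s delta M g : 0 < s -> 0 <= delta -> 0 <= M -> bounded_by M g ->
  wint mu (lapk s) (fun x : R => if 0 <= x - delta then g (x - delta) else 0)
  = expR (- (s * delta)) * wint mu (lapk s) g.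
Proof.
move=> s0 d0 M0 [mg g0].
pose G (x : R) := if 0 <= x then g x else 0.
have bG : bounded_by M G.
  split=> [|x]; last by rewrite /G; case: ifP => _; rewrite ?g0 ?lexx.
  by apply: measurable_fun_ifT => //; exact: measurable_fun_ler.
have bGd := bounded_by_shift (- delta) bG.
have := wint_lapk_shift s0 d0 bGd => /=.
rewrite (_ : wint _ _ _ = wint mu (lapk s) g) => [->|]; last first.
  by apply: wint_eq => x /lapk_neq0 x0; rewrite addrK /G x0.
rewrite mulrA -expRD addNr expR0 mul1r; apply: eq_Rintegral => x _.
rewrite /lapk_ge /G; rewrite subr_ge0 leNgt; case: ltP => _ //=.
by rewrite mul0r mulr0.
Qed.

(** A shock of size j delays the two variables by j a and j b, hence multiplies the transform by
    exp(- (s1 a + s2 b) j); averaging over the exponential size gives 1 / N. *)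
Lemma shock_in_quadrant M f : 0 <= M -> bounded_by M f ->
  E (in_quadrant f) = double_laplace s1 s2 f / N.
Proof.
move=> M0 bf; have N0 : 0 < N by rewrite -addrA ltr_pwDl// addr_ge0// mulr_ge0// ltW.
have w1 := weight_lapk s1_gt0.
have bC : bounded_by (double_laplace s1 s2 f) (fun _ : R => double_laplace s1 s2 f).
  split=> // x; rewrite lexx andbT.
  exact: (wint_ge0 (weight_lapk s2_gt0) (bounded_wint1 w1 bf)).
have C0 := bounded_by_ge0 point bC.
rewrite -(mass_lapk N0) -(wint_cst (weight_lapk N0) C0).
apply: eq_Rintegral => j _; rewrite /lapk; case: ifPn => j0; last by rewrite !mul0r.
have -> : double_laplace s1 s2 (fun z => in_quadrant f (z - (j * a, j * b))) =
    expR (- (s1 * (j * a))) * (expR (- (s2 * (j * b))) * double_laplace s1 s2 f).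
  have ja : 0 <= j * a by rewrite mulr_ge0.
  have jb : 0 <= j * b by rewrite mulr_ge0.
  have bw := bounded_wint1 w1 bf.
  rewrite -(wint_lapk_delay s2_gt0 jb _ bw); last by rewrite mulr_ge0// mass_ge0.
  set g := (X in _ * wint _ _ X).
  have bg : bounded_by (M * mass mu (lapk s1)) g.
    have [mw w0] := bw; split=> [|x]; last first.
      by rewrite /g; case: ifP => _; rewrite ?w0 ?lexx ?mulr_ge0 ?mass_ge0.
    apply: measurable_fun_ifT => //; first by apply: measurable_fun_ler => //; exact: measurable_funD.
    by apply: (measurableT_comp mw); exact: measurable_funD.
  rewrite -(wintZ (weight_lapk s2_gt0) (expR_ge0 _) bg).
  apply: wint_eq => v _; rewrite /g /in_quadrant/=; case: ifPn => vb.
    rewrite -(wint_lapk_delay s1_gt0 ja M0 (bounded_fst (v - j * b) bf)).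
    by apply: wint_eq => u _; rewrite andbT.
  rewrite mulr0; under [X in wint _ _ X]eq_fun do rewrite andbF.
  by rewrite (wint_cst w1 (lexx 0)) mul0r.
by rewrite !mulrA -!expRD; congr (expR _ * _); ring.
Qed.

(* The mass of the cone is obtained from the total mass rather than by
   integrating over it. *)
Lemma shock_expansion (D1 D2 : (R -> R) -> R) f : bounded_by 1 f ->
  (forall g, bounded_by 1 g -> E (side1 r1 r2 g) = D1 g) ->
  (forall g, bounded_by 1 g -> E (side2 r1 r2 g) = D2 g) ->
  E (fun x => f (reflect_point r1 r2 x)) = double_laplace s1 s2 f / N
    + D1 (fun v => f (0, v)) + D2 (fun u => f (u, 0))
    + f (0, 0) * ((1 - N^-1) / (s1 * s2) - D1 (fun=> 1) - D2 (fun=> 1)).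
Proof.
move=> bf HD1 HD2.
have b1 : bounded_by 1 (fun _ : R * R => 1 : R) by split=> // x; rewrite ler01 lexx.
have b1' : bounded_by 1 (fun _ : R => 1 : R) by split=> // x; rewrite ler01 lexx.
have expand h : bounded_by 1 h -> E (fun x => h (reflect_point r1 r2 x)) = double_laplace s1 s2 h / N
    + (D1 (fun v => h (0, v)) + (D2 (fun u => h (u, 0)) + h (0, 0) * E (cone r1 r2))).
  move=> bh; have [_ h0] := bh; have /andP[h00 h01] := h0 (0, 0).
  under [X in E X]eq_fun do rewrite reflect_regions//.
  have bq := bounded_in_quadrant ler01 bh.
  have bs1 := bounded_side1 r1 r2 ler01 (bounded_snd 0 bh).
  have bs2 := bounded_side2 r1 r2 ler01 (bounded_fst 0 bh).
  have bc := bounded_cone r1 r2.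
  have bcz : bounded_by 1 (fun x => h (0, 0) * cone r1 r2 x).
    have [mc c0] := bc; split=> [|x]; first exact: measurable_funM.
    by have /andP[c00 c01] := c0 x; rewrite mulr_ge0//= mulr_ile1.
  have bD (k l : R * R -> R) (K : R) : bounded_by 1 k -> bounded_by K l -> bounded_by (1 + K) (fun x => k x + l x).
    move=> [mk k0] [ml l0]; split=> [|x]; first exact: measurable_funD.
    by have /andP[? ?] := k0 x; have /andP[? ?] := l0 x; rewrite addr_ge0//= lerD.
  have bsc := bD _ _ _ bs2 bcz.
  have bssc := bD _ _ _ bs1 bsc.
  have one_le (x : R) : 0 <= x -> 1 <= 1 + x by rewrite lerDl.
  rewrite (shockD a b s1_gt0 s2_gt0 (bounded_byW (one_le (1 + 1) _) bq) bssc) ?addr_ge0//.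
  rewrite (shockD a b s1_gt0 s2_gt0 (bounded_byW (one_le 1 _) bs1) bsc)//.
  rewrite (shockD a b s1_gt0 s2_gt0 bs2 bcz) (shockZ a b s1_gt0 s2_gt0 h00 bc).
  rewrite (shock_in_quadrant ler01 bh) HD1 ?HD2//; first exact: (bounded_fst 0 bh).
  exact: (bounded_snd 0 bh).
have := expand _ b1; rewrite (shock_cst a b s1_gt0 s2_gt0 ler01) (lap2_cst s1_gt0 s2_gt0 ler01).
rewrite expand// -!addrA; move=> H; congr (_ + (_ + (_ + _ * _))).
move: H; set C := E _; set d1 := D1 _; set d2 := D2 _; set x := 1 / s1 / s2.
rewrite mul1r => H; have -> : C = x - x / (1 + (s1 * a + s2 * b)) - d1 - d2 by rewrite {1}H; ring.
by rewrite /x; field; rewrite !gt_eqF// ltr_pwDl// addr_ge0// mulr_ge0// ltW.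
Qed.

End expansion.

End shock_transform.

Section side_integral.
Context (R : realType).
Local Notation mu := (@lebesgue_measure R).

Lemma ge0_integral_rotate (K : R * R * R -> \bar R) : measurable_fun setT K ->
  (forall x, 0 <= K x)%E ->
  (\int[mu]_j \int[mu]_y \int[mu]_m K ((j, y), m) =
   \int[mu]_y \int[mu]_m \int[mu]_j K ((j, y), m))%E.
Proof.
move=> mK K0.
have mF : measurable_fun setT (fun jy : R * R => \int[mu]_m K (jy, m))%E.
  exact: (measurable_fun_fubini_tonelli_F (m2 := mu) _ mK).
transitivity (\int[mu]_y \int[mu]_j \int[mu]_m K ((j, y), m))%E.
  apply: (fubini_tonelli (m1 := mu) (m2 := mu) (fun jy : R * R => \int[mu]_m K (jy, m))%E) => //.
  by move=> jy; apply: integral_ge0.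
apply: eq_integral => y _.
apply: (fubini_tonelli (m1 := mu) (m2 := mu) (fun jm : R * R => K ((jm.1, y), jm.2))%E) => //.
apply: (measurableT_comp mK); apply: measurable_fun_pair => //.
exact: measurable_fun_pair.
Qed.

Lemma ge0_integral_shear (h : R * R -> \bar R) (c e r : R) : measurable_fun setT h ->
  (forall x, 0 <= h x)%E ->
  (\int[mu]_v \int[mu]_u h (u, v) =
   \int[mu]_y \int[mu]_m h ((c - (m : R))%R, ((y : R) + (e - r * m))%R))%E.
Proof.
move=> mh h0.
have mc : measurable_fun setT (fun vm : R * R => h ((c - vm.2)%R, vm.1)).
  by apply: (measurableT_comp mh); apply: measurable_fun_pair => //; exact: measurable_funB.
have mr : measurable_fun setT (fun ym : R * R => h ((c - ym.2)%R, (ym.1 + (e - r * ym.2))%R)).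
  apply: (measurableT_comp mh); apply: measurable_fun_pair; first exact: measurable_funB.
  by apply: measurable_funD => //; apply: measurable_funB => //; exact: measurable_funM.
transitivity (\int[mu]_v \int[mu]_m h ((c - (m : R))%R, (v : R)))%E.
  apply: eq_integral => v _.
  have mhv : measurable_fun setT (fun u : R => h (u, v)).
    exact: (measurableT_comp mh (pair2_measurable v)).
  have mhv' : measurable_fun setT (fun u : R => h ((u + c)%R, v)).
    exact: (measurableT_comp mhv (measurable_shift c)).
  rewrite -(ge0_integral_shift c mhv)// -(ge0_integral_opp mhv')//.
  by apply: eq_integral => m _; rewrite (addrC c).
transitivity (\int[mu]_m \int[mu]_v h ((c - (m : R))%R, (v : R)))%E.
  exact: (fubini_tonelli (m1 := mu) (m2 := mu) (fun vm : R * R => h ((c - vm.2)%R, vm.1))).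
transitivity (\int[mu]_m \int[mu]_y h ((c - (m : R))%R, ((y : R) + (e - r * m))%R))%E.
  apply: eq_integral => m _.
  have mhm : measurable_fun setT (fun v : R => h ((c - m)%R, v)).
    exact: (measurableT_comp mh (pair1_measurable _)).
  by rewrite (ge0_integral_shift (e - r * m) mhm).
apply: esym.
exact: (fubini_tonelli (m1 := mu) (m2 := mu)
  (fun ym : R * R => h ((c - ym.2)%R, (ym.1 + (e - r * ym.2))%R))).
Qed.

Lemma lap2E (s1 s2 M : R) (f : R * R -> R) : 0 < s1 -> 0 < s2 -> bounded_by M f ->
  (double_laplace s1 s2 f)%:E =
  (\int[mu]_v \int[mu]_u (lapk s2 (v : R) * (lapk s1 (u : R) * f (u, v)))%:E)%E.
Proof.
move=> s10 s20 bf; have w1 := weight_lapk s10; have [mf f0] := bf.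
rewrite (wintE (weight_lapk s20) (bounded_wint1 w1 bf)).
apply: eq_integral => v _; rewrite EFinM (wintE w1 (bounded_fst v bf)).
rewrite -ge0_integralZl//.
- apply/measurable_EFinP; apply: measurable_funM; first exact: measurable_lapk.
  by case: (bounded_fst v bf).
- by move=> u _; rewrite lee_fin mulr_ge0 ?lapk_ge0//; case/andP: (f0 (u, v)).
- by rewrite lee_fin lapk_ge0.
Qed.

Section fixed_shock.
Variables (s1 s2 a b r1 r2 : R).
Hypotheses (s1_gt0 : 0 < s1) (s2_gt0 : 0 < s2).

(* The substitution u = j a - m, v = y + (j b - r1 m), i.e. x1 = - m and
   x2 = y - r1 m after the jump, sends side1 r1 r2 g to g y. *)
Definition side_density (y m j : R) : R :=
  if - m < Num.min (r2 * (y - r1 * m)) 0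
  then lapk 1 j * (lapk s1 (j * a - m) * lapk s2 (y + (j * b - r1 * m))) else 0.

Lemma side_density_ge0 y m j : 0 <= side_density y m j.
Proof. by rewrite /side_density; case: ifP => // _; rewrite !mulr_ge0 ?lapk_ge0. Qed.

Lemma measurable_side_density :
  measurable_fun [set: R * R * R] (fun x : R * R * R => side_density x.1.2 x.2 x.1.1).
Proof.
have m1 : measurable_fun [set: R * R * R] (fun x : R * R * R => x.1.1) by exact: measurableT_comp.
have m2 : measurable_fun [set: R * R * R] (fun x : R * R * R => x.1.2) by exact: measurableT_comp.
have m3 : measurable_fun [set: R * R * R] (fun x : R * R * R => x.2) by exact: measurable_snd.
have mZ (c : R) (k : R * R * R -> R) : measurable_fun setT k -> measurable_fun setT (fun x => c * k x).
  by move=> mk; exact: measurable_funM.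
apply: measurable_fun_ifT => //.
  apply: measurable_fun_ltr; first exact: measurableT_comp.
  apply: measurable_minr => //; apply: (mZ r2 (fun x => _)); apply: measurable_funB => //.
  exact: (mZ r1 _ m3).
have ml s (k : R * R * R -> R) : measurable_fun setT k -> measurable_fun setT (fun x => lapk s (k x)).
  by move=> mk; exact: measurableT_comp (measurable_lapk s) mk.
apply: measurable_funM; first exact: (ml _ _ m1).
apply: measurable_funM; apply: (ml _ (fun x => _)).
  by apply: measurable_funB => //; exact: measurable_funM.
apply: measurable_funD => //; apply: measurable_funB; first exact: measurable_funM.
exact: (mZ r1 _ m3).
Qed.

(** After the substitution [g] depends on [y] alone and leaves the inner integrals, so each side
    reduces to one explicit density in [y]. *)
Lemma shock_side1 g : bounded_by 1 g ->
  ((shock s1 s2 a b (side1 r1 r2 g))%:E =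
   \int[mu]_y ((g y)%:E * \int[mu]_m \int[mu]_j (side_density y m j)%:E))%E.
Proof.
move=> bg; have [mg g01] := bg; have g0 y : 0 <= g y by case/andP: (g01 y).
have bs := bounded_side1 r1 r2 ler01 bg; have [ms s01] := bs.
have s0 x : 0 <= side1 r1 r2 g x by case/andP: (s01 x).
rewrite (wintE (weight_lapk ltr01) (bounded_lap2_shocked a b s1_gt0 s2_gt0 bs)).
pose K (x : R * R * R) := (side_density x.1.2 x.2 x.1.1 * g x.1.2)%:E.
have mK : measurable_fun setT K.
  apply/measurable_EFinP; apply: measurable_funM; first exact: measurable_side_density.
  by apply: (measurableT_comp mg); exact: measurableT_comp.
have K0 x : (0 <= K x)%E by rewrite lee_fin mulr_ge0// side_density_ge0.
transitivity (\int[mu]_j \int[mu]_y \int[mu]_m K ((j, y), m))%E.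
  apply: eq_integral => j _.
  have bj : bounded_by 1 (fun z : R * R => side1 r1 r2 g (z - (j * a, j * b))).
    exact: (bounded_by_pair2 (bounded_shocked a b bs)).
  pose h (z : R * R) :=
    (lapk s2 z.2 * (lapk s1 z.1 * side1 r1 r2 g (z - (j * a, j * b))))%:E.
  have mh : measurable_fun setT h.
    apply/measurable_EFinP; apply: measurable_funM.
      exact: measurableT_comp (measurable_lapk s2) measurable_snd.
    apply: measurable_funM; last by case: bj.
    exact: measurableT_comp (measurable_lapk s1) measurable_fst.
  have h0 z : (0 <= h z)%E by rewrite lee_fin !mulr_ge0 ?lapk_ge0.
  rewrite EFinM (lap2E s1_gt0 s2_gt0 bj).
  transitivity ((lapk 1 j)%:E * \int[mu]_v \int[mu]_u h (u, v))%E; first by [].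
  rewrite (ge0_integral_shear (j * a) (j * b) r1 mh h0).
  have mhs : measurable_fun setT (fun ym : R * R => h ((j * a - ym.2), (ym.1 + (j * b - r1 * ym.2)))).
    apply: (measurableT_comp mh); apply: measurable_fun_pair; first exact: measurable_funB.
    by apply: measurable_funD => //; apply: measurable_funB => //; exact: measurable_funM.
  have l0 : (0 <= (lapk 1 j)%:E)%E by rewrite lee_fin lapk_ge0.
  rewrite -ge0_integralZl//; first last.
  - by move=> y _; exact: integral_ge0.
  - exact: (measurable_fun_fubini_tonelli_F (m2 := mu) _ mhs).
  apply: eq_integral => y _; rewrite -ge0_integralZl//; last first.
    exact: (measurableT_comp mhs (pair1_measurable y)).
  apply: eq_integral => m _; rewrite /h /K /side_density /side1 /= -EFinM; congr EFin.
  rewrite (_ : j * a - m - j * a = - m); last by ring.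
  rewrite (_ : y + (j * b - r1 * m) - j * b = y - r1 * m); last by ring.
  case: ifP => _; last by rewrite !mulr0 mul0r.
  rewrite (_ : y - r1 * m - r1 * - m = y); last by ring.
  by ring.
rewrite (ge0_integral_rotate mK K0); apply: eq_integral => y _.
have mD : measurable_fun setT (fun mj : R * R => (side_density y mj.1 mj.2)%:E).
  apply/measurable_EFinP.
  have mt : measurable_fun setT (fun mj : R * R => ((mj.2, y), mj.1)).
    by apply: measurable_fun_pair => //; exact: measurable_fun_pair.
  exact: (measurableT_comp measurable_side_density mt).
have gy0 : (0 <= (g y)%:E)%E by rewrite lee_fin.
have D0 m j : (0 <= (side_density y m j)%:E)%E by rewrite lee_fin side_density_ge0.
rewrite -ge0_integralZl//; first last.
- by move=> m _; exact: integral_ge0.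
- exact: (measurable_fun_fubini_tonelli_F (m2 := mu) _ mD).
apply: eq_integral => m _; rewrite -ge0_integralZl//; last first.
  exact: (measurableT_comp mD (pair1_measurable m)).
by apply: eq_integral => j _; rewrite /K/= EFinM muleC.
Qed.

End fixed_shock.
End side_integral.

Section laplace_difference.
Context (R : realType).
Local Notation mu := (@lebesgue_measure R).

(** The form taken by the integral of an exponential in m over a window proportional to [y]: one
    exponential of [y] per endpoint. *)
Definition lapk_diff (C s s' y : R) : R := C * (lapk s y - lapk s' y).

Definition laplace_diff (C s s' : R) (g : R -> R) : R :=
  C * (wint mu (lapk s) g - wint mu (lapk s') g).

Lemma lapk_diff_integrable (C s s' M : R) (g : R -> R) : 0 < s -> 0 < s' -> bounded_by M g ->
  mu.-integrable setT (EFin \o (fun y => lapk_diff C s s' y * g y)).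
Proof.
move=> s0 s'0 bg.
have := integrableZl measurableT C (integrableB measurableT
  (wint_integrable (weight_lapk s0) bg) (wint_integrable (weight_lapk s'0) bg)).
apply: eq_integrable => // y _ /=.
by rewrite -EFinB -EFinM; congr EFin; rewrite /lapk_diff; ring.
Qed.

Lemma wint_lapk_diff (C s s' M : R) (g : R -> R) : 0 < s -> 0 < s' -> bounded_by M g ->
  wint mu (lapk_diff C s s') g = laplace_diff C s s' g.
Proof.
move=> s0 s'0 bg; have i1 := wint_integrable (weight_lapk s0) bg.
have i2 := wint_integrable (weight_lapk s'0) bg.
rewrite /laplace_diff /wint -RintegralB// -RintegralZl//.
  by apply: eq_Rintegral => y _; rewrite /lapk_diff; ring.
by have := integrableB measurableT i1 i2; apply: eq_integrable => // y _ /=; rewrite EFinB.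
Qed.

Lemma wint_lapk_diffD (C s s' C' t t' M : R) (g : R -> R) :
  0 < s -> 0 < s' -> 0 < t -> 0 < t' -> bounded_by M g ->
  wint mu (fun y => lapk_diff C s s' y + lapk_diff C' t t' y) g =
  laplace_diff C s s' g + laplace_diff C' t t' g.
Proof.
move=> s0 s'0 t0 t'0 bg.
rewrite -(wint_lapk_diff C s0 s'0 bg) -(wint_lapk_diff C' t0 t'0 bg) /wint.
rewrite -RintegralD//; [|exact: lapk_diff_integrable bg..].
by apply: eq_Rintegral => y _; rewrite mulrDl.
Qed.

(** The rate is [s] at the endpoint m = 0 and s + kap c at m = c y. The sign of [kap] is free, and
    for y <= 0 both sides vanish. *)
Lemma integral_window (b1 : bool) (c y kap s C : R) : 0 < c -> kap != 0 -> 0 <= C ->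
  (\int[mu]_m (if (m : R) \in Interval (BRight 0) (BSide b1 (c * y))
    then expR (- kap * m - s * y) * C else 0)%:E
   = (lapk_diff (C / kap) s (s + kap * c) y)%:E)%E.
Proof.
move=> c0 k0 C0; have [y0|y0] := ltP 0 y; last first.
  rewrite integral0_eq => [|m _].
    congr EFin; rewrite /lapk_diff /lapk; case: ifPn => [y0'|_]; last by rewrite subrr mulr0.
    by rewrite (le_anti (introT andP (conj y0 y0'))) !mulr0 subrr mulr0.
  rewrite in_itv; case: ifPn => // /andP[/= m0 /lteifW mc]; exfalso.
  have : c * y <= 0 by rewrite pmulr_rle0.
  by move=> /(le_trans mc); rewrite leNgt m0.
have k0' : - kap != 0 by rewrite oppr_eq0.
transitivity (\int[mu]_m ((expR (- (s * y)) * C)%:E *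
  (if (m : R) \in Interval (BRight 0) (BSide b1 (c * y)) then expR (- kap * m) else 0)%:E))%E.
  apply: eq_integral => m _; rewrite -EFinM; congr EFin; case: ifP => _; last by rewrite mulr0.
  by rewrite mulrAC -expRD addrC.
rewrite ge0_integralZl//; first last.
- by rewrite lee_fin mulr_ge0 ?expR_ge0.
- by move=> m _; rewrite lee_fin; case: ifP => _; rewrite ?expR_ge0.
- apply/measurable_EFinP; apply: measurable_fun_ifT => //; last first.
    by apply: measurableT_comp; [exact: measurable_expR|exact: measurable_funM].
  under eq_fun do rewrite in_itv/=.
  by apply: measurable_and; [|case: b1 => /=];
    [exact: measurable_fun_ltr|exact: measurable_fun_ltr|exact: measurable_fun_ler].
rewrite integral_expR_itv ?mulr_ge0 ?ltW// -EFinM; congr EFin.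
rewrite /lapk_diff /lapk (ltW y0) mulr0 expR0.
rewrite (_ : - (s + kap * c) * y = - (s * y) + - kap * (c * y)); last by ring.
by rewrite expRD (_ : - s * y = - (s * y)); [field|rewrite mulNr].
Qed.

End laplace_difference.

(** * Explicit densities on the sides *)

Section side_densities.
Context (R : realType).
Local Notation mu := (@lebesgue_measure R).
Variables (s1 s2 a b r1 r2 : R).
Hypotheses (s1_gt0 : 0 < s1) (s2_gt0 : 0 < s2) (a_ge0 : 0 <= a) (b_ge0 : 0 <= b).
Hypotheses (r1_gt0 : 0 < r1) (r2_gt0 : 0 < r2) (r12 : 1 < r1 * r2).
Local Notation N := (1 + s1 * a + s2 * b).
Local Notation A := (r1 * a - b).
Local Notation B := (r2 * b - a).
Local Notation rho := (r2 / (r1 * r2 - 1)).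
Local Notation density := (side_density s1 s2 a b r1 r2).
Local Notation E := (shock s1 s2 a b).

Let r12' : 0 < r1 * r2 - 1. Proof. by rewrite subr_gt0. Qed.
Let N_gt0 : 0 < N. Proof. by rewrite -addrA ltr_pwDl// addr_ge0// mulr_ge0// ltW. Qed.
Let rho_gt0 : 0 < rho. Proof. exact: divr_gt0. Qed.

(** Origin of [rho]: the side condition reads m (r1 r2 - 1) < r2 y. *)
Lemma side_window y m : (- m < Num.min (r2 * (y - r1 * m)) 0) = (0 < m) && (m < rho * y).
Proof.
rewrite lt_min andbC oppr_lt0; congr (_ && _).
rewrite mulrAC ltr_pdivlMr// -subr_gt0 -[RHS]subr_gt0; congr (0 < _); ring.
Qed.

(** The start (j a - m, y + j b - r1 m) lies in the quadrant exactly for the sizes [j] from some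
    threshold [t] on, and the integrand decays in [j] at rate [N]. *)
Lemma side_density_tail y m t :
  (0 < m -> m < rho * y -> forall j,
    [&& 0 <= j, 0 <= j * a - m & 0 <= y + (j * b - r1 * m)] = (t <= j)) ->
  (\int[mu]_j (density y m j)%:E = (if (0 < m) && (m < rho * y)
    then expR ((s1 + s2 * r1) * m - s2 * y - N * t) * N^-1 else 0)%:E)%E.
Proof.
rewrite /side_density side_window; case: ifPn => [/andP[m0 my] /(_ m0 my) tP|_ _]; last first.
  by rewrite integral0.
pose c := expR ((s1 + s2 * r1) * m - s2 * y).
transitivity (\int[mu]_j (c%:E * (if t <= j then expR (- N * j) else 0)%:E))%E.
  apply: eq_integral => j _; rewrite -EFinM; congr EFin.
  rewrite -tP /lapk; case: ifP => _ /=; last by rewrite mul0r mulr0.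
  case: ifP => _ /=; last by rewrite mul0r !mulr0.
  case: ifP => _ /=; last by rewrite !mulr0.
  by rewrite /c -!expRD; congr expR; ring.
rewrite ge0_integralZl//; first last.
- by rewrite lee_fin expR_ge0.
- by move=> j _; rewrite lee_fin; case: ifP => _; rewrite ?expR_ge0.
- apply/measurable_EFinP; apply: measurable_fun_ifT => //.
    exact: measurable_fun_ler.
  by apply: measurableT_comp; [exact: measurable_expR|exact: measurable_funM].
rewrite integral_expR_tail// -EFinM; congr EFin.
by rewrite mulrA -expRD mulNr.
Qed.

Lemma side_density_eq0 y m : (0 < m -> m < rho * y -> forall j,
    [&& 0 <= j, 0 <= j * a - m & 0 <= y + (j * b - r1 * m)] = false) ->
  (\int[mu]_j (density y m j)%:E = 0)%E.
Proof.
move=> H; apply: integral0_eq => j _; congr EFin.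
rewrite /side_density side_window; case: ifP => // /andP[m0 my].
move: (H m0 my j); rewrite /lapk; case: ifP => _ /=; last by rewrite mul0r.
case: ifP => _ /=; last by rewrite mul0r mulr0.
by move=> ->; rewrite !mulr0.
Qed.

Lemma shock_side1_wint (k : R -> R) g : bounded_by 1 g ->
  (forall y, \int[mu]_m \int[mu]_j (density y m j)%:E = (k y)%:E)%E ->
  E (side1 r1 r2 g) = wint mu k g.
Proof.
move=> bg kE; rewrite -[LHS]/(fine (E (side1 r1 r2 g))%:E) shock_side1//.
rewrite /wint /Rintegral; congr fine; apply: eq_integral => y _.
by rewrite kE -EFinM mulrC.
Qed.

(** Without a jump of the first component, that coordinate stays nonnegative and this side is never
    reached. *)
Lemma shock_side1_no_first g : a = 0 -> bounded_by 1 g -> E (side1 r1 r2 g) = 0.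
Proof.
move=> a0 bg; rewrite (@shock_side1_wint (fun=> 0) _ bg).
  by rewrite /wint /Rintegral integral0_eq// => y _; rewrite mul0r.
move=> y; apply: integral0_eq => m _; apply: side_density_eq0 => m0 _ j.
by rewrite a0 mulr0 sub0r oppr_ge0 (leNgt m) m0 andbF.
Qed.

Section first_component_jumps.
Hypothesis a_gt0 : 0 < a.
Local Notation kap := ((1 - A * s2) / a).
Hypothesis kap_neq0 : 1 - A * s2 != 0.

Let kap0 : kap != 0. Proof. by rewrite mulf_neq0// invr_eq0 gt_eqF. Qed.

(** Origin of [kap]: the decay rate in [m] when the threshold for [j] is m / a, that is, when the
    first coordinate of the start is the binding one. *)
Let expE y m : (s1 + s2 * r1) * m - s2 * y - N * (m / a) = - kap * m - s2 * y.
Proof. by field; rewrite gt_eqF. Qed.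

(** The second coordinate does not jump, so it must already satisfy y >= r1 m at the start. This
    window m <= y / r1 is narrower than m < rho y and replaces it. *)
Lemma shock_side1_only_first g : b = 0 -> bounded_by 1 g ->
  E (side1 r1 r2 g) = laplace_diff (N^-1 / kap) s2 (1 / (r1 * a)) g.
Proof.
move=> b0 bg; have s0 : 0 < 1 / (r1 * a) by rewrite divr_gt0// mulr_gt0.
rewrite -(wint_lapk_diff _ s2_gt0 s0 bg); apply: shock_side1_wint => // y.
have -> : 1 / (r1 * a) = s2 + kap * r1^-1 by rewrite b0; field; rewrite !gt_eqF.
have N0 : 0 <= N^-1 by rewrite invr_ge0 ltW.
have r10 : 0 < r1^-1 by rewrite invr_gt0.
rewrite -(integral_window false y s2 r10 kap0 N0); apply: eq_integral => m _.
rewrite in_itv/=; have [m0|m0] /= := ltP 0 m; last first.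
  by apply: side_density_eq0; rewrite ltNge m0.
rewrite (mulrC r1^-1) ler_pdivlMr//; case: ifPn => my; last first.
  apply: side_density_eq0 => _ _ j; rewrite b0 mulr0 sub0r (subr_ge0 (r1 * m)) (mulrC r1).
  by rewrite (negbTE my) !andbF.
have y0 : 0 < y by apply: lt_le_trans my; rewrite mulr_gt0.
rewrite (side_density_tail (t := m / a)).
  rewrite m0 /= expE ifT// mulrAC ltr_pdivlMr//.
  have : m * r1 * r2 <= y * r2 by rewrite ler_wpM2r// ltW.
  by move: m0; lra.
move=> _ _ j; rewrite b0 mulr0 sub0r (subr_ge0 (r1 * m)) (mulrC r1) my andbT subr_ge0 ler_pdivrMr//.
have [mj|] := boolP (m <= j * a); last by rewrite andbF.
rewrite andbT; have : 0 < j * a by exact: lt_le_trans mj.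
by rewrite pmulr_lgt0// => /ltW ->.
Qed.

Section both_components.
Hypothesis b_gt0 : 0 < b.

(** The start is in the quadrant iff j >= m / a and j >= (r1 m - y) / b; the sign of A m - a y tells
    which threshold is the larger. *)
Lemma side_time_first y m : 0 < m -> A * m <= a * y -> forall j,
  [&& 0 <= j, 0 <= j * a - m & 0 <= y + (j * b - r1 * m)] = (m / a <= j).
Proof.
move=> m0 Am j; rewrite subr_ge0 ler_pdivrMr//.
have [mj|] := boolP (m <= j * a); last by rewrite andbF.
have : 0 < j * a by exact: lt_le_trans mj.
rewrite pmulr_lgt0// => j0; rewrite (ltW j0) /=.
have : 0 <= a * (y + (j * b - r1 * m)).
  have : b * m <= b * (j * a) by rewrite ler_wpM2l.
  by move: Am; lra.
by rewrite pmulr_rge0.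
Qed.

Lemma side_time_second y m : 0 < m -> a * y <= A * m -> forall j,
  [&& 0 <= j, 0 <= j * a - m & 0 <= y + (j * b - r1 * m)] = ((r1 * m - y) / b <= j).
Proof.
move=> m0 Am j; rewrite ler_pdivrMr//.
have -> : (0 <= y + (j * b - r1 * m)) = (r1 * m - y <= j * b).
  by rewrite -[RHS]subr_ge0; congr (0 <= _); ring.
have [mj|] := boolP (r1 * m - y <= j * b); last by rewrite !andbF.
have jm : 0 <= j * a - m.
  have : 0 <= b * (j * a - m).
    have : a * (r1 * m - y) <= a * (j * b) by rewrite ler_wpM2l.
    by move: Am; lra.
  by rewrite pmulr_rge0.
have : 0 < j * a by rewrite (lt_le_trans m0)// -subr_ge0.
by rewrite pmulr_lgt0// => /ltW ->; rewrite jm.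
Qed.

Lemma shock_side1_single g : 0 < s2 + kap * rho ->
  (forall y m, 0 < m -> m < rho * y -> A * m <= a * y) ->
  bounded_by 1 g ->
  E (side1 r1 r2 g) = laplace_diff (N^-1 / kap) s2 (s2 + kap * rho) g.
Proof.
move=> s0 Am bg.
rewrite -(wint_lapk_diff _ s2_gt0 s0 bg); apply: shock_side1_wint => // y.
have N0 : 0 <= N^-1 by rewrite invr_ge0 ltW.
rewrite -(integral_window true y s2 rho_gt0 kap0 N0); apply: eq_integral => m _.
rewrite (side_density_tail (t := m / a)) ?expE ?in_itv//.
by move=> m0 my; apply: side_time_first => //; exact: Am.
Qed.

(** The binding coordinate changes at m = (a / A) y, inside the window. There both exponentials
    equal exp(- y / A), which is why the rate 1 / A ends the first difference and begins the
    second. *)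
Lemma shock_side1_double g : 0 < A -> B <= 0 -> bounded_by 1 g ->
  E (side1 r1 r2 g) = laplace_diff (N^-1 / kap) s2 (1 / A) g
    + laplace_diff (N^-1 / ((r1 + A * s1) / b)) (1 / A) ((1 - B * s1) / ((r1 * r2 - 1) * b)) g.
Proof.
move=> A0 B0 bg.
have A1 : 0 < 1 / A by rewrite divr_gt0.
have BB : 0 < (1 - B * s1) / ((r1 * r2 - 1) * b).
  by rewrite divr_gt0 ?mulr_gt0// subr_gt0 (le_lt_trans _ ltr01)// mulr_le0_ge0// ltW.
rewrite -(wint_lapk_diffD _ _ s2_gt0 A1 A1 BB bg).
apply: shock_side1_wint => // y.
have N0 : 0 <= N^-1 by rewrite invr_ge0 ltW.
have aA : 0 < a / A by rewrite divr_gt0.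
have -> : lapk_diff (N^-1 / kap) s2 (1 / A) y = lapk_diff (N^-1 / kap) s2 (s2 + kap * (a / A)) y.
  by congr (lapk_diff _ _ _); field; rewrite !gt_eqF.
rewrite EFinD -(integral_window true y s2 aA kap0 N0).
(* The decay rate in [m] once the second coordinate binds, with threshold (r1 m - y) / b; the
   remaining factor is then the exponential of (1 + s1 a) y / b. *)
set k2 := (r1 + A * s1) / b.
have k20 : 0 < k2 by rewrite divr_gt0// addr_gt0// mulr_gt0.
have N0' : 0 < N^-1 by rewrite invr_gt0.
(* Clearing denominators, this is the condition B <= 0. *)
have aArho : a / A <= rho.
  rewrite ler_pdivrMr// mulrAC ler_pdivlMr//; move: B0; lra.
have [y0|y0] := leP y 0.
  have y0' c : 0 < c -> c * y <= 0 by move=> c0; rewrite pmulr_rle0.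
  rewrite integral0_eq; last first.
    move=> m _; apply: side_density_eq0 => m0 my.
    by have := lt_trans m0 my; rewrite ltNge y0'.
  rewrite integral0_eq; last first.
    move=> m _; rewrite in_itv/=; case: ifP => // /andP[m0 my].
    by have := lt_trans m0 my; rewrite ltNge y0'.
  rewrite add0e; congr EFin; rewrite /lapk_diff /lapk; case: ifPn => [y1|_]; last by rewrite subrr mulr0.
  by rewrite (le_anti (introT andP (conj y0 y1))) !mulr0 subrr mulr0.
have -> : lapk_diff (N^-1 / k2) (1 / A) ((1 - B * s1) / ((r1 * r2 - 1) * b)) y =
    expR ((1 + s1 * a) / b * y) * N^-1 *
      ((expR (- k2 * (rho * y)) - expR (- k2 * (a / A * y))) / - k2).
  rewrite /lapk_diff /lapk (ltW y0).
  rewrite (_ : - (1 / A) * y = (1 + s1 * a) / b * y + - k2 * (a / A * y)); last first.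
    by rewrite /k2; field; rewrite !gt_eqF.
  rewrite (_ : - ((1 - B * s1) / ((r1 * r2 - 1) * b)) * y =
    (1 + s1 * a) / b * y + - k2 * (rho * y)); last first.
    by rewrite /k2; field; rewrite !gt_eqF.
  by rewrite !expRD; field; rewrite !gt_eqF.
have k2n : - k2 != 0 by rewrite oppr_eq0 gt_eqF.
have aAy : a / A * y <= rho * y by rewrite ler_wpM2r// ltW.
rewrite EFinM -(integral_expR_itv true true k2n aAy).
have mI c : measurable_fun setT (fun m : R => expR (c * m)).
  by apply: measurableT_comp; [exact: measurable_expR|exact: measurable_funM].
have mitv b0 b1 (x z : R) : measurable_fun setT (fun m : R => m \in Interval (BSide b0 x) (BSide b1 z)).
  under eq_fun do rewrite in_itv/=.
  by apply: measurable_and; [case: b0|case: b1]; move=> /=;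
    [exact: measurable_fun_ler|exact: measurable_fun_ltr|
     exact: measurable_fun_ltr|exact: measurable_fun_ler].
rewrite -ge0_integralZl//; first last.
- by rewrite lee_fin mulr_ge0 ?expR_ge0.
- by move=> m _; rewrite lee_fin; case: ifP => _; rewrite ?expR_ge0.
- by apply/measurable_EFinP; apply: measurable_fun_ifT; [exact: mitv|exact: mI|exact: measurable_cst].
rewrite -ge0_integralD//; first last.
- apply: measurable_funeM.
  by apply/measurable_EFinP; apply: measurable_fun_ifT; [exact: mitv|exact: mI|exact: measurable_cst].
- by move=> m _; rewrite -EFinM lee_fin !mulr_ge0 ?expR_ge0//; case: ifP => _; rewrite ?expR_ge0.
- apply/measurable_EFinP; apply: measurable_fun_ifT => //; first exact: mitv.
  apply: measurable_funM => //; apply: measurableT_comp; first exact: measurable_expR.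
  by apply: measurable_funB => //; exact: measurable_funM.
- by move=> m _; rewrite lee_fin; case: ifP => _; rewrite ?mulr_ge0 ?expR_ge0.
apply: eq_integral => m _; rewrite !in_itv/= -EFinM.
have aAE : (m < a / A * y) = (A * m < a * y).
  by rewrite mulrAC ltr_pdivlMr// (mulrC m).
have [m0|m0] /= := ltP 0 m; last first.
  rewrite side_density_eq0; last by rewrite ltNge m0.
  rewrite ifF ?mulr0 ?adde0//; apply/negbTE; rewrite negb_and -ltNge.
  by rewrite (le_lt_trans m0)// mulr_gt0.
case: ifPn => my.
  rewrite (leNgt _ m) my /= mulr0 adde0 (side_density_tail (t := m / a)).
    by rewrite m0 (lt_le_trans my aAy) expE.
  by move=> _ _; apply: side_time_first => //; rewrite ltW// -aAE.
rewrite leNgt my /= add0e (side_density_tail (t := (r1 * m - y) / b)); last first.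
  by move=> _ _; apply: side_time_second => //; rewrite leNgt -aAE.
rewrite m0 /=; case: ifP => _; last by rewrite mulr0.
rewrite mulrAC -expRD; congr (expR _ * _)%:E.
by rewrite /k2; field; rewrite !gt_eqF.
Qed.

End both_components.
End first_component_jumps.
End side_densities.

Section explicit_sides.
Context (R : realType).
Local Notation mu := (@lebesgue_measure R).
Variables (s1 s2 a b r1 r2 : R).
Hypotheses (s1_gt0 : 0 < s1) (s2_gt0 : 0 < s2) (r1_gt0 : 0 < r1) (r2_gt0 : 0 < r2).
Hypothesis r12 : 1 < r1 * r2.
Local Notation A := (r1 * a - b).
Local Notation B := (r2 * b - a).
Local Notation N := (1 + s1 * a + s2 * b).

Let r12' : 0 < r1 * r2 - 1. Proof. by rewrite subr_gt0. Qed.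

Lemma shock_side2 g : bounded_by 1 g ->
  shock s1 s2 a b (side2 r1 r2 g) = shock s2 s1 b a (side1 r2 r1 g).
Proof.
move=> bg; rewrite (shock_swap a b s1_gt0 s2_gt0 (bounded_side2 r1 r2 ler01 bg)).
by congr (shock _ _ _ _ _); apply/funext => -[x y].
Qed.

(** For B > 0 the first coordinate binds on the whole window, whatever the sign of [A]: the point m
    = (a / A) y is beyond rho y, or A <= 0 and there is no change at all. *)
Lemma shock_side1_positive g : 0 < a -> 0 < b -> 0 < B -> 1 - A * s2 != 0 -> bounded_by 1 g ->
  shock s1 s2 a b (side1 r1 r2 g) =
  laplace_diff (a / (N * (1 - A * s2))) s2 ((r2 + B * s2) / ((r1 * r2 - 1) * a)) g.
Proof.
move=> a0 b0 B0 A1 bg; have N0 : 0 < N by rewrite -addrA ltr_pwDl// addr_ge0// mulr_ge0// ltW.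
have sE : s2 + (1 - A * s2) / a * (r2 / (r1 * r2 - 1)) = (r2 + B * s2) / ((r1 * r2 - 1) * a).
  by field; rewrite !gt_eqF.
have s0 : 0 < s2 + (1 - A * s2) / a * (r2 / (r1 * r2 - 1)).
  by rewrite sE divr_gt0 ?mulr_gt0// addr_gt0// mulr_gt0.
have Am y m : 0 < m -> m < r2 / (r1 * r2 - 1) * y -> A * m <= a * y.
  move=> m0; rewrite mulrAC ltr_pdivlMr// => my.
  have H1 : 0 <= m * B by rewrite mulr_ge0// ltW.
  have H2 : a * (m * (r1 * r2 - 1)) <= a * (r2 * y) by rewrite ler_pM2l// ltW.
  by rewrite -(ler_pM2l r2_gt0); lra.
rewrite (shock_side1_single s1_gt0 s2_gt0 (ltW a0) (ltW b0) r2_gt0 r12 a0 A1 s0 Am bg).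
by rewrite sE; congr (laplace_diff _ _ _ _); field; rewrite A1 !gt_eqF.
Qed.

Lemma shock_side1_nonpositive g : 0 < a -> 0 < b -> 0 < A -> B <= 0 ->
  1 - A * s2 != 0 -> bounded_by 1 g ->
  shock s1 s2 a b (side1 r1 r2 g) =
  laplace_diff (a / (N * (1 - A * s2))) s2 (1 / A) g
  + laplace_diff (b / (N * (r1 + A * s1))) (1 / A) ((1 - B * s1) / ((r1 * r2 - 1) * b)) g.
Proof.
move=> a0 b0 A0 B0 A1 bg; have N0 : 0 < N by rewrite -addrA ltr_pwDl// addr_ge0// mulr_ge0// ltW.
have rA : 0 < r1 + A * s1 by rewrite addr_gt0// mulr_gt0.
rewrite (shock_side1_double s1_gt0 s2_gt0 (ltW a0) (ltW b0) r1_gt0 r2_gt0 r12 a0 A1 b0)//.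
congr (laplace_diff _ _ _ _ + laplace_diff _ _ _ _).
  by field; rewrite A1 !gt_eqF.
by field; rewrite !gt_eqF.
Qed.

End explicit_sides.

(** * Shocks hitting one component only *)

Section single_component_shocks.
Context (R : realType).
Local Notation mu := (@lebesgue_measure R).
Variables (s1 s2 r1 r2 a : R).
Hypotheses (s1_gt0 : 0 < s1) (s2_gt0 : 0 < s2) (r1_gt0 : 0 < r1) (r2_gt0 : 0 < r2).
Hypotheses (r12 : 1 < r1 * r2) (a_gt0 : 0 < a).

Let wint1 s : 0 < s -> wint mu (lapk s) (fun=> 1) = s^-1.
Proof. by move=> s0; rewrite (wint_cst (weight_lapk s0) ler01) mass_lapk// mul1r. Qed.

(** The second coordinate stays nonnegative, so the cone sent to the origin carries no mass; here
    this appears as the side accounting for all the mass outside the quadrant. *)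
Lemma shock_expansion_first f : 1 - r1 * a * s2 != 0 -> bounded_by 1 f ->
  shock s1 s2 a 0 (fun x => f (reflect_point r1 r2 x)) =
  double_laplace s1 s2 f / (1 + s1 * a)
  + laplace_diff (a / ((1 + s1 * a) * (1 - r1 * a * s2))) s2 (1 / (r1 * a)) (fun v => f (0, v)).
Proof.
move=> A1 bf; have N0 : 0 < 1 + s1 * a by rewrite ltr_wpDr// mulr_ge0// ltW.
have A1' : 1 - (r1 * a - 0) * s2 != 0 by rewrite subr0.
have D1 g : bounded_by 1 g -> shock s1 s2 a 0 (side1 r1 r2 g) =
    laplace_diff (a / ((1 + s1 * a) * (1 - r1 * a * s2))) s2 (1 / (r1 * a)) g.
  move=> bg.
  rewrite (shock_side1_only_first s1_gt0 s2_gt0 (ltW a_gt0) (lexx 0) r1_gt0 r2_gt0 r12 a_gt0 A1' erefl bg).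
  by congr (laplace_diff _ _ _ _); field; rewrite A1 !gt_eqF.
have D2 g : bounded_by 1 g -> shock s1 s2 a 0 (side2 r1 r2 g) = 0.
  by move=> bg; rewrite shock_side2//; apply: shock_side1_no_first => //; rewrite mulrC.
rewrite (shock_expansion s1_gt0 s2_gt0 (ltW a_gt0) (lexx 0) r1_gt0 r2_gt0 r12 bf D1 D2).
rewrite mulr0 !addr0 subr0; set D := laplace_diff _ _ _ (fun=> 1).
suff -> : D = (1 - (1 + s1 * a)^-1) / (s1 * s2) by rewrite subrr mulr0 addr0.
rewrite /D /laplace_diff !wint1 ?divr_gt0 ?mulr_gt0//.
by field; rewrite A1 !gt_eqF.
Qed.

Lemma shock_expansion_second f : 1 - r2 * a * s1 != 0 -> bounded_by 1 f ->
  shock s1 s2 0 a (fun x => f (reflect_point r1 r2 x)) =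
  double_laplace s1 s2 f / (1 + s2 * a)
  + laplace_diff (a / ((1 + s2 * a) * (1 - r2 * a * s1))) s1 (1 / (r2 * a)) (fun u => f (u, 0)).
Proof.
move=> A1 bf; have N0 : 0 < 1 + s2 * a by rewrite ltr_wpDr// mulr_ge0// ltW.
have r21 : 1 < r2 * r1 by rewrite mulrC.
have A1' : 1 - (r2 * a - 0) * s1 != 0 by rewrite subr0.
have D2 g : bounded_by 1 g -> shock s1 s2 0 a (side2 r1 r2 g) =
    laplace_diff (a / ((1 + s2 * a) * (1 - r2 * a * s1))) s1 (1 / (r2 * a)) g.
  move=> bg; rewrite shock_side2//.
  rewrite (shock_side1_only_first s2_gt0 s1_gt0 (ltW a_gt0) (lexx 0) r2_gt0 r1_gt0 r21 a_gt0 A1' erefl bg).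
  by congr (laplace_diff _ _ _ _); field; rewrite A1 !gt_eqF.
have D1 g : bounded_by 1 g -> shock s1 s2 0 a (side1 r1 r2 g) = 0.
  by move=> bg; apply: shock_side1_no_first.
rewrite (shock_expansion s1_gt0 s2_gt0 (lexx 0) (ltW a_gt0) r1_gt0 r2_gt0 r12 bf D1 D2).
rewrite mulr0 !addr0 subr0; set D := laplace_diff _ _ _ (fun=> 1).
suff -> : D = (1 - (1 + s2 * a)^-1) / (s1 * s2) by rewrite subrr mulr0 addr0.
rewrite /D /laplace_diff !wint1 ?divr_gt0 ?mulr_gt0//.
by field; rewrite A1 !gt_eqF.
Qed.

End single_component_shocks.

(** * The kernel equations *)

(** Transfers the transform from a function known only on the quadrant to a globally measurable one
    that agrees with it there. *)
Lemma laplace2E (R : realType) (s1 s2 M : R) (f : R -> R -> R) (h : R * R -> R) :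
  0 < s1 -> bounded_by M h -> (forall u v, 0 <= u -> 0 <= v -> f u v = h (u, v)) ->
  laplace2 f s1 s2 = double_laplace s1 s2 h.
Proof.
move=> s10 bh fh; rewrite /laplace2 /double_laplace -laplaceE; apply: eq_Rintegral => v.
rewrite inE/= in_itv/= andbT => v0; rewrite /wint -RintegralZl//; last first.
  exact: (wint_integrable (weight_lapk s10) (bounded_fst v bh)).
rewrite [LHS]Rintegral_mkcond; apply: eq_Rintegral => u _.
rewrite patchE mem_setE in_itv/= andbT /lapk; case: ifPn => u0; last by rewrite mul0r mulr0.
by rewrite fh// mulrA -expRD; congr (expR _ * _); ring.
Qed.

Lemma sum_ord3 (V : nmodType) (k : 'I_3 -> V) : \sum_(i < 3) k i =
  k ord0 + (k (lift ord0 ord0) + k (lift ord0 (lift ord0 ord0))).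
Proof. by rewrite !big_ord_recl big_ord0 addr0. Qed.

Lemma laplace_diff0 (R : realType) (s s' : R) g : laplace_diff 0 s s' g = 0.
Proof. by rewrite /laplace_diff mul0r. Qed.

Section escape_kernel.
Context d (T : measurableType d) (R : realType) (P : probability T R).
Variables (c1 c2 q1 q2 qb1 qb2 r1 r2 lam lam1 lam2 s1 s2 : R).
Hypotheses (c1_gt0 : 0 < c1) (c2_gt0 : 0 < c2) (s1_gt0 : 0 < s1) (s2_gt0 : 0 < s2).
Hypotheses (q1_gt0 : 0 < q1) (q2_gt0 : 0 < q2) (qb1_gt0 : 0 < qb1) (qb2_gt0 : 0 < qb2).
Hypotheses (r1_gt0 : 0 < r1) (r2_gt0 : 0 < r2) (r12 : 1 < r1 * r2).
Hypotheses (lam_ge0 : 0 <= lam) (lam1_ge0 : 0 <= lam1) (lam2_ge0 : 0 <= lam2).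
Variables (Ns : 'I_3 -> R -> T -> nat) (J : 'I_3 -> nat -> {RV P >-> R}).
Hypothesis model : shock_model lam lam1 lam2 Ns J.
Variable Y : R -> R -> T -> R -> R * R.
Hypothesis reflected : forall u v : R, 0 <= u -> 0 <= v -> forall w,
  reflected_path c1 c2 r1 r2 (free_process c1 c2 q1 q2 qb1 qb2 Ns J w) u v (Y u v w).

Local Notation mu := (@lebesgue_measure R).
Local Notation xi := (sample_path model).
Local Notation flow := (flow c1 c2 q1 q2 qb1 qb2 r1 r2).
Local Notation Lam := (lam + lam1 + lam2).
Local Notation lap2 := (double_laplace s1 s2).
Local Notation q := (escape_law c1 c2 q1 q2 qb1 qb2 r1 r2 model).
Local Notation rate := (rate lam lam1 lam2).
Local Notation sjump := (single_jump q1 q2 qb1 qb2).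
Local Notation drift := (drift c1 c2).
Local Notation part := (step_part c1 c2 q1 q2 qb1 qb2 r1 r2 model).

Let c1_ge0 : 0 <= c1. Proof. exact: ltW. Qed.
Let c2_ge0 : 0 <= c2. Proof. exact: ltW. Qed.
Let Lam_ge0 : 0 <= Lam. Proof. by rewrite !addr_ge0. Qed.

Lemma bounded_escape_law : bounded_by 1 q.
Proof. by split=> [|z]; [exact: measurable_escape_law|exact: escape_law_itv]. Qed.

Definition jump_target i (zj : (R * R) * R) : R :=
  q (reflect_point r1 r2 (zj.1 - sjump i zj.2)).

Lemma measurable_single_jump i : measurable_fun setT (sjump i).
Proof.
case: i => -[|[|[|//]]] i3; rewrite /single_jump;
under eq_fun do rewrite (tnth_nth 0)/=; apply: measurable_fun_pair => //;
exact: measurable_funM.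
Qed.

Lemma bounded_jump_target i : bounded_by 1 (jump_target i).
Proof.
split=> [|zj]; last exact: escape_law_itv.
apply: (measurableT_comp (measurable_escape_law c1 c2 q1 q2 qb1 qb2 r1 r2 model)).
apply: (measurableT_comp (measurable_reflect_point r1 r2)).
have mj : measurable_fun setT (fun zj : (R * R) * R => sjump i zj.2).
  exact: measurableT_comp (measurable_single_jump i) measurable_snd.
have mz : measurable_fun setT (fun zj : (R * R) * R => zj.1) by exact: measurable_fst.
have /measurable_fun_pairP[/= j1 j2] := mj.
have /measurable_fun_pairP[/= z1 z2] := mz.
by apply/measurable_fun_pairP; split; apply: measurable_funB.
Qed.

Section fixed_step.
Variables (h : R) (h_ge0 : 0 <= h).

Local Notation B n := (count_event Ns h n).
Local Notation ind n := (\1_(B n) : T -> R).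

Let mB n : measurable (B n). Proof. exact: (measurable_count_event model h_ge0 n). Qed.

Lemma weight_ind n : weight P (ind n).
Proof.
split=> [|w|]; first exact: measurable_indic.
  by rewrite indicE.
by rewrite integral_indic// setIT (le_lt_trans (probability_le1 P (mB n)))// ltry.
Qed.

Lemma mass_ind n : mass P (ind n) = fine (P (B n)).
Proof. by rewrite /mass /Rintegral integral_indic// setIT. Qed.

Lemma bounded_flow : bounded_by 1 (fun zw : (R * R) * T => q (flow (xi zw.2) h zw.1)).
Proof.
split=> [|zw]; last exact: escape_law_itv.
exact: measurable_escape_flow.
Qed.

Lemma step_partE n z : part h n z = wint P (ind n) (fun w => q (flow (xi w) h z)).
Proof.
rewrite /step_part /wint -[LHS]/(\int[P]_(w in B n) _) Rintegral_mkcond.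
apply: eq_Rintegral => w _; rewrite patchE indicE.
by case: ifPn => _; rewrite ?mul1r// mul0r.
Qed.

Lemma bounded_step_part n : bounded_by 1 (part h n).
Proof.
have := wint_bounded1 (m2 := P) (weight_ind n) bounded_flow.
rewrite mass_ind mul1r => bs; rewrite (_ : part h n = (fun z => wint P (ind n)
  (fun w => q (flow (xi w) h z)))); last by apply/funext => z; rewrite step_partE.
apply: bounded_byW bs; rewrite -lee_fin fineK ?fin_num_measure//.
exact: probability_le1.
Qed.

Lemma lap2_step_part n : lap2 (part h n) =
  wint P (ind n) (fun w => lap2 (fun z => q (flow (xi w) h z))).
Proof.
rewrite -(lap2_wint s1_gt0 s2_gt0 bounded_flow (weight_ind n)).
by apply: lap2_eq => z _; rewrite step_partE.
Qed.

Lemma lap2_step_no_jump : lap2 (part h (fun=> 0%N)) =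
  expR (- (Lam * h)) * lap2 (fun z => q (z + drift h)).
Proof.
rewrite -(lap2Z s1_gt0 s2_gt0 (expR_ge0 _) (bounded_shift (c1 * h) (c2 * h) bounded_escape_law)).
apply: lap2_eq => z Qz; exact: step_part_no_jump.
Qed.

(** The drift after the shock is handled by the Lipschitz bound, since the reflected point is in the
    quadrant. The drift before it cannot be, as it precedes the reflection; it is a translation of
    the starting point, which [lap2_shift_close] controls for any bounded function. *)
Lemma lap2_flow_close i w : (forall j, Ns j h w = unit_count i j) ->
  `|lap2 (fun z => q (flow (xi w) h z)) - lap2 (fun z => jump_target i (z, J i 0%N w))|
    <= (Lam / (s1 * s2) + (c2 / s1 + c1 / s2)) * h.
Proof.
move=> wi; have w0 j : count (xi w) j 0 = 0%N by exact: (poisson_start (shock_poisson model j)).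
have [s /andP[s0 sh] flowE] := @flow_one_jump R c1 c2 q1 q2 qb1 qb2 r1 r2
  c1_ge0 c2_ge0 r1_gt0 r2_gt0 r12 (xi w) h i h_ge0 w0 wi.
have bj : bounded_by 1 (fun z => jump_target i (z, J i 0%N w)).
  exact: (bounded_by_pair2 (bounded_jump_target i)).
have bjs := bounded_shift (c1 * s) (c2 * s) bj.
have bf : bounded_by 1 (fun z => q (flow (xi w) h z)) := bounded_by_pair2 bounded_flow w.
have hs0 : 0 <= h - s by rewrite subr_ge0.
have close1 := @lap2_dist R s1 s2 s1_gt0 s2_gt0 1 (Lam * h) _ _ bf bjs.
have {}close1 := close1 (mulr_ge0 Lam_ge0 h_ge0).
have {}close1 : `|lap2 (fun z => q (flow (xi w) h z))
    - lap2 (fun z => jump_target i (z + (c1 * s, c2 * s), J i 0%N w))|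
    <= Lam * h / (s1 * s2).
  apply: close1 => z Qz; rewrite flowE.
  apply: (@le_trans _ _ (Lam * (h - s))); last first.
    by rewrite ler_wpM2l// lerBlDr lerDl.
  exact: (escape_law_lipschitz c1_ge0 c2_ge0 r1_gt0 r2_gt0 r12 lam_ge0 lam1_ge0
    lam2_ge0 model reflected (reflect_point_quadrant r1_gt0 r2_gt0 r12
    (z + drift s - sjump i (J i 0%N w))) hs0).
have cs1 : 0 <= c1 * s by rewrite mulr_ge0.
have cs2 : 0 <= c2 * s by rewrite mulr_ge0.
have close2 := lap2_shift_close s1_gt0 s2_gt0 cs1 cs2 bj.
rewrite mul1r in close2.
have {}close2 : `|lap2 (fun z => jump_target i (z, J i 0%N w))
    - lap2 (fun z => jump_target i (z + (c1 * s, c2 * s), J i 0%N w))|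
    <= (c2 / s1 + c1 / s2) * h.
  apply: (le_trans close2); rewrite (_ : c2 * s / s1 + c1 * s / s2 = (c2 / s1 + c1 / s2) * s); last first.
    by field; rewrite !gt_eqF.
  by rewrite ler_wpM2l// addr_ge0// divr_ge0// ltW.
rewrite -(subrKA (lap2 (fun z => jump_target i (z + (c1 * s, c2 * s), J i 0%N w)))).
apply: (le_trans (ler_normD _ _)); rewrite mulrDl; apply: lerD.
  by apply: le_trans close1 _; rewrite mulrAC.
by rewrite distrC.
Qed.

Definition jump_laplace i (j : R) : R := lap2 (fun z => jump_target i (z, j)).

Lemma bounded_jump_laplace i : bounded_by (s1^-1 / s2) (jump_laplace i).
Proof.
by have := lap2_bounded s1_gt0 s2_gt0 (bounded_jump_target i); rewrite div1r.
Qed.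

Lemma one_jump_size_law i (U : set R) : measurable U ->
  P (B (unit_count i) `&` (J i 0%N @^-1` U)) =
  (P (B (unit_count i)) * exponential_prob 1%R U)%E.
Proof.
move=> mU; pose A j := [set w | Ns j h w = unit_count i j].
pose V j (k : nat) : set R := if (j == i) && (k == 0%N) then U else setT.
have sA j : sigma_process (Ns j) (A j).
  have -> : A j = [set w | forall a, a \in [:: (h, [set unit_count i j])] -> a.2 (Ns j (id a.1) w)].
    apply/seteqP; split=> w /= H; first by move=> a; rewrite inE => /eqP ->.
    exact: (H (h, [set unit_count i j]) (mem_head _ _)).
  by apply: (@sigma_process_constraints _ _ _ Ns j _ id) => a; rewrite inE => /eqP ->.
have mV j k : measurable (V j k) by rewrite /V; case: ifP.
have BE : B (unit_count i) = \bigcap_j A j.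
  by apply/seteqP; split=> w H j => [_|]; [exact: H|exact: (H j I)].
(* With no size the product gives the probability of the counts alone; with one size of each kind it
   adds the law of the only constrained one. *)
have := indep_product model 0%N sA mV.
rewrite (_ : [set w | _] = setT); last by apply/seteqP; split.
rewrite setIT [X in (_ * X)%E]big1 ?mule1; last by move=> j _; rewrite big_nil.
rewrite BE => ->.
have := indep_product model 1%N sA mV.
under [X in (_ * X)%E]eq_bigr do rewrite big_nat1.
rewrite [X in (_ * X)%E](bigD1 i)//= [X in (_ * (_ * X))%E]big1 ?mule1; last first.
  by move=> j /negbTE ji; rewrite /V ji/= probability_setT.
rewrite {2}/V !eqxx/= => <-; congr (P _); apply/seteqP; split=> w [wA].
  by move=> wU; split=> // j [|//] _; rewrite /V; case: ifPn => // /andP[/eqP ->].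
by move=> /(_ i 0%N isT); rewrite /V !eqxx; split.
Qed.

Lemma wint_jump_laplace i : wint P (ind (unit_count i)) (fun w => jump_laplace i (J i 0%N w)) =
  fine (P (B (unit_count i))) * wint mu (lapk 1) (jump_laplace i).
Proof.
have bH := bounded_jump_laplace i; have [mH H0] := bH.
have H0' x : 0 <= jump_laplace i x by case/andP: (H0 x).
have PB : P (B (unit_count i)) \is a fin_num by exact: fin_num_measure.
have mJ := @measurable_funPT _ _ _ _ (J i 0%N).
have bHJ : bounded_by (s1^-1 / s2) (fun w => jump_laplace i (J i 0%N w)).
  split; last by move=> w; exact: H0.
  by apply: (measurableT_comp mH); exact: mJ.
apply: EFin_inj.
rewrite (wintE (weight_ind (unit_count i)) bHJ).
rewrite [RHS]EFinM (fineK PB).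
rewrite (wintE (weight_lapk ltr01) bH) -(integral_exponential_prob bH).
pose r : {nonneg R} := NngNum (fine_ge0 (measure_ge0 P (B (unit_count i)))).
have rE : P (B (unit_count i)) = r%:num%:E by rewrite fineK.
transitivity (\int[mrestr P (mB (unit_count i))]_w (jump_laplace i (J i 0%N w))%:E)%E.
  rewrite ge0_integral_mrestr//.
    rewrite [RHS]integral_mkcond; apply: eq_integral => w _.
    by rewrite patchE indicE; case: ifP => _; rewrite ?mul1r// mul0r.
    by apply/measurable_EFinP; case: bHJ.
  by move=> w; rewrite lee_fin.
have mJ' : measurable_fun setT (J i 0%N : T -> measurableTypeR R) by exact: mJ.
pose m1 : {measure set (measurableTypeR R) -> \bar R} :=
  measure_function_pushforward__canonical__measure_function_Measure
    (mrestr P (mB (unit_count i))) mJ'.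
transitivity (\int[m1]_x (jump_laplace i x)%:E)%E.
  transitivity (\int[pushforward (mrestr P (mB (unit_count i)))
    (J i 0%N : T -> measurableTypeR R)]_x (jump_laplace i x)%:E)%E; last by [].
  rewrite ge0_integral_pushforward//; first exact/measurable_EFinP.
  by move=> x _; rewrite lee_fin.
pose ex : probability (measurableTypeR R) R :=
  exponential_distribution_exponential_prob__canonical__probability_measure_Probability
    (ltr01 : 0 < (1 : R)).
transitivity (r%:num%:E * \int[ex]_x (jump_laplace i x)%:E)%E; last by rewrite -rE.
rewrite -(@ge0_integral_mscale _ _ _ ex setT measurableT r (EFin \o jump_laplace i)); first last.
- by move=> x _; rewrite lee_fin.
- exact/measurable_EFinP.
pose m2 : {measure set (measurableTypeR R) -> \bar R} := mscale r ex.
rewrite -[RHS]/(\int[m2]_x (jump_laplace i x)%:E)%E.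
apply: eq_measure_integral => U mU _; rewrite /= /mscale/= -rE.
rewrite -(one_jump_size_law i mU) setIC //.
Qed.

Lemma one_jump_close i : `|lap2 (part h (unit_count i))
    - rate i * h * expR (- (Lam * h)) * wint mu (lapk 1) (jump_laplace i)|
  <= (Lam / (s1 * s2) + (c2 / s1 + c1 / s2)) * h * (rate i * h).
Proof.
have PBE : fine (P (B (unit_count i))) = rate i * h * expR (- (Lam * h)).
  by rewrite (one_jump_prob lam_ge0 lam1_ge0 lam2_ge0 model).
rewrite lap2_step_part -PBE -wint_jump_laplace.
have b1 := lap2_bounded s1_gt0 s2_gt0 bounded_flow; rewrite div1r in b1.
have [mH H0] := bounded_jump_laplace i.
have b2 : bounded_by (s1^-1 / s2) (fun w => jump_laplace i (J i 0%N w)).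
  split; last by move=> w; exact: H0.
  by apply: (measurableT_comp mH); exact: measurable_funPT.
have C0 : 0 <= (Lam / (s1 * s2) + (c2 / s1 + c1 / s2)) * h.
  by rewrite mulr_ge0// !addr_ge0// ?divr_ge0 ?mulr_ge0// ltW.
have := wint_dist (weight_ind (unit_count i)) b1 b2 _ C0; move=> /(_ _)/wrap[].
  move=> w; rewrite indicE; have [|_] := boolP (w \in _); last by rewrite eqxx.
  by rewrite inE => wB _; exact: lap2_flow_close.
move=> /le_trans; apply; rewrite mass_ind PBE ler_wpM2l// ler_piMr//.
  by rewrite mulr_ge0// rate_ge0.
by rewrite -expR0 ler_expR oppr_le0 mulr_ge0.
Qed.

End fixed_step.

(* A single shock of type i before time h sends z to z + drift s - jump, then
   reflects it, for some s <= h: up to O(h) this is reflecting z - jump. *)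
Lemma escape_one_step : exists2 K, 0 <= K & forall h, 0 < h -> h <= 1 ->
  `|lap2 q - expR (- (Lam * h)) * lap2 (fun z => q (z + drift h))
    - h * expR (- (Lam * h)) * \sum_(i < 3) rate i * wint mu (lapk 1) (jump_laplace i)|
  <= K * h ^+ 2.
Proof.
pose C := Lam / (s1 * s2) + (c2 / s1 + c1 / s2).
have C0 : 0 <= C.
  by rewrite !addr_ge0// ?divr_ge0 ?mulr_ge0// ltW.
exists (Lam ^+ 2 / (s1 * s2) + C * Lam) => [|h h_gt0 h1].
  by rewrite addr_ge0// ?(mulr_ge0 C0)// divr_ge0 ?sqr_ge0// mulr_ge0// ltW.
have h0 := ltW h_gt0; set e := expR (- (Lam * h)).
have bs n := bounded_step_part h0 n.
pose st i := part h (unit_count i).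
pose S z := st ord0 z + (st (lift ord0 ord0) z + st (lift ord0 (lift ord0 ord0)) z).
have bW (M : R) (f : R * R -> R) : bounded_by 1 f -> 1 <= M -> bounded_by M f.
  by move=> bf M1; exact: bounded_byW bf.
have bD (M : R) (f g : R * R -> R) : bounded_by M f -> bounded_by 1 g -> bounded_by (1 + M) (fun z : R * R => g z + f z).
  move=> [mf f0] [mg g0]; split=> [|z]; first exact: measurable_funD.
  by case/andP: (f0 z) => a1 a2; case/andP: (g0 z) => d1 d2; rewrite addr_ge0//= lerD.
have bst i : bounded_by 1 (st i) := bs (unit_count i).
have b2 := bD _ _ _ (bst (lift ord0 (lift ord0 ord0))) (bst (lift ord0 ord0)).
have bS := bD _ _ _ b2 (bst ord0).
have b0 := bs (fun=> 0%N).
have bT := bD _ _ _ bS b0.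
have one_le (x : R) : 0 <= x -> 1 <= 1 + x by rewrite lerDl.
have lapT : lap2 (fun z => part h (fun=> 0%N) z + S z) =
    e * lap2 (fun z => q (z + drift h)) + \sum_(i < 3) lap2 (st i).
  have l2 := lap2D s1_gt0 s2_gt0 (bst (lift ord0 ord0)) (bst (lift ord0 (lift ord0 ord0))).
  have l1 := lap2D s1_gt0 s2_gt0 (bW _ _ (bst ord0) (one_le _ ler01)) b2.
  have l0 := lap2D s1_gt0 s2_gt0 (bW _ _ b0 (one_le _ (addr_ge0 ler01 ler01))) bS.
  have l3 := lap2_step_no_jump h0.
  apply: (etrans l0); congr (_ + _); first exact: l3.
  apply: (etrans l1); rewrite sum_ord3; congr (_ + _); exact: l2.
have rest : `|lap2 q - lap2 (fun z => part h (fun=> 0%N) z + S z)| <=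
    (Lam * h) ^+ 2 / (s1 * s2).
  apply: (lap2_dist s1_gt0 s2_gt0 (M := 1 + (1 + (1 + 1))) _ bT) => //.
  - by apply: bW; [exact: bounded_escape_law|rewrite one_le// !addr_ge0].
  - exact: sqr_ge0.
  move=> z Qz; have := one_step_law c1_ge0 c2_ge0 r1_gt0 r2_gt0 r12 lam_ge0 lam1_ge0
    lam2_ge0 model reflected Qz h0.
  rewrite sum_ord3 -/e => /andP[low upp].
  have e1 : 1 - Lam * h <= e by have := expR_ge1Dx (- (Lam * h)).
  have Lh : 0 <= Lam * h by rewrite mulr_ge0.
  have : (1 - Lam * h) * (1 + Lam * h) <= e * (1 + Lam * h).
    by rewrite ler_wpM2r// addr_ge0.
  rewrite (_ : (1 - Lam * h) * (1 + Lam * h) = 1 - (Lam * h) ^+ 2); last by ring.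
  move=> e2; rewrite opprD addrA ger0_norm//.
  by apply: (le_trans upp); move: e2; lra.
have jumps : `|\sum_(i < 3) lap2 (st i)
    - h * e * \sum_(i < 3) rate i * wint mu (lapk 1) (jump_laplace i)| <= C * Lam * h ^+ 2.
  rewrite mulr_sumr -sumrB; apply: (le_trans (ler_norm_sum _ _ _)).
  rewrite -(sum_rate lam lam1 lam2) mulr_sumr mulr_suml; apply: ler_sum => i _.
  have := one_jump_close h0 i.
  rewrite (_ : rate i * h * expR (- (Lam * h)) * _ =
    h * e * (rate i * wint mu (lapk 1) (jump_laplace i))); last by rewrite /e; ring.
  by move=> /le_trans; apply; rewrite -/C le_eqVlt (_ : C * h * _ = C * rate i * h ^+ 2) ?eqxx//; ring.
rewrite lapT in rest.
set X := lap2 (fun z => q (z + drift h)) in rest *.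
set Sg := \sum_(i < 3) lap2 (st i) in rest jumps.
set L := \sum_(i < 3) rate i * _ in jumps *.
rewrite (_ : lap2 q - e * X - h * e * L = (lap2 q - (e * X + Sg)) + (Sg - h * e * L)); last by ring.
apply: (le_trans (ler_normD _ _)); rewrite mulrDl; apply: lerD jumps.
by move: rest; rewrite exprMn mulrAC.
Qed.

Theorem escape_kernel_equation :
  (Lam - (c1 * s1 + c2 * s2)) * lap2 q
  + c2 * wint mu (lapk s1) (fun u => q (u, 0))
  + c1 * wint mu (lapk s2) (fun v => q (0, v))
  = \sum_(i < 3) rate i * wint mu (lapk 1) (jump_laplace i).
Proof.
have [K K0 step] := escape_one_step.
apply: (kernel_limit s1_gt0 s2_gt0 c1_gt0 c2_gt0 Lam_ge0 bounded_escape_law _ K0 step).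
move=> z t Qz t0.
exact: (escape_law_lipschitz c1_ge0 c2_ge0 r1_gt0 r2_gt0 r12 lam_ge0 lam1_ge0
  lam2_ge0 model reflected Qz t0).
Qed.

Hypotheses (nz1 : 1 - r2 * s1 / q2 != 0) (nz2 : 1 - r1 * s2 / q1 != 0).

Local Notation p1 := (escape_prob1 P Y).
Local Notation F := (laplace2 p1 s1 s2).
Local Notation F1 := (laplace (fun u => p1 u 0)).
Local Notation F2 := (laplace (fun v => p1 0 v)).
Local Notation N := (1 + s1 * qb1^-1 + s2 * qb2^-1).
Local Notation psi5 := (lam2 / q2 / ((1 + s2 / q2) * (1 - r2 * s1 / q2))).
Local Notation psi6 := (lam1 / q1 / ((1 + s1 / q1) * (1 - r1 * s2 / q1))).

Let p1E u v : 0 <= u -> 0 <= v -> p1 u v = q (u, v).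
Proof.
by move=> u0 v0; exact: (escape_prob1E c1_ge0 c2_ge0 r1_gt0 r2_gt0 r12 model reflected (conj u0 v0)).
Qed.

Local Notation bq := bounded_escape_law.

Let F1E s : F1 s = wint mu (lapk s) (fun u => q (u, 0)).
Proof. by rewrite laplaceE; apply: wint_eq => u /lapk_neq0 u0; rewrite p1E. Qed.

Let F2E s : F2 s = wint mu (lapk s) (fun v => q (0, v)).
Proof. by rewrite laplaceE; apply: wint_eq => u /lapk_neq0 u0; rewrite p1E. Qed.

Let FE : F = lap2 q.
Proof. exact: laplace2E bq p1E. Qed.

Let jump_shock i a b : (forall j, single_jump q1 q2 qb1 qb2 i j = (j * a, j * b)) ->
  wint mu (lapk 1) (jump_laplace i) =
  shock s1 s2 a b (fun x => q (reflect_point r1 r2 x)).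
Proof. by move=> ab; apply: wint_eq => j _; congr double_laplace; apply/funext => z; rewrite /jump_target/= ab. Qed.

(** Common form of the three cases: each side contributes a chain of two differences, from s to [sg]
    and from [sg] to [t]. The last hypothesis evaluates the mass of the cone, the coefficient [K] of
    [p1 0 0], from these chains applied to the constant 1. *)
Lemma kernel_expansion (C1 C2 sg1 sg2 K1 K2 t1 t2 K : R) :
  0 < sg1 -> 0 < sg2 -> 0 < t1 -> 0 < t2 ->
  (forall g, bounded_by 1 g -> shock s1 s2 qb1^-1 qb2^-1 (side1 r1 r2 g) =
     laplace_diff C2 s2 sg2 g + laplace_diff K2 sg2 t2 g) ->
  (forall g, bounded_by 1 g -> shock s1 s2 qb1^-1 qb2^-1 (side2 r1 r2 g) =
     laplace_diff C1 s1 sg1 g + laplace_diff K1 sg1 t1 g) ->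
  (1 - N^-1) / (s1 * s2) - C2 * (s2^-1 - sg2^-1) - K2 * (sg2^-1 - t2^-1)
    - C1 * (s1^-1 - sg1^-1) - K1 * (sg1^-1 - t1^-1) = K ->
  (c1 * s1 + c2 * s2 - (lam + lam1 + lam2) + lam / N + lam1 / (1 + s1 / q1)
    + lam2 / (1 + s2 / q2)) * F =
  (c2 - psi5) * F1 s1 + (c1 - psi6) * F2 s2 + psi5 * F1 (q2 / r2) + psi6 * F2 (q1 / r1)
  - lam * (C2 * (F2 s2 - F2 sg2) + K2 * (F2 sg2 - F2 t2)
           + (C1 * (F1 s1 - F1 sg1) + K1 * (F1 sg1 - F1 t1))
           + K * p1 0 0).
Proof.
move=> sg10 sg20 t10 t20 D2 D1 <-.
have w s : 0 < s -> wint mu (lapk s) (fun=> 1) = s^-1.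
  by move=> s0; rewrite (wint_cst (weight_lapk s0) ler01) mass_lapk// mul1r.
have q1i : 0 < q1^-1 by rewrite invr_gt0.
have q2i : 0 < q2^-1 by rewrite invr_gt0.
have qb1i : 0 <= qb1^-1 by rewrite invr_ge0 ltW.
have qb2i : 0 <= qb2^-1 by rewrite invr_ge0 ltW.
pose L i := rate i * wint mu (lapk 1) (jump_laplace i).
have key : (lam + lam1 + lam2 - (c1 * s1 + c2 * s2)) * F + c2 * F1 s1 + c1 * F2 s2 =
    \sum_(i < 3) L i.
  rewrite FE F1E F2E.
  exact: escape_kernel_equation.
have L0 : L ord0 = lam * (F / N
    + (C2 * (F2 s2 - F2 sg2) + K2 * (F2 sg2 - F2 t2))
    + (C1 * (F1 s1 - F1 sg1) + K1 * (F1 sg1 - F1 t1))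
    + p1 0 0 * ((1 - N^-1) / (s1 * s2) - (C2 * (s2^-1 - sg2^-1) + K2 * (sg2^-1 - t2^-1))
              - (C1 * (s1^-1 - sg1^-1) + K1 * (sg1^-1 - t1^-1)))).
  have := shock_expansion s1_gt0 s2_gt0 qb1i qb2i r1_gt0 r2_gt0 r12
    (D1 := fun g => laplace_diff C2 s2 sg2 g + laplace_diff K2 sg2 t2 g)
    (D2 := fun g => laplace_diff C1 s1 sg1 g + laplace_diff K1 sg1 t1 g) bq D2 D1.
  rewrite /laplace_diff !w// => EX; rewrite FE !F1E !F2E p1E//.
  congr (_ * _); apply: etrans EX.
  by apply: jump_shock => j; rewrite /single_jump (tnth_nth 0).
have L1 : L (lift ord0 ord0) = lam1 * (F / (1 + s1 / q1)
    + q1^-1 / ((1 + s1 / q1) * (1 - r1 / q1 * s2)) * (F2 s2 - F2 (1 / (r1 / q1)))).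
  rewrite FE !F2E; congr (_ * _).
  apply: etrans (@jump_shock _ q1^-1 0 _) _.
    by move=> j; rewrite /single_jump (tnth_nth 0) mulr0.
  apply: (shock_expansion_first s1_gt0 s2_gt0 r1_gt0 r2_gt0 r12 q1i _ bq).
  by rewrite mulrAC.
have L2 : L (lift ord0 (lift ord0 ord0)) = lam2 * (F / (1 + s2 / q2)
    + q2^-1 / ((1 + s2 / q2) * (1 - r2 / q2 * s1)) * (F1 s1 - F1 (1 / (r2 / q2)))).
  rewrite FE !F1E; congr (_ * _).
  apply: etrans (@jump_shock _ 0 q2^-1 _) _.
    by move=> j; rewrite /single_jump (tnth_nth 0) mulr0.
  apply: (shock_expansion_second s1_gt0 s2_gt0 r1_gt0 r2_gt0 r12 q2i _ bq).
  by rewrite mulrAC.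
move: key; rewrite sum_ord3 L0 L1 L2.
rewrite (_ : 1 / (r1 / q1) = q1 / r1); last by rewrite div1r invf_div.
rewrite (_ : 1 / (r2 / q2) = q2 / r2); last by rewrite div1r invf_div.
rewrite (mulrAC r1) (mulrAC r2).
(* The identity is polynomial in the transforms and in the inverses, so all of them are generalized
   to free variables. *)
move: F (F1 s1) (F2 s2) (F1 (q2 / r2)) (F2 (q1 / r1)) (F1 sg1) (F1 t1) (F2 sg2) (F2 t2) (p1 0 0).
move: ((1 + s1 / q1) * _)^-1 ((1 + s2 / q2) * _)^-1 N^-1 (1 + s1 / q1)^-1 (1 + s2 / q2)^-1.
move: (s1 * s2)^-1 s1^-1 s2^-1 sg1^-1 sg2^-1 t1^-1 t2^-1 q1^-1 q2^-1.
move=> x1 x2 x3 x4 x5 x6 x7 x8 x9 y1 y2 y3 y4 y5 f f1 f2 f3 f4 f5 f6 f7 f8 p /eqP.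
rewrite -subr_eq0 => /eqP key; apply/eqP; rewrite -subr_eq0; apply/eqP.
by rewrite -[RHS]oppr0 -key; ring.
Qed.

Local Notation a := (qb1^-1).
Local Notation b := (qb2^-1).
Local Notation A := (r1 * a - b).
Local Notation B := (r2 * b - a).
Local Notation psi := (c1 * s1 + c2 * s2 - (lam + lam1 + lam2) + lam / N + lam1 / (1 + s1 / q1)
    + lam2 / (1 + s2 / q2)).
Local Notation C2 := (a / (N * (1 - A * s2))).
Local Notation C1 := (b / (N * (1 - B * s1))).
Hypotheses (nzA : 1 - A * s2 != 0) (nzB : 1 - B * s1 != 0).

Let a_gt0 : 0 < a. Proof. by rewrite invr_gt0. Qed.
Let b_gt0 : 0 < b. Proof. by rewrite invr_gt0. Qed.
Let r12' : 0 < r1 * r2 - 1. Proof. by rewrite subr_gt0. Qed.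
Let N_gt0 : 0 < N. Proof. by rewrite -addrA ltr_pwDl// addr_ge0// mulr_ge0// ltW. Qed.
Let r21 : 1 < r2 * r1. Proof. by rewrite mulrC. Qed.

Let side1_pos g : 0 < B -> bounded_by 1 g -> shock s1 s2 a b (side1 r1 r2 g) =
  laplace_diff C2 s2 ((r2 + B * s2) / ((r1 * r2 - 1) * a)) g.
Proof. by move=> B0; exact: shock_side1_positive. Qed.

Let side2_pos g : 0 < A -> bounded_by 1 g -> shock s1 s2 a b (side2 r1 r2 g) =
  laplace_diff C1 s1 ((r1 + A * s1) / ((r1 * r2 - 1) * b)) g.
Proof.
move=> A0 bg; rewrite shock_side2//.
rewrite (shock_side1_positive s2_gt0 s1_gt0 r1_gt0 r21 b_gt0 a_gt0 A0 nzB bg).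
by rewrite (mulrC r2 r1) addrAC.
Qed.

Lemma kernel_positive : 0 < A -> 0 < B ->
  psi * F = (c2 - lam * C1 - psi5) * F1 s1 + (c1 - lam * C2 - psi6) * F2 s2
    + lam * C1 * F1 ((r1 + A * s1) / ((r1 * r2 - 1) * b))
    + lam * C2 * F2 ((r2 + B * s2) / ((r1 * r2 - 1) * a))
    + psi5 * F1 (q2 / r2) + psi6 * F2 (q1 / r1)
    - lam * (A * B * (N + 1) + r1 * a ^+ 2 + r2 * b ^+ 2 - 2 * (a * b))
      / (N * (r1 + A * s1) * (r2 + B * s2)) * p1 0 0.
Proof.
move=> A0 B0.
have rA : 0 < r1 + A * s1 by rewrite addr_gt0// mulr_gt0.
have rB : 0 < r2 + B * s2 by rewrite addr_gt0// mulr_gt0.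
have sg1_gt0 : 0 < (r1 + A * s1) / ((r1 * r2 - 1) * b) by rewrite divr_gt0// mulr_gt0.
have sg2_gt0 : 0 < (r2 + B * s2) / ((r1 * r2 - 1) * a) by rewrite divr_gt0// mulr_gt0.
pose K := (A * B * (N + 1) + r1 * a ^+ 2 + r2 * b ^+ 2 - 2 * (a * b))
      / (N * (r1 + A * s1) * (r2 + B * s2)).
(* Each side has a single difference here: the second coefficients are 0 and their endpoints are set
   to the dummy value 1. *)
rewrite (kernel_expansion (C1 := C1) (C2 := C2) (K1 := 0) (K2 := 0) (K := K) sg1_gt0 sg2_gt0 ltr01 ltr01); first last.
- rewrite /K; move: a b a_gt0 b_gt0 nzA nzB rA rB N_gt0 => x y x0 y0 nzA' nzB' rA' rB' N0.
  by field; rewrite nzA' nzB' !gt_eqF.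
- by move=> g bg; rewrite laplace_diff0 addr0 side2_pos.
- by move=> g bg; rewrite laplace_diff0 addr0 side1_pos.
rewrite -(mulrA lam _ (_^-1)) -/K.
move: K (laplace _ s1) (laplace _ s2) (laplace _ (q2 / r2)) (laplace _ (q1 / r1)).
move: (laplace _ _) (laplace _ _) (p1 0 0) C1 C2 psi5 psi6 => f1 f2 p x1 x2 x5 x6 K g1 g2 g3 g4.
by ring.
Qed.

Lemma kernel_nonpositive2 : 0 < A -> B <= 0 ->
  psi * F = (c2 - lam * C1 - psi5) * F1 s1 + (c1 - lam * C2 - psi6) * F2 s2
    + lam * C1 * F1 ((r1 + A * s1) / ((r1 * r2 - 1) * b))
    + lam * (b / (N * (r1 + A * s1))) * F2 ((1 - B * s1) / ((r1 * r2 - 1) * b))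
    + psi5 * F1 (q2 / r2) + psi6 * F2 (q1 / r1)
    + lam * (A / ((r1 + A * s1) * (1 - A * s2))) * F2 (1 / A)
    - lam * ((r1 * r2 - 1) * b ^+ 2 / (N * (r1 + A * s1) * (1 - B * s1))) * p1 0 0.
Proof.
move=> A0 B0.
have rA : 0 < r1 + A * s1 by rewrite addr_gt0// mulr_gt0.
have nB : 0 < 1 - B * s1 by rewrite subr_gt0 (le_lt_trans _ ltr01)// mulr_le0_ge0// ltW.
have sg1_gt0 : 0 < (r1 + A * s1) / ((r1 * r2 - 1) * b) by rewrite divr_gt0// mulr_gt0.
have t2_gt0 : 0 < (1 - B * s1) / ((r1 * r2 - 1) * b) by rewrite divr_gt0// mulr_gt0.
have A1_gt0 : 0 < 1 / A by rewrite divr_gt0.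
pose K := (r1 * r2 - 1) * b ^+ 2 / (N * (r1 + A * s1) * (1 - B * s1)).
pose K2 := b / (N * (r1 + A * s1)).
rewrite (kernel_expansion (C1 := C1) (C2 := C2) (K1 := 0) (K2 := K2) (K := K) sg1_gt0 A1_gt0 ltr01 t2_gt0); first last.
- rewrite /K /K2; move: a b a_gt0 b_gt0 nzA rA nB A0 N_gt0 => x y x0 y0 nzA' rA' nB' A0' N0.
  by field; rewrite nzA' !gt_eqF.
- by move=> g bg; rewrite laplace_diff0 addr0 side2_pos.
- by move=> g bg; apply: shock_side1_nonpositive.
rewrite -/K -/K2.
(* The value of [F2] at 1 / A closes the first difference and opens the second, so its two
   coefficients combine. *)
have -> : A / ((r1 + A * s1) * (1 - A * s2)) = C2 - K2.
  rewrite /K2; move: a b nzA rA N_gt0 => x y nzA' rA' N0.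
  by field; rewrite nzA' !gt_eqF.
move: K K2 (laplace _ s1) (laplace _ s2) (laplace _ (q2 / r2)) (laplace _ (q1 / r1)).
move: (laplace _ _) (laplace _ _) (laplace _ (1 / A)) (p1 0 0) C1 C2 psi5 psi6.
move=> f1 f2 f0 p x1 x2 x5 x6 K K2 g1 g2 g3 g4.
by ring.
Qed.

Lemma kernel_nonpositive1 : A <= 0 -> 0 < B ->
  psi * F = (c2 - lam * C1 - psi5) * F1 s1 + (c1 - lam * C2 - psi6) * F2 s2
    + lam * C2 * F2 ((r2 + B * s2) / ((r1 * r2 - 1) * a))
    + lam * (a / (N * (r2 + B * s2))) * F1 ((1 - A * s2) / ((r1 * r2 - 1) * a))
    + psi5 * F1 (q2 / r2) + psi6 * F2 (q1 / r1)
    + lam * (B / ((r2 + B * s2) * (1 - B * s1))) * F1 (1 / B)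
    - lam * ((r1 * r2 - 1) * a ^+ 2 / (N * (r2 + B * s2) * (1 - A * s2))) * p1 0 0.
Proof.
move=> A0 B0.
have rB : 0 < r2 + B * s2 by rewrite addr_gt0// mulr_gt0.
have nA : 0 < 1 - A * s2 by rewrite subr_gt0 (le_lt_trans _ ltr01)// mulr_le0_ge0// ltW.
have sg2_gt0 : 0 < (r2 + B * s2) / ((r1 * r2 - 1) * a) by rewrite divr_gt0// mulr_gt0.
have t1_gt0 : 0 < (1 - A * s2) / ((r1 * r2 - 1) * a) by rewrite divr_gt0// mulr_gt0.
have B1_gt0 : 0 < 1 / B by rewrite divr_gt0.
pose K := (r1 * r2 - 1) * a ^+ 2 / (N * (r2 + B * s2) * (1 - A * s2)).
pose K1 := a / (N * (r2 + B * s2)).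
rewrite (kernel_expansion (C1 := C1) (C2 := C2) (K1 := K1) (K2 := 0) (K := K) B1_gt0 sg2_gt0 t1_gt0 ltr01); first last.
- rewrite /K /K1; move: a b a_gt0 b_gt0 nzB rB nA B0 N_gt0 => x y x0 y0 nzB' rB' nA' B0' N0.
  by field; rewrite nzB' !gt_eqF.
- move=> g bg; rewrite shock_side2//.
  rewrite (shock_side1_nonpositive s2_gt0 s1_gt0 r2_gt0 r1_gt0 r21 b_gt0 a_gt0 B0 A0 nzB bg).
  by rewrite (mulrC r2 r1) (addrAC 1).
- by move=> g bg; rewrite laplace_diff0 addr0 side1_pos.
rewrite -/K -/K1.
have -> : B / ((r2 + B * s2) * (1 - B * s1)) = C1 - K1.
  rewrite /K1; move: a b nzB rB N_gt0 => x y nzB' rB' N0.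
  by field; rewrite nzB' !gt_eqF.
move: K K1 (laplace _ s1) (laplace _ s2) (laplace _ (q2 / r2)) (laplace _ (q1 / r1)).
move: (laplace _ _) (laplace _ _) (laplace _ (1 / B)) (p1 0 0) C1 C2 psi5 psi6.
move=> f1 f2 f0 p x1 x2 x5 x6 K K1 g1 g2 g3 g4.
by ring.
Qed.

End escape_kernel.

(* For A, B > 0 the bracket multiplying p1 0 0 starts with A * B * (N + 1): the
   bracket is (r1 + A s1) B / qb1 + (r2 + B s2) A / qb2 expanded.  With
   A * B * N in its place the equation fails for every lam > 0. *)
Theorem proposition12 (R : realType) (d : measure_display)
  (T : measurableType d) (P : probability T R)
  (c1 c2 q1 q2 qb1 qb2 lam lam1 lam2 r1 r2 : R)
  (c1_gt0 : 0 < c1) (c2_gt0 : 0 < c2) (q1_gt0 : 0 < q1) (q2_gt0 : 0 < q2)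
  (qb1_gt0 : 0 < qb1) (qb2_gt0 : 0 < qb2) (lam_ge0 : 0 <= lam)
  (lam1_gt0 : 0 < lam1) (lam2_gt0 : 0 < lam2) (r1_gt0 : 0 < r1) (r2_gt0 : 0 < r2)
  (Ns : 'I_3 -> R -> T -> nat) (J : 'I_3 -> nat -> {RV P >-> R})
  (model : shock_model lam lam1 lam2 Ns J)
  (Y : R -> R -> T -> R -> R * R)
  (reflected : forall u v : R, 0 <= u -> 0 <= v -> forall w,
    reflected_path c1 c2 r1 r2 (free_process c1 c2 q1 q2 qb1 qb2 Ns J w) u v
      (Y u v w)) :
  let mu1 := c1 - lam / qb1 - lam1 / q1 in
  let mu2 := c2 - lam / qb2 - lam2 / q2 in
  let p1 := escape_prob1 P Y in
  let F := laplace2 p1 in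
  let F1 := laplace (fun u => p1 u 0) in
  let F2 := laplace (fun v => p1 0 v) in
  let A := r1 / qb1 - 1 / qb2 in
  let B := r2 / qb2 - 1 / qb1 in
  mu1 < 0 -> mu2 < 0 ->
  r1 * `|mu1| > `|mu2| -> r2 * `|mu2| > `|mu1| ->
  ~ (c1 = r2 * c2 /\ qb1 = qb2 / r2) ->
  ~ (c2 = r1 * c1 /\ qb2 = qb1 / r1) ->
  forall s1 s2 : R, 0 < s1 -> 0 < s2 ->
  (* the factors of the denominators that may vanish for positive arguments *)
  1 - B * s1 != 0 -> 1 - A * s2 != 0 ->
  1 - r2 * s1 / q2 != 0 -> 1 - r1 * s2 / q1 != 0 ->
  let N := 1 + s1 / qb1 + s2 / qb2 in
  let psi := c1 * s1 + c2 * s2 - (lam + lam1 + lam2)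
    + lam / (1 + s1 / qb1 + s2 / qb2) + lam1 / (1 + s1 / q1)
    + lam2 / (1 + s2 / q2) in
  let psi1 := c2 - (lam / qb2) / (N * (1 - B * s1))
    - (lam2 / q2) / ((1 + s2 / q2) * (1 - r2 * s1 / q2)) in
  let psi2 := c1 - (lam / qb1) / (N * (1 - A * s2))
    - (lam1 / q1) / ((1 + s1 / q1) * (1 - r1 * s2 / q1)) in
  let psi5 := (lam2 / q2) / ((1 + s2 / q2) * (1 - r2 * s1 / q2)) in
  let psi6 := (lam1 / q1) / ((1 + s1 / q1) * (1 - r1 * s2 / q1)) in
  [/\ A > 0 -> B > 0 ->
      psi * F s1 s2 = psi1 * F1 s1 + psi2 * F2 s2
        + (lam / qb2) / (N * (1 - B * s1))
          * F1 ((r1 + A * s1) / ((r1 * r2 - 1) / qb2))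
        + (lam / qb1) / (N * (1 - A * s2))
          * F2 ((r2 + B * s2) / ((r1 * r2 - 1) / qb1))
        + psi5 * F1 (q2 / r2) + psi6 * F2 (q1 / r1)
        - lam * (A * B * (N + 1) + r1 / qb1 ^+ 2 + r2 / qb2 ^+ 2
                 - 2 / (qb1 * qb2))
          / (N * (r1 + A * s1) * (r2 + B * s2)) * p1 0 0,
      A > 0 -> B <= 0 ->
      psi * F s1 s2 = psi1 * F1 s1 + psi2 * F2 s2
        + (lam / qb2) / (N * (1 - B * s1))
          * F1 ((r1 + A * s1) / ((r1 * r2 - 1) / qb2))
        + (lam / qb2) / (N * (r1 + A * s1))
          * F2 ((1 - B * s1) / ((r1 * r2 - 1) / qb2))
        + psi5 * F1 (q2 / r2) + psi6 * F2 (q1 / r1)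
        + lam * A / ((r1 + A * s1) * (1 - A * s2)) * F2 (1 / A)
        - (lam * (r1 * r2 - 1) / qb2 ^+ 2)
          / (N * (r1 + A * s1) * (1 - B * s1)) * p1 0 0
    & A <= 0 -> B > 0 ->
      psi * F s1 s2 = psi1 * F1 s1 + psi2 * F2 s2
        + (lam / qb1) / (N * (1 - A * s2))
          * F2 ((r2 + B * s2) / ((r1 * r2 - 1) / qb1))
        + (lam / qb1) / (N * (r2 + B * s2))
          * F1 ((1 - A * s2) / ((r1 * r2 - 1) / qb1))
        + psi5 * F1 (q2 / r2) + psi6 * F2 (q1 / r1)
        + lam * B / ((r2 + B * s2) * (1 - B * s1)) * F1 (1 / B)
        - (lam * (r1 * r2 - 1) / qb1 ^+ 2)
          / (N * (r2 + B * s2) * (1 - A * s2)) * p1 0 0].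

Proof.
move=> mu1 mu2 p1 F F1 F2 A B mu1_lt0 mu2_lt0 dom1 dom2 _ _ s1 s2 s1_gt0 s2_gt0
  nzB nzA nz1 nz2 N psi psi1 psi2 psi5 psi6.
(* The chain |mu1| < r2 |mu2| < r2 r1 |mu1|, divided by |mu1|, which is positive. *)
have r12 : 1 < r1 * r2.
  have m1 : 0 < `|mu1| by rewrite normr_gt0 lt_eqF.
  have dom : r2 * `|mu2| < r2 * (r1 * `|mu1|) by rewrite ltr_pM2l.
  have := lt_trans dom2 dom; rewrite mulrA (mulrC r2) -[X in X < _]mul1r.
  by rewrite ltr_pM2r.
have AE : A = r1 / qb1 - qb2^-1 by rewrite /A div1r.
have BE : B = r2 / qb2 - qb1^-1 by rewrite /B div1r.
move: nzA nzB; rewrite /psi1 /psi2 AE BE => {psi1 psi2 A AE B BE} nzA nzB.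
set A := r1 / qb1 - qb2^-1 in nzA *; set B := r2 / qb2 - qb1^-1 in nzB *.
split=> A_sign B_sign.
- rewrite (kernel_positive c1_gt0 c2_gt0 s1_gt0 s2_gt0 q1_gt0 q2_gt0 qb1_gt0 qb2_gt0
    r1_gt0 r2_gt0 r12 lam_ge0 (ltW lam1_gt0) (ltW lam2_gt0) model reflected
    nz1 nz2 nzA nzB A_sign B_sign).
  rewrite -/p1 -/F1 -/F2 -/psi5 -/psi6 -/A -/B -/N.
  by rewrite !exprVn -[qb1^-1 * qb2^-1]invfM !mulrA.
- rewrite (kernel_nonpositive2 c1_gt0 c2_gt0 s1_gt0 s2_gt0 q1_gt0 q2_gt0 qb1_gt0 qb2_gt0
    r1_gt0 r2_gt0 r12 lam_ge0 (ltW lam1_gt0) (ltW lam2_gt0) model reflected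
    nz1 nz2 nzA nzB A_sign B_sign).
  rewrite -/p1 -/F1 -/F2 -/psi5 -/psi6 -/A -/B -/N.
  by rewrite exprVn !mulrA.
- rewrite (kernel_nonpositive1 c1_gt0 c2_gt0 s1_gt0 s2_gt0 q1_gt0 q2_gt0 qb1_gt0 qb2_gt0
    r1_gt0 r2_gt0 r12 lam_ge0 (ltW lam1_gt0) (ltW lam2_gt0) model reflected
    nz1 nz2 nzA nzB A_sign B_sign).
  rewrite -/p1 -/F1 -/F2 -/psi5 -/psi6 -/A -/B -/N.
  by rewrite exprVn !mulrA.
Qed.
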